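(* There exists a constant $c>0$ such that for every positive integer $n$, if $\mathcal{H}$ is a $3$-uniform hypergraph on $n$ vertices which does not contain a triangulation of the torus, then $\mathcal{H}$ has at most $cn^{5/2}$ edges.
   Context: A $3$-uniform hypergraph $\mathcal{S}$ is identified with the simplicial complex formed by its edges and all their subsets. A $3$-uniform hypergraph $\mathcal{H}$ ''contains a triangulation of'' a topological space $X$ if some subhypergraph of $\mathcal{H}$ has associated simplicial complex homeomorphic to $X$. *)

(* Defs.v *)
From HB Require Import structures.
From mathcomp Require Import all_boot all_order all_algebra.
From mathcomp Require Import all_classical all_reals all_analysis.

Set Implicit Arguments.
Unset Strict Implicit.
Unset Printing Implicit Defensive.

Import Order.TTheory GRing.Theory Num.Theory.
Import numFieldNormedType.Exports.

Local Open Scope ring_scope.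

Definition uniform3 (V : finType) (H : {set {set V}}) : Prop :=
  forall e : {set V}, e \in H -> #|e| = 3%N.

Definition complex_of (V : finType) (S : {set {set V}}) : {set {set V}} :=
  [set f : {set V} | [exists e in S, f \subset e]]%SET.

Definition supp (R : realType) (n : nat) (x : 'rV[R]_n) : {set 'I_n} :=
  [set i | x ord0 i != 0]%SET.

(* Points are given by barycentric coordinates: vertex i is the i-th unit
   vector of R^n. The empty face contributes no point, as coordinates sum
   to 1. Vertices lying in no edge of S contribute no point either. *)
Definition realization (R : realType) (n : nat) (S : {set {set 'I_n}}) :
    set 'rV[R]_n :=
  [set x : 'rV[R]_n | [/\ forall i, 0 <= x ord0 i,
               \sum_i x ord0 i = 1
             & supp x \in complex_of S]]%classic.
Arguments realization R {n} S.

Definition homeomorphic (X Y : topologicalType) : Prop :=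
  exists (f : X -> Y) (g : Y -> X),
    [/\ continuous f, continuous g, cancel f g & cancel g f].

Definition circle (R : realType) : set (R * R) :=
  [set z : R * R | z.1 ^+ 2 + z.2 ^+ 2 = 1]%classic.
Arguments circle R : clear implicits.

(* Sets are coerced to their subtypes, which carry the subset topology. *)
Definition torus (R : realType) : topologicalType :=
  (circle R * circle R)%type.

Definition contains_triangulation (R : realType) (n : nat)
    (H : {set {set 'I_n}}) (X : topologicalType) : Prop :=
  exists2 S : {set {set 'I_n}},
    S \subset H & homeomorphic (set_type (realization R S)) X.

(* Main.v *)
(** Write [G_aa'] for the common link graph of two vertices [a], [a'].  If
    [abc] and [a'bc] are edges of the hypergraph, the quadrilateral [a b a' c]
    bounds the disc consisting of these two triangles; if moreover [b] and [c]
    are joined by another path in [G_aa'], coning this path from [a] and [a']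
    gives a second filling (a lens) whose interior vertices are new.  A graph
    with [v] vertices has fewer than [v] bridges.  Since there are [C n^(5/2)]
    edges, a typical [G_aa'] has many more than [n] edges, so for a typical pair
    of edges [abc], [a'bc] a random sparse set of vertices contains the interior
    of such a path with probability close to one; hence boundedly many lenses
    can be made disjoint by a random colouring.

    It remains to find a closed walk on edges, each step replacing one vertex,
    that introduces distinct vertices: the lenses of its steps then form a
    torus swept out by the triangles of the walk.  Steps are weighted by the
    symmetric kernels "replace the vertex of a given colour uniformly", in the
    periodic order A B C C B A, so that the weight [zeta j] of the closed walks
    of length [6 j] is a Hilbert-Schmidt norm.  A Cauchy-Schwarz argument bounds
    the weight of the walks with a repeated vertex by [O(n^(-1/4)) zeta (j-1)].
    As [zeta 0 = n^3] while [zeta 13] is bounded below, some [j <= 13] admits a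
    closed walk without repetition.  Its vertices form a triangulated grid, the
    product of a cycle and a triangle, of which the union of the lenses is an
    iterated stellar subdivision. *)
Require Import Defs.
From mathcomp Require Import all_boot all_order all_algebra.
From mathcomp Require Import ring lra zify.

Set Implicit Arguments.
Unset Strict Implicit.
Unset Printing Implicit Defensive.

Import Order.TTheory GRing.Theory Num.Theory.

(** * Bridges and random colourings *)

Section Link.
Variable n : nat.
Local Notation V := 'I_n.
Implicit Types (g : rel V) (W : {set V}) (b c : V).

(** The exponent 5/2 balances available steps against obstructions. Each of the n^2 common link
    graphs has O(n) edges unsafe for a lens, so O(n^3) pairs of edges of the hypergraph are
    unusable; C n^(5/2) edges, spread over n^2 pairs of vertices, form at least about C^2 n^3 pairs
    sharing two vertices. For large C one can therefore pass to a set of edges in which every step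
    has at least d choices, d of order n^(1/2), half of them usable. A newly chosen vertex hits a
    prescribed one with probability at most 1/d, and Cauchy-Schwarz keeps the square root of this,
    n^(-1/4); twelve such gains cancel n^3, whence the 13. There are at most 6 * 13 = 78 lenses, and
    all constants depend on this number alone.

    The obstacle is that the walk must close up: conditioning on this makes its steps dependent and
    ruins a direct estimate. Comparing [zeta j] with [zeta (j-1)] avoids any bound for a particular
    return probability; it is enough that not all these ratios can be small. *)

Definition link_rel g W b c : rel V :=
  [rel x y | [&& g x y, x \in b |: (c |: W), y \in b |: (c |: W),
                (x, y) != (b, c) & (x, y) != (c, b)]].

Definition linked g W b c := connect (link_rel g W b c) b c.

Lemma link_rel_sym g W b c : symmetric g -> symmetric (link_rel g W b c).
Proof.
move=> gs x y; rewrite /link_rel /= gs; congr (_ && _).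
rewrite !xpair_eqE (andbC (y == b)) (andbC (y == c)).
by case: (x \in _); case: (y \in _) => //=; rewrite andbC.
Qed.

Lemma linkedC g W b c : symmetric g -> linked g W b c = linked g W c b.
Proof.
move=> gs; rewrite /linked (sym_connect_sym (link_rel_sym _ _ _ gs)).
apply: eq_connect => x y; rewrite /link_rel /=.
by rewrite setUCA; congr [&& _, _, _ & _]; rewrite andbC.
Qed.

Lemma eq_linked g g' W b c : g =2 g' -> linked g W b c = linked g' W b c.
Proof. by move=> e; apply: eq_connect => x y; rewrite /link_rel /= e. Qed.

Lemma path_all (T : Type) (e : rel T) (a : pred T) x p :
  (forall y z, e y z -> a z) -> path e x p -> all a p.
Proof. by move=> h; elim: p x => //= y p IH x /andP[/h -> /IH]. Qed.

(** Once the path is freed of repetitions, [b] and [c] cannot recur inside it, so its interior lies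
    in [W]; the interior is nonempty because [link_rel] leaves out the edge [bc] itself. *)
Lemma linked_path g W b c : b != c -> linked g W b c ->
  exists ps : seq V, [/\ ps != [::], path g b (rcons ps c), uniq ps &
     [/\ {subset ps <= W}, b \notin ps & c \notin ps]].
Proof.
move=> bc /connectP [p0 pp lp].
case/shortenP: pp lp => p pth un _ lp.
case/lastP: p pth un lp => [|ps z]; first by move=> _ _ /= e; rewrite e eqxx in bc.
rewrite last_rcons => pth un cz; subst z.
move: un; rewrite cons_uniq mem_rcons inE rcons_uniq negb_or => /andP[/andP[_ bp] /andP[cp up]].
exists ps; split=> //.
- by case: ps pth bp cp up => [|//] /=; rewrite /link_rel /= !eqxx /= !andbF.
- by apply: sub_path pth => x y; rewrite /link_rel /= => /andP[].
split=> // z zp.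
have zb : z != b by apply: contraNneq bp => <-.
have zc : z != c by apply: contraNneq cp => <-.
have /allP/(_ z) : all (fun y => y \in b |: (c |: W)) (rcons ps c).
  by apply: path_all pth => y t; rewrite /link_rel /= => /and4P[].
by rewrite mem_rcons inE zp orbT !inE (negbTE zb) (negbTE zc); apply.
Qed.

Definition bridges g W : {set V * V} :=
  [set p : V * V | [&& (p.1 < p.2)%N, p.1 \in W, p.2 \in W, g p.1 p.2 & ~~ linked g W p.1 p.2]].

(* The indicator of the side of a bridge is constant along every other edge, so
   these indicators are dual to the boundaries of the bridges. *)
Lemma bridges_card g W : symmetric g -> (#|bridges g W| <= n)%N.
Proof.
move=> gs; pose B := bridges g W.
pose pt (i : 'I_#|B|) : V * V := enum_val i.
pose e i := link_rel g W (pt i).1 (pt i).2.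
pose M1 : 'M[rat]_(#|B|, n) := (\matrix_(i, v) (connect (e i) (pt i).1 v)%:R)%R.
pose M2 : 'M[rat]_(n, #|B|) := (\matrix_(v, j) ((v == (pt j).1)%:R - (v == (pt j).2)%:R))%R.
(* Row [i] of [M1] is the side of bridge [i] containing its first end, column [j] of [M2] the
   boundary of bridge [j]. Their product is the identity of size [#|B|], which cannot factor through
   a dimension smaller than [#|B|]. *)
apply: (@mulmx1_min rat _ _ M1 M2); apply/matrixP => i j; rewrite !mxE.
have -> : (\sum_v M1 i v * M2 v j = M1 i (pt j).1 - M1 i (pt j).2)%R.
  under eq_bigr do rewrite [M2 _ _]mxE mulrBr.
  have dl (u : V) : (\sum_v M1 i v * (v == u)%:R = M1 i u)%R.
    by rewrite (bigD1 u) //= eqxx mulr1 big1 ?addr0 // => v /negbTE ->; rewrite mulr0.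
  by rewrite sumrB !dl.
rewrite !mxE; have := enum_valP j; rewrite inE -/(pt j) => /and5P[lj j1 j2 gj _].
have [<-{j lj j1 j2 gj}|ij] := eqVneq i j.
  have := enum_valP i; rewrite inE -/(pt i) => /and5P[_ _ _ _].
  by rewrite connect0 /linked -/(e i) => /negbTE ->; rewrite subr0.
suff -> : connect (e i) (pt i).1 (pt j).1 = connect (e i) (pt i).1 (pt j).2 by rewrite subrr.
apply: same_connect_r; first exact: sym_connect_sym (link_rel_sym _ _ _ gs).
apply: connect1; rewrite /e /link_rel /= gj !inE j1 j2 !orbT /=.
have := enum_valP i; rewrite inE -/(pt i) => /and5P[li _ _ _ _].
(* Bridges are stored with the smaller end first, so [pt j] is neither [pt i] nor its reverse and
   survives as an edge of [e i]. *)
have nij : pt i != pt j by apply: contraNneq ij => /enum_val_inj ->.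
move: nij lj li; case: (pt i) => a1 a2; case: (pt j) => b1 b2 /= nij lj li.
rewrite eq_sym nij /=; apply/negP => /eqP[e1 e2].
by move: lj li; rewrite e1 e2; lia.
Qed.

Variable q : nat.
Local Notation C := {ffun V -> 'I_q}.
Implicit Types (chi : C) (i : 'I_q).

Definition colour_class chi i : {set V} := [set v | chi v == i].
Definition unlinked g i b c : {set C} := [set chi | ~~ linked g (colour_class chi i) b c].

(** The colours of [b] and [c] do not influence whether the two are linked, since both vertices are
    added to the class anyway. Overwriting these two colours by [i] is thus at most
    [q * q]-to-one. *)
Lemma unlinked_fibre g i b c :
  (#|unlinked g i b c| <= q * q * #|[set chi in unlinked g i b c | (chi b == i) && (chi c == i)]|)%N.
Proof.
pose D := [set chi in unlinked g i b c | (chi b == i) && (chi c == i)].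
pose upd (chi : C) : C := [ffun v => if (v == b) || (v == c) then i else chi v].
pose f (chi : C) := (chi b, chi c, upd chi).
have fi : injective f.
  move=> c1 c2 [e1 e2 /ffunP e3]; apply/ffunP => v.
  have := e3 v; rewrite !ffunE; case: eqP => [->//|_]; case: eqP => [->//|_] //.
rewrite -(card_imset _ fi) -/D.
apply: leq_trans (_ : #|setX [set: 'I_q * 'I_q] D| <= _)%N; last first.
  by rewrite cardsX cardsT card_prod !card_ord.
apply/subset_leq_card/fintype.subsetP => _ /imsetP[chi ch ->].
rewrite !inE /= !ffunE !eqxx ?orbT /= ?andbT.
move: ch; rewrite inE.
suff -> : linked g (colour_class (upd chi) i) b c = linked g (colour_class chi i) b c by rewrite eqxx andbT.
apply: eq_connect => x y; rewrite /link_rel /=.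
rewrite !inE !ffunE.
by case: (x == b); case: (x == c); case: (y == b); case: (y == c).
Qed.

(** After exchanging the sums: for a fixed colouring, the unlinked edges with both ends of colour
    [i] are bridges of that colour class, hence at most [n]. *)
Lemma unlinked_sum g i : symmetric g ->
  (\sum_(p : V * V | (p.1 < p.2)%N && g p.1 p.2) #|unlinked g i p.1 p.2|
     <= q ^ 2 * (n * q ^ n))%N.
Proof.
move=> gs.
apply: leq_trans (_ : \sum_(p : V * V | (p.1 < p.2)%N && g p.1 p.2)
   (q * q * #|[set chi in unlinked g i p.1 p.2 | (chi p.1 == i) && (chi p.2 == i)]|) <= _)%N.
  by apply: leq_sum => p _; apply: unlinked_fibre.
rewrite -big_distrr /= mulnn leq_mul2l; apply/orP; right.
under eq_bigr do rewrite -sum1_card big_mkcond /=.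
rewrite exchange_big /=.
apply: leq_trans (_ : \sum_(chi : C) n <= _)%N; last first.
  by rewrite sum_nat_const card_ffun !card_ord mulnC.
apply: leq_sum => chi _; apply: leq_trans (bridges_card (colour_class chi i) gs).
rewrite -sum1_card big_mkcond [X in (_ <= X)%N]big_mkcond /=.
apply: leq_sum => -[b c] _ /=; rewrite !inE /=.
by case: (b < c)%N; case: (g b c); case: (linked _ _ _ _); case: (chi b == i); case: (chi c == i).
Qed.

Variable M : nat.

(** Failure probability at least [1/M] under a uniform colouring. All colours are considered because
    the colour of a lens is assigned only after the whole walk is known. *)
Definition fragile g b c := [exists i, q ^ n <= M * #|unlinked g i b c|]%N.

Lemma fragileC g b c : symmetric g -> fragile g b c = fragile g c b.
Proof.
move=> gs; apply: eq_existsb => i; congr (_ <= _ * #|pred_of_set _|)%N.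
by apply/setP => chi; rewrite !inE linkedC.
Qed.

Lemma eq_fragile g g' b c : g =2 g' -> fragile g b c = fragile g' b c.
Proof.
move=> e; apply: eq_existsb => i; congr (_ <= _ * #|pred_of_set _|)%N.
by apply/setP => chi; rewrite !inE (eq_linked _ _ _ e).
Qed.

(** Markov's inequality for each of the [q] colours; the factor 2 restores both orders of an edge,
    as [unlinked_sum] runs over [p.1 < p.2]. *)
Lemma fragile_count g : (0 < q)%N -> symmetric g -> irreflexive g ->
  (#|[set p : V * V | g p.1 p.2 && fragile g p.1 p.2]| <= 2 * (M * q ^ 3) * n)%N.
Proof.
move=> q0 gs gi.
pose B1 := [set p : V * V | [&& (p.1 < p.2)%N, g p.1 p.2 & fragile g p.1 p.2]].
have h1 : (#|B1| <= M * q ^ 3 * n)%N.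
  have qn : (0 < q ^ n)%N by rewrite expn_gt0 q0.
  rewrite -(leq_pmul2r qn) -sum_nat_const.
  apply: leq_trans (_ : \sum_i \sum_(p : V * V | (p.1 < p.2)%N && g p.1 p.2) M * #|unlinked g i p.1 p.2| <= _)%N.
    rewrite exchange_big /= big_mkcond [X in (_ <= X)%N]big_mkcond /=.
    apply: leq_sum => p _; rewrite inE andbA; case: ifP => [/andP[-> /existsP[i hi]]|_ //].
    by rewrite (bigD1 i) //=; apply: leq_trans hi (leq_addr _ _).
  apply: leq_trans (_ : \sum_(i : 'I_q) M * (q ^ 2 * (n * q ^ n)) <= _)%N.
    by apply: leq_sum => i _; rewrite -big_distrr /= leq_mul2l unlinked_sum ?orbT.
  rewrite sum_nat_const card_ord; apply: eq_leq; rewrite (expnS q 2); ring.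
pose sw (p : V * V) := (p.2, p.1).
apply: leq_trans (_ : #|B1 :|: (sw @: B1)| <= _)%N.
  apply/subset_leq_card/fintype.subsetP => -[b c]; rewrite !inE /= => /andP[gbc bad].
  case: (ltngtP b c) => h.
  - by rewrite gbc bad.
  - by apply/orP; right; apply/imsetP; exists (c, b); rewrite // inE /= h gs gbc fragileC.
  - by move: gbc; rewrite (val_inj h) gi.
apply: leq_trans (leq_card_setU _ _) _.
rewrite -mulnA mul2n -addnn; apply: leq_add => //.
exact: leq_trans (leq_imset_card sw (mem B1)) h1.
Qed.

End Link.

(** * One colouring for all lenses *)

Section ChooseColouring.
Variables (n q : nat).
Local Notation V := 'I_n.

(** Union bound with [Q = q + 1] colours. All of [Z] receives colour 0 with probability at least
    [Q^(-Q)], while the at most [q] linking failures have total probability at most [q / M]. The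
    choice [M = Q^(Q+1)] makes the latter smaller. *)
Lemma choose_colouring (I : finType) (g : I -> rel V) (b c : I -> V)
    (col : I -> 'I_q.+1) (Z : {set V}) :
  (#|I| <= q)%N -> (#|Z| <= q.+1)%N ->
  (forall i, ~~ fragile q.+1 (q.+1 ^ (q.+2)) (g i) (b i) (c i)) ->
  exists chi : {ffun V -> 'I_q.+1}, (forall z, z \in Z -> chi z = ord0) /\
    forall i, linked (g i) (colour_class chi (col i)) (b i) (c i).
Proof.
move=> cI cZ nb; set Q := q.+1; pose M := (Q ^ q.+2)%N.
pose A := [set chi : {ffun V -> 'I_Q} | [forall z in Z, chi z == ord0]].
pose B := \bigcup_i unlinked (g i) (col i) (b i) (c i).
have [AB|/fintype.subsetPn[chi]] := boolP (A \subset B); last first.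
  rewrite inE => /forall_inP hA nB; exists chi; split=> [z /hA/eqP//|i].
  by apply: contraNT nB => nl; apply/bigcupP; exists i; rewrite // inE.
exfalso.
have cA : (#|A| * Q ^ #|Z| = Q ^ n)%N.
  have -> : #|A| = (\prod_(v : V) (if v \in Z then 1 else Q))%N.
    rewrite -(eq_card (A := family (fun v : V => if v \in Z then pred1 (ord0 : 'I_Q) else predT))).
      rewrite card_family /image_mem foldrE big_map big_enum /=; apply: eq_bigr => v _.
      by case: ifP => _; rewrite ?card1 // card_ord.
    move=> chi; rewrite [RHS]inE; apply/familyP/forall_inP => h v.
      by move=> vZ; have := h v; rewrite vZ inE.
    by case: ifP => // vZ; rewrite inE h.
  rewrite (bigID (mem Z)) /= big1 ?mul1n; last by move=> v ->.
  rewrite (eq_bigr (fun=> Q)); last by move=> v /negbTE ->.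
  rewrite prod_nat_const -expnD; congr (_ ^ _)%N.
  by rewrite addnC -[RHS]card_ord -(cardC (mem Z)).
have MB : (M * #|B| <= q * Q ^ n)%N.
  apply: leq_trans (_ : M * \sum_i #|unlinked (g i) (col i) (b i) (c i)| <= _)%N.
    rewrite leq_mul2l; apply/orP; right.
    rewrite /B; elim/big_ind2: _ => [|x X y Y hx hy|//]; first by rewrite cards0.
    by apply: leq_trans (leq_card_setU _ _) _; apply: leq_add.
  rewrite big_distrr /=.
  apply: leq_trans (_ : \sum_(i : I) Q ^ n <= _)%N; last first.
    by rewrite sum_nat_const leq_mul2r cI orbT.
  apply: leq_sum => i _; have := nb i; rewrite negb_exists => /forallP/(_ (col i)).
  by rewrite -ltnNge => /ltnW.
have h : (M * Q ^ n <= q * Q ^ Q * Q ^ n)%N.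
  rewrite -{1}cA mulnA.
  apply: leq_trans (_ : M * #|B| * Q ^ #|Z| <= _)%N.
    by rewrite leq_mul2r leq_mul2l subset_leq_card ?orbT.
  apply: leq_trans (_ : q * Q ^ n * Q ^ Q <= _)%N; last by rewrite mulnAC.
  by apply: leq_mul => //; apply: leq_pexp2l.
move: h; rewrite leq_pmul2r ?expn_gt0 // /M expnS leq_pmul2r ?expn_gt0 //.
by rewrite /Q ltnn.
Qed.

End ChooseColouring.

Local Open Scope ring_scope.

(** * Kernels and closed walks *)

Section Kernels.
Variables (R : realFieldType) (X : finType).
Implicit Types A B C : X -> X -> R.

Definition kone : X -> X -> R := fun x y => (x == y)%:R.
Definition kmul A B : X -> X -> R := fun x z => \sum_y A x y * B y z.
Definition ktr A : R := \sum_x A x x.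
Definition hs A : R := \sum_x \sum_y A x y ^+ 2.

Lemma sum_kone (x : X) (f : X -> R) : \sum_y kone x y * f y = f x.
Proof.
rewrite (bigD1 x) //= /kone eqxx mul1r big1 ?addr0 // => y.
by rewrite eq_sym => /negbTE ->; rewrite mul0r.
Qed.

Lemma kmul1 A x y : kmul kone A x y = A x y.
Proof. exact: (sum_kone x (fun z => A z y)). Qed.

Lemma kmulA A B C x y : kmul A (kmul B C) x y = kmul (kmul A B) C x y.
Proof.
rewrite /kmul; under eq_bigr do rewrite big_distrr /=.
rewrite exchange_big /=; apply: eq_bigr => z _.
by rewrite big_distrl /=; apply: eq_bigr => t _; rewrite mulrA.
Qed.

Lemma eq_kmul A A' B B' : A =2 A' -> B =2 B' -> kmul A B =2 kmul A' B'.
Proof. by move=> eA eB x y; apply: eq_bigr => z _; rewrite eA eB. Qed.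

Lemma eq_ktr A B : A =2 B -> ktr A = ktr B.
Proof. by move=> e; apply: eq_bigr => x _; rewrite e. Qed.

Lemma eq_hs A B : A =2 B -> hs A = hs B.
Proof. by move=> e; apply: eq_bigr => x _; apply: eq_bigr => y _; rewrite e. Qed.

Lemma ktrC A B : ktr (kmul A B) = ktr (kmul B A).
Proof.
rewrite /ktr /kmul exchange_big; apply: eq_bigr => y _.
by apply: eq_bigr => x _; rewrite mulrC.
Qed.

Lemma hs_tr A : hs A = ktr (kmul A (fun x y => A y x)).
Proof. by apply: eq_bigr => x _; apply: eq_bigr => y _; rewrite expr2. Qed.

Lemma hs_transpose A : hs (fun x y => A y x) = hs A.
Proof. by rewrite /hs exchange_big. Qed.

Lemma hs_ge0 A : 0 <= hs A.
Proof. by apply: sumr_ge0 => x _; apply: sumr_ge0 => y _; apply: sqr_ge0. Qed.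

Lemma hs_kone : hs kone = #|X|%:R.
Proof.
rewrite /hs -sum1_card natr_sum; apply: eq_bigr => x _.
rewrite (eq_bigr (fun y => kone x y * kone x y)); last by move=> y _; rewrite expr2.
by rewrite sum_kone /kone eqxx.
Qed.

End Kernels.

(** * Cauchy-Schwarz inequalities *)

Section CauchySchwarz.
Variables (R : realFieldType) (I : finType).

Lemma cauchy_schwarz_sum (f g : I -> R) :
  (\sum_i f i * g i) ^+ 2 <= (\sum_i f i ^+ 2) * (\sum_i g i ^+ 2).
Proof.
set F := \sum_i f i ^+ 2; set G := \sum_i g i ^+ 2; set P := \sum_i _.
have G0 : 0 <= G by apply: sumr_ge0 => i _; apply: sqr_ge0.
have [Gp|] := ltrP 0 G; last first.
  move=> Gle; have /eqP : G = 0 by apply: le_anti; rewrite Gle.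
  rewrite psumr_eq0; last by move=> i _; apply: sqr_ge0.
  move/allP => g0; rewrite /P big1 => [|i _].
    by rewrite expr0n /= mulr_ge0 // sumr_ge0 // => i _; apply: sqr_ge0.
  have := g0 i (mem_index_enum i); rewrite /= sqrf_eq0 => /eqP ->.
  by rewrite mulr0.
have : 0 <= \sum_i (G * f i - P * g i) ^+ 2.
  by apply: sumr_ge0 => i _; apply: sqr_ge0.
have -> : \sum_i (G * f i - P * g i) ^+ 2 = G ^+ 2 * F - G * P ^+ 2.
  transitivity (\sum_i (G ^+ 2 * (f i ^+ 2) + (- (2 * G * P)) * (f i * g i)
                 + P ^+ 2 * (g i ^+ 2))).
    by apply: eq_bigr => i _; ring.
  rewrite !big_split /= -!big_distrr /= -/F -/G -/P; ring.
have -> : G ^+ 2 * F - G * P ^+ 2 = G * (F * G - P ^+ 2) by ring.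
by rewrite pmulr_rge0 // subr_ge0.
Qed.

(* The weight [u] redistributes a factor between the two sums; where it
   vanishes, so must [w], and Rocq's [0^-1 = 0] does no harm. *)
Lemma weighted_cauchy_schwarz (w c g u : I -> R) :
  (forall i, 0 <= w i) -> (forall i, 0 <= u i) ->
  (forall i, c i ^+ 2 = c i) -> (forall i, u i = 0 -> w i = 0) ->
  (\sum_i w i * c i * g i) ^+ 2 <=
  (\sum_i w i * c i * u i) * (\sum_i w i * g i ^+ 2 / u i).
Proof.
move=> w0 u0 c2 uw.
have [|n] := boolP [forall i, w i == 0].
  move/forallP => h; rewrite big1 ?expr0n /=; last by move=> i _; rewrite (eqP (h i)) !mul0r.
  by rewrite big1 ?mul0r // => i _; rewrite (eqP (h i)) !mul0r.
(* no square roots are available, hence a discriminant argument *)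
set P := \sum_i _; set F := \sum_i w i * c i * u i; set G := \sum_i _.
have c0 i : 0 <= c i by rewrite -c2 sqr_ge0.
have F0 : 0 <= F by apply: sumr_ge0 => i _; rewrite !mulr_ge0.
have key t : 0 <= t ^+ 2 * F - 2 * t * P + G.
  have -> : t ^+ 2 * F - 2 * t * P + G =
     \sum_i (t ^+ 2 * (w i * c i * u i) + (- (2 * t)) * (w i * c i * g i)
       + w i * g i ^+ 2 / u i).
    by rewrite !big_split /= -!big_distrr /= -/F -/G -/P; ring.
  apply: sumr_ge0 => i _; have [ui|ui] := eqVneq (u i) 0.
    by rewrite (uw _ ui) !mul0r !mulr0 !add0r.
  have up : 0 < u i by rewrite lt_def ui u0.
  (* The summand is [w / u] times a square, up to a multiple of [c - c^2], which vanishes. *)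
  have -> : t ^+ 2 * (w i * c i * u i) + (- (2 * t)) * (w i * c i * g i)
       + w i * g i ^+ 2 / u i =
       w i / u i * ((t * c i * u i - g i) ^+ 2 + (c i - c i ^+ 2) * t ^+ 2 * u i ^+ 2).
    by field.
  by rewrite c2 subrr !mul0r addr0 mulr_ge0 ?divr_ge0 ?sqr_ge0.
have [Fp|] := ltrP 0 F.
  have := key (P / F).
  have -> : (P / F) ^+ 2 * F - 2 * (P / F) * P + G = G - P ^+ 2 / F.
    by field; rewrite gt_eqF.
  by rewrite subr_ge0 ler_pdivrMr // mulrC.
move=> Fle; have F00 : F = 0 by apply: le_anti; rewrite Fle.
have -> : P = 0; last by rewrite expr0n /= F00 mul0r.
rewrite /P big1 // => i _.
have : w i * c i * u i == 0.
  move/eqP: F00; rewrite psumr_eq0; last by move=> j _; rewrite !mulr_ge0.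
  by move/allP/(_ i (mem_index_enum i)).
by rewrite mulf_eq0 => /orP[/eqP->|/eqP/uw ->]; rewrite ?mul0r.
Qed.

End CauchySchwarz.

(** * Substochastic kernels and the conflict estimate *)

Section Markov.
Variables (R : realFieldType) (X : finType).
Implicit Types A B E W T : X -> X -> R.

(** Each entry of the product combines entries of [A] with weights of total at most 1, by the column
    sums; Cauchy-Schwarz moves the square inside, and the row sums absorb the summation over the end
    point. *)
Lemma hs_mulr A T :
  (forall x y, 0 <= T x y) -> (forall y, \sum_x T x y <= 1) ->
  (forall x, \sum_y T x y <= 1) -> hs (kmul A T) <= hs A.
Proof.
move=> T0 Tc Tr; apply: ler_sum => x _.
apply: (@le_trans _ _ (\sum_z \sum_y A x y ^+ 2 * T y z)).
  apply: ler_sum => z _; rewrite /kmul.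
  have := @weighted_cauchy_schwarz R X (fun y => T y z) (fun=> 1) (fun y => A x y) (fun=> 1).
  move=> /(_ (fun y => T0 y z) (fun=> ler01) (fun=> expr1n _ _)).
  move=> /(_ (fun _ h => False_ind _ (elimN eqP (oner_neq0 R) h))).
  rewrite (eq_bigr (fun y => A x y * T y z)); last by move=> y _; rewrite mulr1 mulrC.
  move/le_trans; apply.
  rewrite (eq_bigr (fun y => T y z)); last by move=> y _; rewrite !mulr1.
  rewrite [X in _ * X](eq_bigr (fun y => A x y ^+ 2 * T y z)); last first.
    by move=> y _; rewrite divr1 mulrC.
  by rewrite ler_piMl ?sumr_ge0 // => y _; rewrite mulr_ge0 ?sqr_ge0.
rewrite exchange_big /=; apply: ler_sum => y _.
by rewrite -big_distrr /= ler_piMr ?sqr_ge0.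
Qed.

(* Conditioning on the state just before the last step of the segment leaves
   the event [c] with probability at most [s] under one further step. *)
Lemma conflict_bound (E A T W : X -> X -> R) (c : X -> X -> bool) (s : R) :
  0 <= s ->
  (forall x y, 0 <= E x y) -> (forall x y, 0 <= A x y) ->
  (forall x y, 0 <= T x y) -> (forall y, \sum_x T x y <= 1) ->
  (forall x y, \sum_z T y z * (c x z)%:R <= s) ->
  (\sum_x \sum_z kmul A T x z * kmul W E z x * (c x z)%:R) ^+ 2
   <= s * hs (kmul E A) * hs W.
Proof.
move=> s0 E0 A0 T0 Tc Ts.
(* With [u] as redistributing weight both factors collapse: summing over [x] turns [E * A * u] into
   [u^2], giving [hs (kmul E A)], and turns [E * A / u] into 1, leaving [T] and [W^2], where the
   column sums of [T] give [hs W]. *)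
pose u y0 ym := kmul E A y0 ym.
have u0 y0 ym : 0 <= u y0 ym by apply: sumr_ge0 => x _; rewrite mulr_ge0.
pose J := (X * X * X * X)%type. (* y0, x, ym, z *)
pose w (i : J) := let: (y0, x, ym, z) := i in E y0 x * A x ym * T ym z.
pose cc (i : J) : R := let: (y0, x, ym, z) := i in (c x z)%:R.
pose g (i : J) := let: (y0, x, ym, z) := i in W z y0.
pose uu (i : J) := let: (y0, x, ym, z) := i in u y0 ym.
have big4 (F : X -> X -> X -> X -> R) :
   \sum_(i : J) (let: (y0, x, ym, z) := i in F y0 x ym z) =
   \sum_y0 \sum_x \sum_ym \sum_z F y0 x ym z.
  rewrite !pair_bigA /=; apply: eq_bigr => -[[[y0 x] ym] z] _ //.
have -> : \sum_x \sum_z kmul A T x z * kmul W E z x * (c x z)%:R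
        = \sum_i w i * cc i * g i.
  transitivity (\sum_y0 \sum_x \sum_ym \sum_z
      (E y0 x * A x ym * T ym z * (c x z)%:R * W z y0)); last first.
    by rewrite -big4; apply: eq_bigr => -[[[y0 x] ym] z] _.
  rewrite [RHS]exchange_big; apply: eq_bigr => x _ /=.
  under [RHS]eq_bigr do rewrite exchange_big /=.
  rewrite [RHS]exchange_big; apply: eq_bigr => z _ /=.
  rewrite /kmul.
  rewrite [RHS](eq_bigr (fun i => W z i * E i x * ((c x z)%:R * \sum_y A x y * T y z))).
    rewrite -big_distrl /=; ring.
  move=> y _; rewrite mulrA big_distrr /=; apply: eq_bigr => t _; ring.
apply: le_trans (_ : (\sum_i w i * cc i * uu i) * (\sum_i w i * g i ^+ 2 / uu i) <= _).
  apply: weighted_cauchy_schwarz.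
  - by move=> [[[y0 x] ym] z]; rewrite /= !mulr_ge0.
  - by move=> [[[y0 x] ym] z]; apply: u0.
  - by move=> [[[y0 x] ym] z] /=; case: (c _ _); rewrite ?expr1n // expr0n.
  - move=> [[[y0 x] ym] z] /= /eqP; rewrite /u /kmul psumr_eq0; last first.
      by move=> i _; rewrite mulr_ge0.
    by move/allP/(_ x (mem_index_enum x)) => /eqP ->; rewrite mul0r.
apply: ler_pM.
- by apply: sumr_ge0 => -[[[y0 x] ym] z] _; rewrite /= !mulr_ge0 // ler0n.
- by apply: sumr_ge0 => -[[[y0 x] ym] z] _ /=; apply: divr_ge0 => //;
  rewrite mulr_ge0 ?sqr_ge0 // !mulr_ge0.
- rewrite (eq_bigr (fun i : J => let: (y0, x, ym, z) := i in
      E y0 x * A x ym * T ym z * (c x z)%:R * u y0 ym)); last by move=> -[[[y0 x] ym] z] _.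
  rewrite big4 /hs big_distrr /=; apply: ler_sum => y0 _.
  rewrite exchange_big big_distrr /=; apply: ler_sum => ym _.
  apply: (@le_trans _ _ (\sum_x E y0 x * A x ym * (s * u y0 ym))).
    apply: ler_sum => x _.
    rewrite (eq_bigr (fun z => (E y0 x * A x ym * u y0 ym) * (T ym z * (c x z)%:R))); last first.
      by move=> z _; ring.
    rewrite -big_distrr /= [s * _]mulrC mulrA.
    by apply: ler_wpM2l; rewrite ?mulr_ge0.
  by rewrite -big_distrl /= -/(kmul E A y0 ym) -/(u y0 ym) expr2 mulrCA.
- rewrite (eq_bigr (fun i : J => let: (y0, x, ym, z) := i in
      E y0 x * A x ym * T ym z * W z y0 ^+ 2 / u y0 ym)); last by move=> -[[[y0 x] ym] z] _.
  rewrite big4 /hs [X in _ <= X]exchange_big /=; apply: ler_sum => y0 _.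
  rewrite exchange_big /=.
  apply: (@le_trans _ _ (\sum_ym \sum_z T ym z * W z y0 ^+ 2)).
    apply: ler_sum => ym _; rewrite exchange_big /=; apply: ler_sum => z _.
    rewrite (eq_bigr (fun x => E y0 x * A x ym * (T ym z * W z y0 ^+ 2 / u y0 ym))); last first.
      by move=> x _; ring.
    rewrite -big_distrl /= -/(kmul E A y0 ym) -/(u y0 ym).
    have [->|un] := eqVneq (u y0 ym) 0; first by rewrite mul0r mulr_ge0 // sqr_ge0.
    by rewrite mulrCA mulfV // mulr1.
  rewrite exchange_big /=; apply: ler_sum => z _.
  by rewrite -big_distrl /= ler_piMl ?sqr_ge0.
Qed.

End Markov.

(** * Periodic products of kernels and closed walks *)

Definition step_type (k : nat) : 'I_3 :=
  inord (if (k %% 6 < 3)%N then (k %% 6)%N else (5 - k %% 6)%N).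

Lemma step_type_val k : step_type k = (if (k %% 6 < 3)%N then (k %% 6)%N else (5 - k %% 6)%N) :> nat.
Proof. rewrite /step_type inordK //; have := ltn_pmod k (isT : (0 < 6)%N); case: (ltnP (k %% 6) 3); lia. Qed.

Lemma step_type_period k e : step_type (k + 6 * e) = step_type k.
Proof. by apply: val_inj => /=; rewrite !step_type_val addnC mulnC modnMDl. Qed.

Lemma step_type_mirror k k' e : (k + k' = 6 * e + 5)%N -> step_type k = step_type k'.
Proof. move=> h; apply: val_inj => /=; rewrite !step_type_val; case: (ltnP (k %% 6) 3); case: (ltnP (k' %% 6) 3); lia. Qed.

Section Walks.
Variables (R : realFieldType) (X : finType) (T : 'I_3 -> X -> X -> R).
Hypothesis T_ge0 : forall c x y, 0 <= T c x y.
Hypothesis T_sym : forall c x y, T c x y = T c y x.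
Hypothesis T_row : forall c x, \sum_y T c x y <= 1.

Fixpoint kprod (k m : nat) : X -> X -> R :=
  if m is m'.+1 then kmul (T (step_type k)) (kprod k.+1 m') else @kone R X.

Lemma kprod_ge0 k m x y : 0 <= kprod k m x y.
Proof.
elim: m k x y => [|m IH] k x y /=; first exact: ler0n.
by apply: sumr_ge0 => z _; rewrite mulr_ge0.
Qed.

Lemma kprod_add k m1 m2 : kprod k (m1 + m2) =2 kmul (kprod k m1) (kprod (k + m1) m2).
Proof.
elim: m1 k => [|m1 IH] k x y; first by rewrite addn0 /= kmul1.
rewrite addSn /= -kmulA; apply: eq_kmul => // {}x {}y.
by rewrite IH addSnnS.
Qed.

Lemma kprod1 k : kprod k 1 =2 T (step_type k).
Proof.
move=> x y; rewrite /= /kmul (eq_bigr (fun z => kone R y z * T (step_type k) x z)).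
  by rewrite sum_kone.
by move=> z _; rewrite mulrC /kone eq_sym.
Qed.

Lemma kprod_period k e m : kprod (k + 6 * e) m =2 kprod k m.
Proof.
elim: m k => [|m IH] k x y //=.
by apply: eq_kmul => //; rewrite ?step_type_period // -addSn.
Qed.

Lemma T_col c y : \sum_x T c x y <= 1.
Proof. by rewrite (eq_bigr (fun x => T c y x)). Qed.

Lemma hs_kprod_right A k m : hs (kmul A (kprod k m)) <= hs A.
Proof.
elim: m k A => [|m IH] k A /=.
  rewrite (@eq_hs _ _ _ A) // => x y; rewrite /kmul.
  rewrite (eq_bigr (fun z => kone R y z * A x z)) ?sum_kone // => z _.
  by rewrite mulrC /kone eq_sym.
rewrite (@eq_hs _ _ _ (kmul (kmul A (T (step_type k))) (kprod k.+1 m))); last exact: kmulA.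
apply: le_trans (IH _ _) _.
by apply: hs_mulr => // y; apply: T_col.
Qed.

(** The sequence of step types is a palindrome about every multiple of 3 and the kernels are
    symmetric, so the [m] steps before time [c] are the [m] steps after it, reversed. *)
Lemma kprod_mirror c m : (3 %| c)%N -> (m <= c)%N ->
  forall x y, kprod (c - m) m y x = kprod c m x y.
Proof.
move=> /dvdnP [e ce]; elim: m => [|m IH] mc x y; first by rewrite /kone /= /kone eq_sym.
rewrite -[in RHS]addn1 kprod_add [LHS]/= /kmul; apply: eq_bigr => z _.
rewrite kprod1 mulrC; congr (_ * _).
  by rewrite -IH; [congr (kprod _ _ _ _); lia | lia].
rewrite T_sym; congr (T _ _ _); apply: (@step_type_mirror _ _ e.-1); lia.
Qed.

Lemma hs_kprod_left A k m : hs (kmul (kprod k m) A) <= hs A.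
Proof.
elim: m k A => [|m IH] k A /=.
  by rewrite (@eq_hs _ _ _ A) // => x y; rewrite kmul1.
rewrite (@eq_hs _ _ _ (kmul (T (step_type k)) (kmul (kprod k.+1 m) A))); last first.
  by move=> x y; rewrite kmulA.
apply: le_trans (_ : hs (kmul (kprod k.+1 m) A) <= _); last exact: IH.
set B := kmul _ A; rewrite -hs_transpose.
rewrite (@eq_hs _ _ _ (kmul (fun x y => B y x) (T (step_type k)))); last first.
  by move=> x y; apply: eq_bigr => z _; rewrite mulrC T_sym.
by rewrite -[X in _ <= X]hs_transpose; apply: hs_mulr => // y; apply: T_col.
Qed.

Definition zeta j := hs (kprod 0 (3 * j)).

(** By reflection at time [3 * j], the second half of the product is the transpose of the first. *)
Lemma zetaE j : zeta j = ktr (kprod 0 (6 * j)).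
Proof.
rewrite /zeta hs_tr; apply: eq_ktr => x y.
rewrite (_ : (6 * j = 3 * j + 3 * j)%N); last by lia.
rewrite kprod_add add0n; apply: eq_kmul => // {}x {}y.
by rewrite -(@kprod_mirror (3 * j)) ?subnn // dvdn_mulr.
Qed.

(** Both sides are traces of closed walks of length [6 * j], and cyclicity of the trace, together
    with the period 6, moves the starting time three steps at a time. *)
Lemma hs_kprod_aligned c j : (3 %| c)%N -> hs (kprod c (3 * j)) = zeta j.
Proof.
move=> dc; rewrite hs_tr.
have e1 : ktr (kmul (kprod c (3 * j)) (fun x y => kprod c (3 * j) y x)) = ktr (kprod c (6 * j)).
  apply: eq_ktr => x y.
  rewrite (_ : (6 * j = 3 * j + 3 * j)%N); last by lia.
  rewrite kprod_add; apply: eq_kmul => // {}x {}y.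
  by rewrite -(@kprod_mirror (c + 3 * j) (3 * j)) ?addnK ?leq_addl // dvdn_add // dvdn_mulr.
rewrite e1 zetaE; case: j {e1} => [|j]; first by rewrite !muln0.
have /dvdnP [e ->] := dc; elim: e => [//|e IH]; rewrite -IH.
have -> : (e.+1 * 3 = e * 3 + 3)%N by lia.
transitivity (ktr (kmul (kprod (e * 3 + 3) (6 * j.+1 - 3)) (kprod (e * 3) 3))).
  apply: eq_ktr => x y; rewrite [in LHS](_ : (6 * j.+1 = (6 * j.+1 - 3) + 3)%N); last by lia.
  rewrite kprod_add; apply: eq_kmul => // {}x {}y.
  by rewrite -(kprod_period (e * 3) j.+1); congr (kprod _ _ _ _); lia.
rewrite ktrC; apply: eq_ktr => x y; rewrite -kprod_add; congr (kprod _ _ _ _); lia.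
Qed.

(** At most two initial steps are dropped to reach a time divisible by 3, and whatever remains
    beyond [3 * j] steps is dropped at the end; both removals are contractions. *)
Lemma hs_kprod_le k m j : (3 * j + 2 <= m)%N -> hs (kprod k m) <= zeta j.
Proof.
move=> mj; pose r := ((3 - k %% 3) %% 3)%N.
have r2 : (r <= 2)%N by rewrite -ltnS ltn_pmod.
have dr : (3 %| k + r)%N by rewrite /r; lia.
rewrite (@eq_hs _ _ _ (kmul (kprod k r) (kmul (kprod (k + r) (3 * j)) (kprod (k + r + 3 * j) (m - r - 3 * j))))).
  by apply: le_trans (hs_kprod_left _ _ _) _; rewrite -(@hs_kprod_aligned (k + r)) //; apply: hs_kprod_right.
move=> x y; rewrite [in LHS](_ : m = r + (3 * j + (m - r - 3 * j)))%N; last by lia.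
by rewrite kprod_add; apply: eq_kmul => // {}x {}y; rewrite kprod_add.
Qed.

(** Walks of length [3 * j] inside [S] have total weight at least [#|S| * r^(3j)]. Cauchy-Schwarz
    against the indicator of [S * S] squares this and divides by [#|S|^2], so the size of [S]
    cancels. *)
Lemma zeta_lower (S : {set X}) j (r : R) :
  0 <= r -> (0 < #|S|)%N ->
  (forall c x, x \in S -> r <= \sum_(y in S) T c x y) ->
  r ^+ (6 * j) <= zeta j.
Proof.
move=> r0 S0 Tr.
have rows k m x : x \in S -> r ^+ m <= \sum_(y in S) kprod k m x y.
  elim: m k x => [|m IH] k x xS; rewrite /=.
    by rewrite expr0 (bigD1 x) //= /kone eqxx lerDl sumr_ge0.
  rewrite /kmul exchange_big /=.
  apply: (@le_trans _ _ (\sum_(z in S) T (step_type k) x z * r ^+ m)).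
    by rewrite -big_distrl /= exprS ler_wpM2r ?exprn_ge0 ?Tr.
  rewrite big_mkcond /=; apply: ler_sum => z _; case: ifP => zS.
    by rewrite -big_distrr /= ler_wpM2l ?IH.
  by apply: sumr_ge0 => y _; rewrite mulr_ge0 ?kprod_ge0.
have N0 : 0 < #|S|%:R :> R by rewrite ltr0n.
have low : #|S|%:R * r ^+ (3 * j) <= \sum_(x in S) \sum_(y in S) kprod 0 (3 * j) x y.
  rewrite -sum1_card natr_sum big_distrl /=; apply: ler_sum => x xS.
  by rewrite mul1r rows.
pose w (i : X * X) : R := ((i.1 \in S) && (i.2 \in S))%:R.
have := cauchy_schwarz_sum w (fun i => kprod 0 (3 * j) i.1 i.2).
have -> : \sum_i w i * kprod 0 (3 * j) i.1 i.2 = \sum_(x in S) \sum_(y in S) kprod 0 (3 * j) x y.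
  rewrite -(pair_bigA _ (fun x y => w (x, y) * kprod 0 (3 * j) x y)) /= [RHS]big_mkcond /=.
  apply: eq_bigr => x _; rewrite /w /=; case: ifP => xS /=.
    rewrite [RHS]big_mkcond /=; apply: eq_bigr => y _.
    by case: ifP; rewrite ?mul1r ?mul0r.
  by rewrite big1 // => y _; rewrite mul0r.
have -> : \sum_i w i ^+ 2 = #|S|%:R ^+ 2.
  rewrite -(pair_bigA _ (fun x y => w (x, y) ^+ 2)) /=.
  rewrite -sum1_card natr_sum expr2 big_distrl /= [RHS]big_mkcond /=.
  apply: eq_bigr => x _; rewrite /w /=; case: ifP => xS /=.
    rewrite mul1r [RHS]big_mkcond /=; apply: eq_bigr => y _.
    by case: ifP; rewrite ?expr1n ?expr0n.
  by rewrite big1 // => y _; rewrite expr0n.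
rewrite -(pair_bigA _ (fun x y => kprod 0 (3 * j) x y ^+ 2)) /= -/(hs _) -/(zeta j).
move=> cs.
have : (#|S|%:R * r ^+ (3 * j)) ^+ 2 <= #|S|%:R ^+ 2 * zeta j.
  apply: le_trans cs; rewrite ler_pXn2r ?nnegrE ?mulr_ge0 ?exprn_ge0 ?ler0n //.
  by apply: sumr_ge0 => x _; apply: sumr_ge0 => y _; apply: kprod_ge0.
rewrite exprMn -exprM ler_pM2l ?exprn_gt0 //.
by rewrite (_ : (3 * j * 2 = 6 * j)%N); last by lia.
Qed.

Lemma zeta0 : zeta 0 = #|X|%:R.
Proof. by rewrite /zeta muln0 hs_kone. Qed.

Lemma zeta1_le : zeta 1 <= zeta 0.
Proof.
rewrite {2}/zeta muln0 /zeta muln1.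
have -> : hs (kprod 0 3) = hs (kmul (@kone R X) (kprod 0 3)) by apply: eq_hs => x y; rewrite kmul1.
exact: hs_kprod_right.
Qed.

Variables (V : eqType) (co : 'I_3 -> X -> V) (s sigma : R).
Hypothesis sigma_ge0 : 0 <= sigma.
Hypothesis sigma2 : sigma ^+ 2 = s.
Hypothesis T_conflict : forall c y v, \sum_z T c y z * (co c z == v)%:R <= s.

(** The closed walk is cut at the states [y] and [z] after steps [i] and [j]. As the segment takes
    up at most half the walk, the complement has room for a piece [W] of nearly half the length. *)
Lemma segment_conflict j0 i j : (0 < j0)%N -> (i < j)%N -> (j - i <= 3 * j0)%N ->
  \sum_y \sum_z kprod i.+1 (j - i) y z * kprod j.+1 (6 * j0 - (j - i)) z y
     * (co (step_type i) y == co (step_type j) z)%:R <= sigma * zeta j0.-1.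
Proof.
move=> j0p ij ji.
(* [3 * (j0 - 1) + 2], the least length for which [hs_kprod_le] yields [zeta (j0 - 1)]. Apart from
   [W] and step [j], the walk keeps [3 * j0] steps, again enough. *)
pose w := (3 * j0 - 1)%N.
pose E := kprod (j.+1 + w) (6 * j0 - (j - i) - w).
pose A := kprod i.+1 (j - i - 1).
pose W := kprod j.+1 w.
have s0 : 0 <= s by rewrite -sigma2 sqr_ge0.
have z0 : 0 <= zeta j0.-1 by apply: hs_ge0.
rewrite -(@ler_pXn2r _ 2) ?nnegrE ?mulr_ge0 //; last first.
  by apply: sumr_ge0 => y _; apply: sumr_ge0 => z _; rewrite !mulr_ge0 ?kprod_ge0.
have := @conflict_bound R X E A (T (step_type j)) W (fun x z => co (step_type i) x == co (step_type j) z) s s0.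
move=> /(_ (fun x y => kprod_ge0 _ _ _ _) (fun x y => kprod_ge0 _ _ _ _) (T_ge0 _) (T_col _)).
have h x y : \sum_z T (step_type j) y z * (co (step_type i) x == co (step_type j) z)%:R <= s.
  rewrite (eq_bigr (fun z => T (step_type j) y z * (co (step_type j) z == co (step_type i) x)%:R)) //.
  by move=> z _; rewrite eq_sym.
move=> /(_ h) {h} bnd.
rewrite (eq_bigr (fun y => \sum_z kmul A (T (step_type j)) y z * kmul W E z y
     * (co (step_type i) y == co (step_type j) z)%:R)); last first.
  move=> y _; apply: eq_bigr => z _; congr (_ * _ * _).
    rewrite [in LHS](_ : j - i = (j - i - 1) + 1)%N; last by lia.
    rewrite kprod_add; apply: eq_kmul => // {}y {}z; rewrite kprod1; congr (T (step_type _) _ _); lia.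
  rewrite [in LHS](_ : 6 * j0 - (j - i) = w + (6 * j0 - (j - i) - w))%N; last by rewrite /w; lia.
  by rewrite kprod_add.
apply: le_trans bnd _; rewrite exprMn sigma2 -mulrA expr2.
apply: ler_wpM2l => //; apply: ler_pM; rewrite ?hs_ge0 //; last first.
  by apply: hs_kprod_le; rewrite /w; lia.
rewrite (@eq_hs _ _ _ (kprod (j.+1 + w) (6 * j0 - 1 - w))).
  by apply: hs_kprod_le; rewrite /w; lia.
move=> x y; rewrite [in RHS](_ : 6 * j0 - 1 - w = (6 * j0 - (j - i) - w) + (j - i - 1))%N; last by rewrite /w; lia.
rewrite kprod_add; apply: eq_kmul => // {}x {}y.
rewrite /A -[in LHS](kprod_period i.+1 j0); congr (kprod _ _ _ _); rewrite /w; lia.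
Qed.

(** Weighted sum over explicit walks. In contrast to [kprod], the functional [F] sees all states, so
    it can express coincidences between two times. *)
Fixpoint walk_sum (k m : nat) (x : X) (F : seq X -> R) : R :=
  if m is m'.+1 then \sum_x1 T (step_type k) x x1 * walk_sum k.+1 m' x1 (fun l => F (x1 :: l))
  else F [::].

Lemma eq_walk_sum k m x F G : (forall l, size l = m -> F l = G l) ->
  walk_sum k m x F = walk_sum k m x G.
Proof.
elim: m k x F G => [|m IH] k x F G h /=; first exact: h.
by apply: eq_bigr => x1 _; congr (_ * _); apply: IH => l sl; apply: h; rewrite /= sl.
Qed.

Lemma le_walk_sum k m x F G : (forall l, size l = m -> F l <= G l) ->
  walk_sum k m x F <= walk_sum k m x G.
Proof.
elim: m k x F G => [|m IH] k x F G h /=; first exact: h.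
apply: ler_sum => x1 _; apply: ler_wpM2l => //.
by apply: IH => l sl; apply: h; rewrite /= sl.
Qed.

Lemma walk_sumD k m x F G : walk_sum k m x (fun l => F l + G l) = walk_sum k m x F + walk_sum k m x G.
Proof.
elim: m k x F G => [|m IH] k x F G //=.
by rewrite -big_split; apply: eq_bigr => x1 _; rewrite IH mulrDr.
Qed.

Lemma walk_sum0 k m x : walk_sum k m x (fun=> 0) = 0.
Proof. by elim: m k x => [|m IH] k x //=; rewrite big1 // => y _; rewrite IH mulr0. Qed.

Lemma walk_sum_sum k m x (I : Type) (r : seq I) (p : pred I) (F : I -> seq X -> R) :
  walk_sum k m x (fun l => \sum_(i <- r | p i) F i l) = \sum_(i <- r | p i) walk_sum k m x (F i).
Proof.
elim: r => [|i r IH].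
  by rewrite big_nil -[RHS](walk_sum0 k m x); apply: eq_walk_sum => l _; rewrite big_nil.
rewrite big_cons; case: ifP => pi.
  by rewrite -IH -walk_sumD; apply: eq_walk_sum => l _; rewrite big_cons pi.
by rewrite -IH; apply: eq_walk_sum => l _; rewrite big_cons pi.
Qed.

Lemma walk_sum_cat k m1 m2 x F : walk_sum k (m1 + m2) x F =
  walk_sum k m1 x (fun l1 => walk_sum (k + m1) m2 (last x l1) (fun l2 => F (l1 ++ l2))).
Proof.
elim: m1 k x F => [|m1 IH] k x F; first by rewrite addn0.
rewrite addSn /=; apply: eq_bigr => x1 _; congr (_ * _).
by rewrite IH; apply: eq_walk_sum => l _; rewrite addSnnS.
Qed.

Lemma walk_sum_last k m x (f : X -> R) :
  walk_sum k m x (fun l => f (last x l)) = \sum_y kprod k m x y * f y.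
Proof.
elim: m k x => [|m IH] k x /=; first by rewrite sum_kone.
rewrite /kmul; under [RHS]eq_bigr do rewrite big_distrl /=.
rewrite exchange_big /=; apply: eq_bigr => x1 _.
by rewrite IH big_distrr /=; apply: eq_bigr => y _; rewrite mulrA.
Qed.

Lemma walk_sum_neq0 k m x F : walk_sum k m x F != 0 ->
  exists l, [/\ size l = m, F l != 0 &
    forall i, (i < m)%N -> T (step_type (k + i)) (nth x (x :: l) i) (nth x l i) != 0].
Proof.
elim: m k x F => [|m IH] k x F /=; first by exists [::].
move=> nz.
have [x1] : exists x1, T (step_type k) x x1 * walk_sum k.+1 m x1 (fun l => F (x1 :: l)) != 0.
  apply/existsP; apply: contraNT nz; rewrite negb_exists => /forallP h.
  by rewrite big1 // => x1 _; apply/eqP; have := h x1; rewrite negbK.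
rewrite mulf_eq0 negb_or => /andP[t /IH[l [sl Fl h]]].
exists (x1 :: l); split => //=; first by rewrite sl.
case=> [|i] im; first by rewrite addn0.
have := h i im; rewrite addSnnS /=.
by rewrite (set_nth_default x) ?(set_nth_default x (s := l)) //= ?sl // ltnS ltnW.
Qed.

Arguments kprod : simpl never.

(** Entry [i] of [l] is the state after step [i], so [co (step_type i)] reads the vertex introduced
    by that step. If every closed walk of nonzero weight has a repetition, all of [zeta j0] is
    accounted for by a union bound over the pairs of times, at most [(6 * j0)^2] in number. *)
Lemma closed_walk j0 : (0 < j0)%N ->
  (exists x l, [/\ size l = (6 * j0)%N, last x l = x,
     forall i, (i < 6 * j0)%N -> T (step_type i) (nth x (x :: l) i) (nth x l i) != 0 &
     forall i j, (i < j < 6 * j0)%N -> co (step_type i) (nth x l i) != co (step_type j) (nth x l j)])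
  \/ zeta j0 <= ((6 * j0)%:R ^+ 2 * sigma) * zeta j0.-1.
Proof.
move=> j0p; set L := (6 * j0)%N.
pose cf x l (i j : nat) := co (step_type i) (nth x l i) == co (step_type j) (nth x l j).
pose nc x l := [forall i : 'I_L, forall j : 'I_L, (i < j)%N ==> ~~ cf x l i j].
have [nz|/negPn/eqP nc0] := boolP (\sum_x walk_sum 0 L x (fun l => ((last x l == x) && nc x l)%:R) != 0).
  left; have [x] : exists x, walk_sum 0 L x (fun l => ((last x l == x) && nc x l)%:R) != 0.
    apply/existsP; apply: contraNT nz; rewrite negb_exists => /forallP h.
    by rewrite big1 // => x1 _; apply/eqP; have := h x1; rewrite negbK.
  move/walk_sum_neq0 => [l [sl + h]].
  case: andP => [[/eqP lx /forallP ncl] _|]; last by rewrite eqxx.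
  exists x, l; split => // i j /andP[ij jL].
  have iL := ltn_trans ij jL.
  by have := ncl (Ordinal iL) => /forallP/(_ (Ordinal jL))/implyP/(_ ij).
right.
have zE : zeta j0 = \sum_x walk_sum 0 L x (fun l => (last x l == x)%:R).
  rewrite zetaE /ktr; apply: eq_bigr => x _.
  rewrite (walk_sum_last 0 L x (fun y => (y == x)%:R)) -/L.
  rewrite (eq_bigr (fun y => kone R x y * kprod 0 L x y)) ?sum_kone // => y _.
  by rewrite mulrC /kone eq_sym.
pose bad (i j : nat) := \sum_x walk_sum 0 L x (fun l => (last x l == x)%:R * (cf x l i j)%:R).
have zb : zeta j0 <= \sum_(i < L) \sum_(j < L | (i < j)%N) bad i j.
  rewrite zE.
  apply: (@le_trans _ _ (\sum_x walk_sum 0 L x (fun l => ((last x l == x) && nc x l)%:R +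
      \sum_(i < L) \sum_(j < L | (i < j)%N) (last x l == x)%:R * (cf x l i j)%:R))).
    apply: ler_sum => x _; apply: le_walk_sum => l _.
    have nn (i : 'I_L) : 0 <= \sum_(j < L | (i < j)%N) (last x l == x)%:R * (cf x l i j)%:R :> R.
      by apply: sumr_ge0 => j _; rewrite mulr_ge0.
    case: (last x l == x) nn => nn /=; last by rewrite add0r sumr_ge0.
    have [ncl|] := boolP (nc x l); first by rewrite lerDl sumr_ge0.
    rewrite negb_forall => /existsP[i]; rewrite negb_forall => /existsP[j].
    rewrite negb_imply negbK => /andP[ij c]; rewrite add0r.
    rewrite (bigD1 i) //= (bigD1 j) //= c mulr1 -addrA lerDl addr_ge0 ?sumr_ge0 //.
    by move=> j' _; rewrite mulr_ge0.
  rewrite (eq_bigr _ (fun x _ => walk_sumD _ _ _ _ _)) big_split /= nc0 add0r.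
  rewrite (eq_bigr _ (fun x _ => walk_sum_sum _ _ _ _ _ _)) exchange_big /=.
  apply: ler_sum => i _.
  by rewrite (eq_bigr _ (fun x _ => walk_sum_sum _ _ _ _ _ _)) exchange_big.
(* The walk is cut after steps [i] and [j]; its last and first pieces are glued at the base point
   [x], using that [L] is a multiple of the period. *)
have badE (i j : nat) : (i < j < L)%N ->
   bad i j = \sum_y \sum_z kprod i.+1 (j - i) y z * kprod j.+1 (L - (j - i)) z y
     * (co (step_type i) y == co (step_type j) z)%:R.
  move=> /andP[ij jL].
  transitivity (\sum_x \sum_y kprod 0 i.+1 x y * \sum_z kprod i.+1 (j - i) y z *
      \sum_t kprod j.+1 (L - j.+1) z t * ((t == x)%:R * (co (step_type i) y == co (step_type j) z)%:R)).
    apply: eq_bigr => x _.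
    rewrite -(walk_sum_last 0 i.+1 x (fun y => \sum_z kprod i.+1 (j - i) y z *
      \sum_t kprod j.+1 (L - j.+1) z t * ((t == x)%:R * (co (step_type i) y == co (step_type j) z)%:R))).
    rewrite [in LHS](_ : L = i.+1 + ((j - i) + (L - j.+1)))%N; last by lia.
    rewrite walk_sum_cat; apply: eq_walk_sum => l1 s1.
    rewrite -(walk_sum_last i.+1 (j - i) (last x l1) (fun z => 
      \sum_t kprod j.+1 (L - j.+1) z t * ((t == x)%:R * (co (step_type i) (last x l1) == co (step_type j) z)%:R))).
    rewrite add0n walk_sum_cat; apply: eq_walk_sum => l2 s2.
    rewrite -(walk_sum_last j.+1 (L - j.+1) (last (last x l1) l2) (fun t => 
       ((t == x)%:R * (co (step_type i) (last x l1) == co (step_type j) (last (last x l1) l2))%:R))).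
    have -> : (i.+1 + (j - i) = j.+1)%N by lia.
    apply: eq_walk_sum => l3 s3; rewrite /cf !last_cat.
    congr (_ * (_ == _)%:R).
      by rewrite nth_cat s1 ltnSn -nth_last s1.
    rewrite catA nth_cat size_cat s1 s2.
    have -> : (j < i.+1 + (j - i))%N by lia.
    by rewrite -last_cat -nth_last size_cat s1 s2; congr (co _ (nth _ _ _)); lia.
  rewrite exchange_big /=; apply: eq_bigr => y _.
  transitivity (\sum_x \sum_z kprod 0 i.+1 x y * kprod i.+1 (j - i) y z * kprod j.+1 (L - j.+1) z x *
        (co (step_type i) y == co (step_type j) z)%:R).
    apply: eq_bigr => x _; rewrite big_distrr /=; apply: eq_bigr => z _.
    rewrite (eq_bigr (fun t => kone R x t * (kprod j.+1 (L - j.+1) z t * (co (step_type i) y == co (step_type j) z)%:R))).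
      by rewrite sum_kone; ring.
    by move=> t _; rewrite /kone eq_sym; ring.
  rewrite exchange_big /=; apply: eq_bigr => z _.
  rewrite -big_distrl /=; congr (_ * _).
  rewrite [in RHS](_ : L - (j - i) = (L - j.+1) + i.+1)%N; last by lia.
  rewrite kprod_add /kmul big_distrr /=; apply: eq_bigr => x _.
  have -> : kprod (j.+1 + (L - j.+1)) i.+1 x y = kprod 0 i.+1 x y.
    by rewrite -(kprod_period 0 j0); congr (kprod _ _ _ _); lia.
  by ring.
apply: le_trans zb _.
apply: (@le_trans _ _ (\sum_(i < L) \sum_(j < L) sigma * zeta j0.-1)); last first.
  by rewrite !sumr_const !card_ord -mulrnA -[X in X <= _]mulr_natr natrM expr2; lra.
apply: ler_sum => i _; rewrite big_mkcond /=; apply: ler_sum => j _.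
case: ifP => ij; last by rewrite mulr_ge0 // hs_ge0.
rewrite badE ?ij ?ltn_ord //.
case: (leqP (j - i) (3 * j0)) => h; first exact: segment_conflict.
have jL := ltn_ord j; have iL := ltn_ord i.
(* Times more than half the walk apart are joined the other way round, by the segment from [j] to
   [i + L]. *)
have := @segment_conflict j0 j (i + L) j0p.
have -> : (j < i + L)%N by lia.
have -> : (i + L - j <= 3 * j0)%N by lia.
move=> /(_ isT isT); apply: le_trans; rewrite exchange_big /= le_eqVlt; apply/orP; left.
apply/eqP; apply: eq_bigr => y _; apply: eq_bigr => z _.
rewrite step_type_period [co (step_type i) _ == _]eq_sym; congr (_ * _); rewrite mulrC; congr (_ * _).
  by congr (kprod _ _ _ _); lia.
by rewrite -addSn kprod_period; congr (kprod _ _ _ _); lia.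
Qed.

End Walks.

(** * A conflict-free grid *)

Lemma ord3_cases (c e : 'I_3) : [\/ e = c, e = c + 1 | e = c + 2].
Proof.
case: c => [[|[|[|//]]] hc]; case: e => [[|[|[|//]]] he];
 by [apply: Or31; apply: val_inj | apply: Or32; apply: val_inj | apply: Or33; apply: val_inj].
Qed.

Section Clean.
Variables (R : realFieldType) (V : finType).
Local Notation X := {ffun 'I_3 -> V}.
Variable G : 'I_3 -> X -> X -> bool.

(** Addition in ['I_3] is modulo 3: these are the two coordinates other than [c], in cyclic
    order. *)
Definition off (c : 'I_3) (x : X) : V * V := (x (c + 1), x (c + 2)).

Lemma off_eqP c x y e : off c x = off c y -> e != c -> x e = y e.
Proof. by case=> h1 h2; case: (ord3_cases c e) => ->; rewrite ?eqxx. Qed.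

Lemma off_inj c x y : off c x = off c y -> x c = y c -> x = y.
Proof.
move=> h hc; apply/ffunP => e.
by have [->//|] := eqVneq e c; apply: off_eqP.
Qed.

Definition fibre (S : {set X}) c x := [set y in S | off c y == off c x].
Definition badset (S : {set X}) c x := [set y in fibre S c x | ~~ G c x y].
Definition badpairs (S : {set X}) c :=
  [set p : X * X | [&& p.1 \in S, p.2 \in S, off c p.2 == off c p.1 & ~~ G c p.1 p.2]].
Definition bad_count (S : {set X}) := (\sum_c #|badpairs S c|)%N.
Definition fibre_count (S : {set X}) := (\sum_c #|off c @: S|)%N.

Definition stable (d : R) (S : {set X}) := forall x c, x \in S ->
  d <= #|fibre S c x|%:R /\ (2 * #|badset S c x| <= #|fibre S c x|)%N.

Lemma bad_count_mono (S S' : {set X}) : S \subset S' -> (bad_count S <= bad_count S')%N.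
Proof.
move=> /fintype.subsetP s; apply: leq_sum => c _; apply: subset_leq_card.
apply/fintype.subsetP => -[x y]; rewrite !inE /= => /and4P[/s -> /s -> -> ->] //.
Qed.

Lemma fibre_count_mono (S S' : {set X}) : S \subset S' -> (fibre_count S <= fibre_count S')%N.
Proof. by move=> s; apply: leq_sum => c _; apply: subset_leq_card; apply: imsetS. Qed.

(** Greedy deletion, preserving that the potential on the left stays below [#|S|]. A fibre of size
    less than [d] is deleted whole: the potential drops by at least [d]. If more than half of a
    fibre of size at least [d] is bad for [x], then [x] alone is deleted: more than [d/2] bad pairs
    disappear and the potential drops by more than 1. Since the potential is nonnegative, [S] never
    becomes empty. *)
Lemma stable_subset (d : R) (S : {set X}) : 0 < d ->
  2 / d * (bad_count S)%:R + d * (fibre_count S)%:R < #|S|%:R ->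
  exists S' : {set X}, [/\ S' \subset S, (0 < #|S'|)%N & stable d S'].
Proof.
move=> d0; move: {2}#|S| (leqnn #|S|) => m; elim: m S => [|m IH] S.
  rewrite leqn0 => /eqP -> h; suff : 0 <= 2 / d * (bad_count S)%:R + d * (fibre_count S)%:R by lra.
  by rewrite addr_ge0 ?mulr_ge0 ?invr_ge0 ?ler0n ?(ltW d0).
move=> Sm h.
have S0 : (0 < #|S|)%N.
  rewrite -(ltr0n R); apply: le_lt_trans h.
  by rewrite addr_ge0 ?mulr_ge0 ?invr_ge0 ?ler0n ?(ltW d0).
pose stb := [forall x, forall c, (x \in S) ==>
   ((d <= #|fibre S c x|%:R) && (2 * #|badset S c x| <= #|fibre S c x|)%N)].
have [/forallP st|] := boolP stb.
  exists S; split=> // x c xS.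
  by have /forallP/(_ c)/implyP/(_ xS)/andP[] := st x.
rewrite negb_forall => /existsP[x]; rewrite negb_forall => /existsP[c].
rewrite negb_imply negb_and => /andP[xS].
have xf : x \in fibre S c x by rewrite inE xS eqxx.
have fS : fibre S c x \subset S by apply/fintype.subsetP => y; rewrite inE => /andP[].
have fin (S1 : {set X}) : S1 \subset S -> (#|S1| < #|S|)%N ->
    2 / d * (bad_count S1)%:R + d * (fibre_count S1)%:R < #|S1|%:R ->
  exists S' : {set X}, [/\ S' \subset S, (0 < #|S'|)%N & stable d S'].
  move=> s1 c1 h1; have [|S' [s' p st]] := IH S1 _ h1.
    by rewrite -ltnS; apply: leq_trans c1 Sm.
  by exists S'; split=> //; apply: fintype.subset_trans s1.
have [fd _|df] := ltrP (#|fibre S c x|%:R) d; last rewrite -ltnNge /= => badx.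
  have cS : (#|S| = #|fibre S c x| + #|S :\: fibre S c x|)%N.
    by rewrite -(cardsID (fibre S c x) S) (setIidPr fS).
  have f0 : (0 < #|fibre S c x|)%N by apply/card_gt0P; exists x.
  apply: (fin (S :\: fibre S c x)); first exact: subsetDl.
    by rewrite cS -addn1 addnC leq_add2r.
  have b1 := bad_count_mono (subsetDl S (fibre S c x)).
  have p1 : (fibre_count (S :\: fibre S c x) + 1 <= fibre_count S)%N.
    rewrite /fibre_count (bigD1 c) //= [X in (_ <= X)%N](bigD1 c) //= addnAC; apply: leq_add.
      rewrite addn1; apply: proper_card; apply/properP; split.
        by apply: imsetS; apply: subsetDl.
      exists (off c x); first by apply: imset_f.
      by apply/imsetP => -[y]; rewrite !inE => /andP[+ yS] e; rewrite yS e eqxx.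
    by apply: leq_sum => c' _; apply: subset_leq_card; apply/imsetS/subsetDl.
  move: h b1 p1; rewrite cS natrD -(ler_nat R) -[(_ + 1 <= _)%N](ler_nat R) natrD.
  move=> h b1 p1; have i0 : 0 <= 2 / d by rewrite divr_ge0 ?ler0n ?(ltW d0).
  have := ler_wpM2l i0 b1; have := ler_wpM2l (ltW d0) p1; rewrite mulrDr mulr1; lra.
have cS : #|S| = (#|S :\ x| + 1)%N by rewrite (cardsD1 x S) xS addnC.
apply: (fin (S :\ x)); first exact: subsetDl.
  by rewrite cS addn1.
have p1 := fibre_count_mono (subsetDl S [set x]).
have b1 : (bad_count (S :\ x) + #|badset S c x| <= bad_count S)%N.
  rewrite /bad_count (bigD1 c) //= [X in (_ <= X)%N](bigD1 c) //= addnAC; apply: leq_add; last first.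
    apply: leq_sum => c' _; apply: subset_leq_card; apply/fintype.subsetP => -[y z].
    by rewrite !inE /= => /and4P[/andP[_ ->] /andP[_ ->] -> ->].
  have ix : injective (fun y : X => (x, y)) by move=> y z [].
  rewrite -(card_imset (mem (badset S c x)) ix) -cardsUI.
  rewrite [X in (_ + X)%N](_ : _ = 0%N) ?addn0; last first.
    apply/eqP; rewrite cards_eq0; apply/eqP/setP => -[y z]; rewrite !inE /=.
    apply/negbTE/negP => /andP[/and4P[/andP[/negP yx _] _ _ _] /imsetP[w _ [e _]]].
    by apply: yx; rewrite e.
  apply: subset_leq_card; apply/fintype.subsetP => -[y z]; rewrite !inE /=.
  case/orP => [/and4P[/andP[_ ->] /andP[_ ->] -> ->] //|/imsetP[w]].
  by rewrite !inE => /andP[/andP[wS pw] gw] [-> ->]; rewrite xS wS pw.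
move: h b1 p1 badx; rewrite cS natrD -(ler_nat R) natrD -(ler_nat R) => h b1 p1.
rewrite -(ltr_nat R) natrM => badx.
have i0 : 0 <= 2 / d by rewrite divr_ge0 ?ler0n ?(ltW d0).
have := ler_wpM2l i0 b1; have := ler_wpM2l (ltW d0) p1; rewrite mulrDr.
have : 1 < 2 / d * #|badset S c x|%:R.
  by rewrite mulrAC ltr_pdivlMr // mul1r; apply: le_lt_trans df badx.
lra.
Qed.

End Clean.

(** * Blocks of three steps *)

Section BlockStructure.
Variables (Y : Type) (s : nat -> 'I_3 -> Y) (j0 : nat).
Hypothesis s_step : forall i e, (i < 6 * j0)%N -> e != step_type i -> s i.+1 e = s i e.

Definition pos (b : nat) (e : 'I_3) : nat := if odd b then (2 - e)%N else e.

Lemma pos_lt b e : (pos b e < 3)%N.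
Proof. rewrite /pos; case: odd => //; lia. Qed.

Lemma step_type_pos b r : (r < 3)%N -> forall e, (step_type (3 * b + r) == e) = (pos b e == r).
Proof.
move=> r3 e; have := odd_double_half b; rewrite -muln2.
set h := (b./2)%N; move: h => h bE.
have -> : (step_type (3 * b + r) == e) = (step_type (3 * b + r) == e :> nat) by [].
rewrite step_type_val /pos; have := ltn_ord e.
case: (ltnP ((3 * b + r) %% 6) 3); case: (odd b) bE => /= bE; lia.
Qed.

(** Within block [b] coordinate [e] is replaced exactly once, at position [pos b e]: before that it
    belongs to row [b], afterwards to row [b + 1]. *)
Lemma block_coord b r e : (b < 2 * j0)%N -> (r <= 3)%N ->
  s (3 * b + r) e = s (3 * (if (pos b e < r)%N then b.+1 else b)) e.
Proof.
move=> bj; case: ltnP => h r3.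
  suff H k : (pos b e < r)%N -> (k + r = 3)%N -> s (3 * b + r) e = s (3 * b.+1) e.
    by apply: (H (3 - r)%N) => //; lia.
  elim: k r {h} r3 => [|k IH] r r3 h kr.
    by congr (s _ e); lia.
  rewrite -(IH r.+1); [|lia|lia|lia].
  rewrite addnS s_step //; first by lia.
  by rewrite eq_sym step_type_pos ?neq_ltn ?h //; lia.
elim: r h r3 => [|r IH] h r3; first by rewrite addn0.
rewrite addnS s_step ?IH //; try lia.
by rewrite eq_sym step_type_pos ?neq_ltn ?h ?orbT //; lia.
Qed.

Lemma block_intro b e : (b < 2 * j0)%N ->
  s (3 * b.+1) e = s (3 * b + pos b e).+1 e.
Proof.
by move=> bj; rewrite -addnS block_coord ?ltnSn // pos_lt.
Qed.

End BlockStructure.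

(** * Random steps on a stable set *)

Section Grid.
Variables (R : realFieldType) (V : finType).
Local Notation X := {ffun 'I_3 -> V}.
Variable G : 'I_3 -> X -> X -> bool.
Hypothesis G_sym : forall c x y, off c x = off c y -> G c x y = G c y x.
Variables (d sigma : R) (S : {set X}).
Hypotheses (d_gt0 : 0 < d) (S_gt0 : (0 < #|S|)%N) (S_stable : stable G d S).
Hypotheses (sigma_ge0 : 0 <= sigma) (sigma2 : sigma ^+ 2 = d^-1).

(** The normalisation is by the whole fibre, which [x] and [y] share, and not by the number of good
    neighbours of [x]: this keeps the kernel symmetric, at the price of row sums that may fall to
    1/2. *)
Definition step_kernel (c : 'I_3) (x y : X) : R :=
  if [&& x \in S, y \in S, off c y == off c x & G c x y]
  then (#|fibre S c x|%:R)^-1 else 0.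

Lemma step_kernel_ge0 c x y : 0 <= step_kernel c x y.
Proof. by rewrite /step_kernel; case: ifP => // _; rewrite invr_ge0. Qed.

Lemma step_kernel_sym c x y : step_kernel c x y = step_kernel c y x.
Proof.
rewrite /step_kernel; have [e|ne] := eqVneq (off c y) (off c x); last first.
  by rewrite !andbF.
rewrite (G_sym (esym e)) /= andbCA; case: ifP => // _.
by congr (#|pred_of_set _|%:R^-1); apply/setP => z; rewrite !inE e.
Qed.

Lemma fibre_gt0 c x : x \in S -> 0 < #|fibre S c x|%:R :> R.
Proof. by move=> xS; rewrite ltr0n; apply/card_gt0P; exists x; rewrite inE xS eqxx. Qed.

Lemma step_kernel_row c x : \sum_y step_kernel c x y <= 1.
Proof.
have [xS|xS] := boolP (x \in S); last first.
  by rewrite big1 // => y _; rewrite /step_kernel (negbTE xS).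
apply: (@le_trans _ _ (\sum_(y in fibre S c x) (#|fibre S c x|%:R)^-1)).
  rewrite [X in _ <= X]big_mkcond /=; apply: ler_sum => y _.
  rewrite /step_kernel xS inE /=; case: (y \in S) => //=; case: eqP => //= _.
  by case: (G _ _ _) => //; rewrite invr_ge0.
by rewrite sumr_const -[X in X <= _]mulr_natl mulfV // gt_eqF // fibre_gt0.
Qed.

(** A fibre contains at most one state with a prescribed coordinate [c], and its weight is the
    inverse of a fibre size that is at least [d]. *)
Lemma step_kernel_conflict c y (v : V) : \sum_z step_kernel c y z * (z c == v)%:R <= d^-1.
Proof.
have [yS|yS] := boolP (y \in S); last first.
  by rewrite big1 ?invr_ge0 ?ltW // => z _; rewrite /step_kernel (negbTE yS) mul0r.
have [z0 /andP[/eqP p0 /eqP e0]|no] := pickP (fun z : X => (off c z == off c y) && (z c == v)).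
  rewrite (bigD1 z0) //= big1 ?addr0 => [|z zz].
    rewrite e0 eqxx mulr1 /step_kernel; case: ifP => _; last by rewrite invr_ge0 ltW.
    by rewrite lef_pV2 ?posrE ?fibre_gt0 //; case: (S_stable c yS).
  rewrite /step_kernel; case: ifP => [/and4P[_ _ /eqP pz _]|_]; last by rewrite mul0r.
  case: eqP => [zc|]; last by rewrite mulr0.
  by case/eqP: zz; apply: (@off_inj _ c); rewrite ?pz ?zc.
rewrite big1 ?invr_ge0 ?ltW // => z _; rewrite /step_kernel.
have := no z; case: (off c z == _) => /= [->|_]; first by rewrite mulr0.
by rewrite !andbF mul0r.
Qed.

Lemma step_kernel_lower c x : x \in S -> 2^-1 <= \sum_(y in S) step_kernel c x y.
Proof.
move=> xS.
have -> : \sum_(y in S) step_kernel c x y = \sum_(y in fibre S c x :\: badset G S c x) (#|fibre S c x|%:R)^-1.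
  rewrite big_mkcond [RHS]big_mkcond /=; apply: eq_bigr => y _.
  rewrite /step_kernel xS !inE /=; case: (y \in S) => //=; case: eqP => //= _.
  by case: (G _ _ _).
rewrite sumr_const -[X in _ <= X]mulr_natl.
have f0 := fibre_gt0 c xS.
rewrite ler_pdivlMr // mulrC ler_pdivrMr ?ltr0n // -natrM ler_nat.
have := (S_stable c xS).2.
have : badset G S c x \subset fibre S c x by apply/fintype.subsetP => y; rewrite inE => /andP[].
by move=> /setIidPr e; rewrite cardsD e; lia.
Qed.

(** If all [j] from 2 to 13 failed, [zeta 13] would be at most [K^12 * #|X|], hence below [2^(-78)];
    but each of the 6 * 13 = 78 steps keeps at least half of the weight inside [S]. As [q] bounds
    all lengths [6 * j], one [K] serves every [j]. *)
Lemma closed_walk_exists (q : nat) : (78 <= q)%N ->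
  (q%:R ^+ 2 * sigma) ^+ 12 * #|X|%:R < 2^-1 ^+ 78 :> R ->
  exists j0 (x : X) (l : seq X), [/\ (2 <= j0 <= 13)%N, size l = (6 * j0)%N, last x l = x,
     forall i, (i < 6 * j0)%N -> step_kernel (step_type i) (nth x (x :: l) i) (nth x l i) != 0 &
     forall i j, (i < j < 6 * j0)%N -> (nth x l i) (step_type i) != (nth x l j) (step_type j)].
Proof.
move=> q78 small.
pose co (c : 'I_3) (x : X) := x c.
have cw j := @closed_walk R X step_kernel step_kernel_ge0 step_kernel_sym step_kernel_row V co _ sigma sigma_ge0 sigma2
   step_kernel_conflict j.
pose Q j := exists (x : X) (l : seq X), [/\ size l = (6 * j)%N, last x l = x,
     forall i, (i < 6 * j)%N -> step_kernel (step_type i) (nth x (x :: l) i) (nth x l i) != 0 &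
     forall i i', (i < i' < 6 * j)%N -> co (step_type i) (nth x l i) != co (step_type i') (nth x l i')].
set K := q%:R ^+ 2 * sigma in small.
have K0 : 0 <= K by rewrite mulr_ge0 ?exprn_ge0.
have H m : (m < 13)%N -> (exists2 j, (2 <= j <= 13)%N & Q j) \/
     zeta step_kernel m.+1 <= K ^+ m * #|X|%:R.
  elim: m => [|m IH] m13.
    (* No walk is sought for [j = 1], whose grid would have only two rows; contraction alone bounds
       [zeta 1]. *)
    right; rewrite expr0 mul1r -(zeta0 step_kernel); apply: zeta1_le => //.
    - exact: step_kernel_ge0.
    - exact: step_kernel_sym.
    - exact: step_kernel_row.
  case: (IH (ltnW m13)) => [|zm]; first by left.
  have [//|q'|zm'] := cw m.+2; first by left; exists m.+2; rewrite // m13.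
  right; apply: le_trans zm' _; rewrite [K ^+ _]exprS -[X in _ <= X]mulrA.
  have KL : (6 * m.+2)%:R ^+ 2 * sigma <= K.
    rewrite /K ler_wpM2r // ler_pXn2r ?nnegrE ?ler0n // ler_nat; lia.
  apply: le_trans (ler_wpM2r (hs_ge0 _) KL) _.
  exact: ler_wpM2l.
case: (H 12%N isT) => [[j jr [x [l [h1 h2 h3 h4]]]]|zm]; first by exists j, x, l.
have := @zeta_lower R X step_kernel step_kernel_ge0 S 13 2^-1.
rewrite invr_ge0 ler0n => /(_ isT S_gt0 (fun c x xS => step_kernel_lower c xS)) low.
by have := lt_le_trans (le_lt_trans zm small) low; rewrite ltxx.
Qed.

(* Row [b] of the grid is the state reached after [b] blocks of three steps;
   in an even block the coordinates change in increasing order, in an odd one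
   in decreasing order. *)
Theorem grid_exists (q : nat) : (78 <= q)%N ->
  (q%:R ^+ 2 * sigma) ^+ 12 * #|X|%:R < 2^-1 ^+ 78 :> R ->
  exists j0 (g : nat -> 'I_3 -> V), [/\ (2 <= j0 <= 13)%N,
    forall e, g (2 * j0)%N e = g 0%N e,
    forall b b' e e', (b < 2 * j0)%N -> (b' < 2 * j0)%N -> g b e = g b' e' ->
       b = b' /\ e = e' &
    forall b c, (b < 2 * j0)%N -> exists x y : X,
      [/\ x \in S, y \in S, off c x = off c y, G c x y &
          [/\ x c = g b c, y c = g b.+1 c &
          forall e, e != c ->
            x e = g (if (e < c)%N (+) odd b then b.+1 else b) e]]].
Proof.
move=> q78 small.
have [j0 [x [l [jr sl lx st nc]]]] := closed_walk_exists q78 small.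
pose s i e := (nth x (x :: l) i) e.
have stE i : (i < 6 * j0)%N -> [/\ nth x (x :: l) i \in S, nth x l i \in S,
   off (step_type i) (nth x (x :: l) i) = off (step_type i) (nth x l i) & G (step_type i) (nth x (x :: l) i) (nth x l i)].
  by move=> /st; rewrite /step_kernel; case: ifP => [/and4P[? ? /eqP ? ?] _|]; rewrite ?eqxx.
have s_step i e : (i < 6 * j0)%N -> e != step_type i -> s i.+1 e = s i e.
  by move=> /stE[_ _ p _] en; rewrite /s /= (off_eqP p).
have ncs i j : (i < 6 * j0)%N -> (j < 6 * j0)%N -> s i.+1 (step_type i) = s j.+1 (step_type j) -> i = j.
  move=> il jl; rewrite /s /= => h.
  case: (ltngtP i j) => // ij.
    by have := nc i j; rewrite ij jl h eqxx => /(_ isT).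
  by have := nc j i; rewrite ij il h eqxx => /(_ isT).
pose g b e := s (3 * b)%N e.
have gP e : g (2 * j0)%N e = g 0%N e.
  rewrite /g /s muln0 [in RHS]/=.
  have -> : (3 * (2 * j0) = size l)%N by rewrite sl; lia.
  by rewrite -[size l]/((size (x :: l)).-1) nth_last /= lx.
have typ b e : step_type (3 * b + pos b e) = e by apply/eqP; rewrite step_type_pos ?pos_lt.
have ginj1 b b' e e' : (b < 2 * j0)%N -> (b' < 2 * j0)%N -> g b.+1 e = g b'.+1 e' ->
     b = b' /\ e = e'.
  move=> bl bl'; rewrite /g (block_intro s_step) // [in RHS](block_intro s_step) //.
  rewrite -{2}(typ b e) -{2}(typ b' e') => /ncs.
  have p3 := pos_lt b e; have p3' := pos_lt b' e'.
  move=> h; have hh : (3 * b + pos b e = 3 * b' + pos b' e')%N by apply: h; lia.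
  have bb : b = b' by lia.
  by split=> //; rewrite -(typ b e) -(typ b' e') hh.
exists j0, g; split=> //.
  (* The vertices introduced by the steps are those of rows 1 to [2 * j0]; row 0 is therefore read
     as row [2 * j0], and [pb b] is the block that produces row [b]. *)
  pose pb b := if b is b1.+1 then b1 else (2 * j0).-1.
  have pbE b e : (b < 2 * j0)%N -> g b e = g (pb b).+1 e.
    case: b => [|b] //= _; rewrite -gP; congr (g _ e); lia.
  have pbl b : (b < 2 * j0)%N -> (pb b < 2 * j0)%N.
    by case: b => [|b] /=; lia.
  move=> b b' e e' bl bl'; rewrite (pbE b) // (pbE b') // => /ginj1 [||h ->]; rewrite ?pbl //.
  by split=> //; move: h bl bl'; rewrite /pb; case: b; case: b' => [|b'] //; lia.
move=> b c bl.
have p3 := pos_lt b c.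
have kl : (3 * b + pos b c < 6 * j0)%N by lia.
have [xS yS pxy gxy] := stE _ kl; rewrite typ in pxy gxy.
exists (nth x (x :: l) (3 * b + pos b c)), (nth x l (3 * b + pos b c)); split=> //.
split.
- rewrite -[LHS]/(s (3 * b + pos b c)%N c) (block_coord s_step) //; last by lia.
  by rewrite ltnn.
- by rewrite -[LHS]/(s (3 * b + pos b c).+1 c) /g (block_intro s_step).
- move=> e ec; rewrite -[LHS]/(s (3 * b + pos b c)%N e) (block_coord s_step) //; last by lia.
congr (s _ e); congr (3 * _)%N; congr (if _ then _ else _).
have := ltn_ord c; have := ltn_ord e; have : (e : nat) != c by [].
by rewrite /pos; case: (odd b); rewrite ?addbF ?addbT; lia.
Qed.

End Grid.

From mathcomp Require Import all_classical all_reals all_analysis.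
Import numFieldNormedType.Exports.

(** * Homeomorphisms *)

Section Homeo.

Lemma homeo_trans (X Y Z : topologicalType) :
  homeomorphic X Y -> homeomorphic Y Z -> homeomorphic X Z.
Proof.
move=> [f [g [cf cg fg gf]]] [f' [g' [cf' cg' fg' gf']]].
exists (f' \o f), (g \o g'); split.
- by move=> x; apply: continuous_comp; [apply: cf|apply: cf'].
- by move=> x; apply: continuous_comp; [apply: cg'|apply: cg].
- by move=> x /=; rewrite fg' fg.
- by move=> x /=; rewrite gf gf'.
Qed.

Lemma homeo_sym (X Y : topologicalType) : homeomorphic X Y -> homeomorphic Y X.
Proof. by move=> [f [g [cf cg fg gf]]]; exists g, f; split. Qed.

Lemma homeo_refl (X : topologicalType) : homeomorphic X X.
Proof. by exists id, id; split=> // x; apply: cvg_id. Qed.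

Lemma cts_pair (X Y Z : topologicalType) (f : X -> Y) (g : X -> Z) x :
  {for x, continuous f} -> {for x, continuous g} ->
  {for x, continuous (fun y => (f y, g y))}.
Proof. by move=> cf cg; apply: cvg_pair. Qed.

Lemma pair_continuous (X Y Z : topologicalType) (f : X -> Y) (g : X -> Z) :
  continuous f -> continuous g -> continuous (fun x => (f x, g x)).
Proof. by move=> cf cg x; apply: cvg_pair; [exact: cf|exact: cg]. Qed.

Lemma homeo_prod (X Y X' Y' : topologicalType) :
  homeomorphic X X' -> homeomorphic Y Y' ->
  homeomorphic (X * Y)%type (X' * Y')%type.
Proof.
move=> [f [g [cf cg fg gf]]] [f' [g' [cf' cg' fg' gf']]].
exists (fun p => (f p.1, f' p.2)), (fun p => (g p.1, g' p.2)); split.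
- move=> [x y]; apply: cvg_pair; [apply: (@continuous_comp _ _ _ fst f)|
    apply: (@continuous_comp _ _ _ snd f')];
   by [apply: cvg_fst|apply: cvg_snd|apply: cf|apply: cf'].
- move=> [x y]; apply: cvg_pair; [apply: (@continuous_comp _ _ _ fst g)|
    apply: (@continuous_comp _ _ _ snd g')];
   by [apply: cvg_fst|apply: cvg_snd|apply: cg|apply: cg'].
- by move=> [x y] /=; rewrite fg fg'.
- by move=> [x y] /=; rewrite gf gf'.
Qed.

Lemma val_continuous (X : topologicalType) (A : set X) : continuous (set_val : A -> X).
Proof. exact: initial_continuous. Qed.

Lemma into_set_continuous (X Y : topologicalType) (B : set Y) (f : X -> B) :
  continuous (fun x => set_val (f x)) -> continuous f.
Proof. by move=> h; apply: (@continuous_comp_initial _ X Y set_val f). Qed.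

Definition into_set (T : Type) (A : set T) (x : T) (Ax : A x) : A := exist _ x (mem_set Ax).

(** The maps are total on the ambient spaces but need continuity only at points of the sets, so that
    they may divide by a quantity vanishing elsewhere. *)
Lemma homeo_sets (X Y : topologicalType) (A : set X) (B : set Y) (f : X -> Y) (g : Y -> X) :
  (forall x, A x -> {for x, continuous f}) -> (forall y, B y -> {for y, continuous g}) ->
  (forall x, A x -> B (f x)) -> (forall y, B y -> A (g y)) ->
  (forall x, A x -> g (f x) = x) -> (forall y, B y -> f (g y) = y) ->
  homeomorphic (set_type A) (set_type B).
Proof.
move=> cf cg fAB gBA gf fg.
exists (fun x : A => into_set (fAB _ (set_valP x))), (fun y : B => into_set (gBA _ (set_valP y))).
split.
- apply: into_set_continuous => x; apply: (@continuous_comp _ _ _ set_val f).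
    exact: val_continuous.
  exact/cf/set_valP.
- apply: into_set_continuous => x; apply: (@continuous_comp _ _ _ set_val g).
    exact: val_continuous.
  exact/cg/set_valP.
- by move=> x; apply: val_inj => /=; apply/gf/set_valP.
- by move=> y; apply: val_inj => /=; apply/fg/set_valP.
Qed.

Lemma homeo_sets_prod (X Y Z : topologicalType) (A : set X) (B : set Y) (C : set Z)
   (f1 : X -> Y) (f2 : X -> Z) (g : Y * Z -> X) :
  continuous f1 -> continuous f2 -> continuous g ->
  (forall x, A x -> B (f1 x)) -> (forall x, A x -> C (f2 x)) ->
  (forall y z, B y -> C z -> A (g (y, z))) ->
  (forall x, A x -> g (f1 x, f2 x) = x) ->
  (forall y z, B y -> C z -> f1 (g (y, z)) = y /\ f2 (g (y, z)) = z) ->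
  homeomorphic (set_type A) (set_type B * set_type C)%type.
Proof.
move=> c1 c2 cg f1P f2P gP gf fg.
exists (fun x : A => (into_set (f1P _ (set_valP x)), into_set (f2P _ (set_valP x)))).
exists (fun p : B * C => into_set (gP _ _ (set_valP p.1) (set_valP p.2))).
split.
- apply: pair_continuous.
    apply: (@into_set_continuous A Y B (fun x : A => into_set (f1P _ (set_valP x)))) => x.
    by apply: (@continuous_comp _ _ _ set_val f1); [exact: val_continuous|exact: c1].
  apply: (@into_set_continuous A Z C (fun x : A => into_set (f2P _ (set_valP x)))) => x.
  by apply: (@continuous_comp _ _ _ set_val f2); [exact: val_continuous|exact: c2].
- apply: into_set_continuous => -[y z].
  apply: (@continuous_comp _ _ _ (fun p : B * C => (set_val p.1, set_val p.2)) g); last exact: cg.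
  apply: cvg_pair; [apply: (@continuous_comp _ _ _ fst set_val)|
     apply: (@continuous_comp _ _ _ snd set_val)];
   by [apply: cvg_fst|apply: cvg_snd|apply: val_continuous].
- by move=> x; apply: val_inj => /=; apply/gf/set_valP.
- move=> [y z] /=; have [e1 e2] := fg _ _ (set_valP y) (set_valP z).
  by congr pair; apply: val_inj => /=.
Qed.

End Homeo.

(** * Continuity of real and vector-valued expressions *)

Section Cont.
Context {R : realType} {T : topologicalType}.
Implicit Types (f g : T -> R) (x : T).
Local Notation "x :C f" := {for x, continuous f} (at level 70).

Lemma eq_cts f g x : f =1 g -> x :C g -> x :C f.
Proof. by move=> /funext ->. Qed.

Lemma ctsD f g x : x :C f -> x :C g -> x :C (fun y => f y + g y).
Proof. by move=> cf cg; apply: (@continuousD R R^o T f g). Qed.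

Lemma ctsB f g x : x :C f -> x :C g -> x :C (fun y => f y - g y).
Proof. by move=> cf cg; apply: (@continuousB R R^o T f g). Qed.

Lemma ctsM f g x : x :C f -> x :C g -> x :C (fun y => f y * g y).
Proof. by move=> cf cg; apply: (@continuousM R T f g). Qed.

Lemma ctsV f x : f x != 0 -> x :C f -> x :C (fun y => (f y)^-1).
Proof. by move=> f0 cf; apply: (@continuousV R T f). Qed.

Lemma cts_cst (a : R) x : x :C (fun=> a).
Proof. exact: cvg_cst. Qed.

Lemma cts_min f g x : x :C f -> x :C g -> x :C (fun y => Num.min (f y) (g y)).
Proof. by move=> cf cg; apply: (@continuous_min R T f g). Qed.

Lemma cts_max f g x : x :C f -> x :C g -> x :C (fun y => Num.max (f y) (g y)).
Proof. by move=> cf cg; apply: (@continuous_max R T f g). Qed.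

Lemma cts_norm f x : x :C f -> x :C (fun y => `|f y|).
Proof. by move=> cf; apply: (@cvg_norm R R^o T). Qed.

Lemma cts_sum (I : Type) (r : seq I) (p : pred I) (f : I -> T -> R) x :
  (forall i, x :C f i) -> x :C (fun y => \sum_(i <- r | p i) f i y).
Proof.
move=> cf; elim: r => [|i r IH].
  by apply: (@eq_cts _ (fun=> 0)) => [y|]; [rewrite big_nil|exact: cts_cst].
case pi: (p i).
  apply: (@eq_cts _ (fun y => f i y + \sum_(j <- r | p j) f j y)).
    by move=> y; rewrite big_cons pi.
  exact: ctsD.
by apply: eq_cts IH; move=> y; rewrite big_cons pi.
Qed.

Lemma cts_row n (f : T -> 'rV[R]_n) x : (forall i, x :C (fun y => f y ord0 i)) -> x :C f.
Proof.
move=> h A /= [P nP sA].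
have H : \forall y \near x, forall i j, P i j (f y i j).
  apply: filter_forall => i; apply: filter_forall => j; rewrite (ord1 i).
  exact: (h j) (nP ord0 j).
by apply: filterS H => y Hy; apply: sA.
Qed.

Lemma cts_rowE n (f : 'I_n -> T -> R) x : (forall i, x :C f i) -> x :C (fun y => \row_i f i y).
Proof.
move=> h; apply: cts_row => i.
by apply: eq_cts (h i); move=> y; rewrite mxE.
Qed.

End Cont.

Lemma cts_coord (R : realType) n (i : 'I_n) (x : 'rV[R]_n) :
  {for x, continuous (fun y : 'rV[R]_n => y ord0 i)}.
Proof. exact: coord_continuous. Qed.

Lemma complex_ofP (V : finType) (S : {set {set V}}) (f : {set V}) :
  reflect (exists2 e, e \in S & f \subset e) (f \in complex_of S).
Proof. by rewrite inE; apply: (iffP exists_inP). Qed.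

Lemma supp0 (R : realType) n (x : 'rV[R]_n) (A : {set 'I_n}) i :
  supp x \subset A -> i \notin A -> x ord0 i = 0.
Proof.
move=> /fintype.subsetP h; apply: contraNeq => xi; apply: h.
by rewrite inE.
Qed.

Lemma supp_subP (R : realType) n (x : 'rV[R]_n) (A : {set 'I_n}) :
  (forall i, x ord0 i != 0 -> i \in A) -> supp x \subset A.
Proof. by move=> h; apply/fintype.subsetP => i; rewrite inE; apply: h. Qed.

(** * Stellar subdivision of an edge *)

Section Subdivision.
Variables (R : realType) (n : nat).
Local Notation V := 'I_n.
Implicit Types (S : {set {set V}}) (u v p : V) (x y : 'rV[R]_n).

(* Stellar subdivision at the edge [{u, v}] with new vertex [p]. *)
Definition subdiv S u v p : {set {set V}} :=
  [set s in S | ~~ ((u \in s) && (v \in s))]%SET :|: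
  ([set p |: (s :\ u) | s in [set s in S | (u \in s) && (v \in s)]]%SET :|:
   [set p |: (s :\ v) | s in [set s in S | (u \in s) && (v \in s)]]%SET).

Lemma subdivP S u v p (s : {set V}) :
  reflect [\/ s \in S /\ ~~ ((u \in s) && (v \in s)),
     exists t, [/\ t \in S, u \in t, v \in t & s = p |: (t :\ u)] |
     exists t, [/\ t \in S, u \in t, v \in t & s = p |: (t :\ v)]]
   (s \in subdiv S u v p).
Proof.
rewrite /subdiv !inE; apply: (iffP or3P) => -[].
- by move/andP => [? ?]; apply: Or31.
- by move/imsetP => [t]; rewrite inE => /and3P[? ? ?] ->; apply: Or32; exists t.
- by move/imsetP => [t]; rewrite inE => /and3P[? ? ?] ->; apply: Or33; exists t.
- by case=> -> ->; apply: Or31.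
- by case=> t [? ? ? ->]; apply: Or32; apply/imsetP; exists t; rewrite // inE; apply/and3P.
- by case=> t [? ? ? ->]; apply: Or33; apply/imsetP; exists t; rewrite // inE; apply/and3P.
Qed.

(** The direction that carries mass from [p] to the midpoint of [u] and [v]. *)
Let w u v p : 'rV[R]_n :=
  \row_i (((i == u)%:R + (i == v)%:R) / 2 - (i == p)%:R).

Let sum_delta (u : V) : \sum_i (i == u)%:R = 1 :> R.
Proof. by rewrite (bigD1 u) //= eqxx big1 ?addr0 // => i /negbTE ->. Qed.

Let sum_w u v p : \sum_i w u v p ord0 i = 0.
Proof.
under eq_bigr do rewrite mxE.
rewrite sumrB -big_distrl /= big_split /= !sum_delta; lra.
Qed.

(** [F] hands the weight of [p] in equal halves to [u] and [v]; [G] takes the common part of the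
    weights of [u] and [v] from both and places it on [p]. They are mutually inverse because no face
    of the subdivision contains both [u] and [v], and no face of [S] contains [p]. *)
Lemma subdiv_homeo S u v p : u != v -> p != u -> p != v ->
  (forall s, s \in S -> p \notin s) ->
  homeomorphic (set_type (realization R (subdiv S u v p))) (set_type (realization R S)).
Proof.
move=> uv pu pv fresh.
pose W := w u v p.
have Wu : W ord0 u = 2^-1.
  by rewrite mxE eqxx (negbTE uv) [u == p]eq_sym (negbTE pu); rewrite /=; lra.
have Wv : W ord0 v = 2^-1.
  by rewrite mxE eqxx [v == u]eq_sym (negbTE uv) [v == p]eq_sym (negbTE pv); rewrite /=; lra.
have Wp : W ord0 p = -1.
  by rewrite mxE eqxx (negbTE pu) (negbTE pv); rewrite /=; lra.
have W0 i : i != u -> i != v -> i != p -> W ord0 i = 0.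
  by rewrite mxE => /negbTE -> /negbTE -> /negbTE ->; rewrite /=; lra.
pose F x := x + x ord0 p *: W.
pose t y := 2 * Num.min (y ord0 u) (y ord0 v).
pose G y := y - t y *: W.
have Fi x i : F x ord0 i = x ord0 i + x ord0 p * W ord0 i by rewrite !mxE.
have Gi y i : G y ord0 i = y ord0 i - t y * W ord0 i by rewrite !mxE.
have vi (i : V) : i = u \/ i = v \/ i = p \/ [/\ i != u, i != v & i != p].
  have [->|h1] := eqVneq i u; [by left|right].
  have [->|h2] := eqVneq i v; [by left|right].
  by have [->|h3] := eqVneq i p; [left|right].
have minS x : realization R (subdiv S u v p) x -> Num.min (x ord0 u) (x ord0 v) = 0.
  move=> [x0 _ /complex_ofP[s sS sx]].
  suff : x ord0 u = 0 \/ x ord0 v = 0.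
    by case=> h; rewrite h minElt; have := x0 u; have := x0 v; rewrite ?h; case: ifP => //; lra.
  case/subdivP: sS => [[_ h]|[q [_ uq vq e]]|[q [_ uq vq e]]].
  - move: h; rewrite negb_and => /orP[] h; [left|right]; exact: supp0 sx h.
  - by left; apply: supp0 sx _; rewrite e !inE eqxx eq_sym (negbTE pu).
  - by right; apply: supp0 sx _; rewrite e !inE eqxx eq_sym (negbTE pv).
have pS y : realization R S y -> y ord0 p = 0.
  by move=> [_ _ /complex_ofP[s sS sy]]; apply: supp0 sy (fresh _ sS).
apply: (homeo_sets (f := F) (g := G)).
- move=> x _; apply: cts_row => i.
  apply: (@eq_cts _ _ _ (fun y => y ord0 i + y ord0 p * W ord0 i)); first by move=> y; rewrite Fi.
  by apply: ctsD; [apply: cts_coord|apply: ctsM; [apply: cts_coord|apply: cts_cst]].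
- move=> x _; apply: cts_row => i.
  apply: (@eq_cts _ _ _ (fun y => y ord0 i - t y * W ord0 i)); first by move=> y; rewrite Gi.
  apply: ctsB; first exact: cts_coord.
  apply: ctsM; last exact: cts_cst.
  by apply: ctsM; [exact: cts_cst|apply: cts_min; apply: cts_coord].
- move=> x xS; have [x0 x1 /complex_ofP[s sS sx]] := xS.
  have p0 := x0 p; have u0 := x0 u; have v0 := x0 v.
  split.
  + move=> i; rewrite Fi; case: (vi i) => [->|[->|[->|[h1 h2 h3]]]].
    * by rewrite Wu addr_ge0 ?mulr_ge0 ?invr_ge0.
    * by rewrite Wv addr_ge0 ?mulr_ge0 ?invr_ge0.
    * by rewrite Wp; lra.
    * by rewrite W0 // mulr0 addr0.
  + under eq_bigr do rewrite Fi.
    by rewrite big_split /= -big_distrr /= sum_w mulr0 addr0.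
  + apply/complex_ofP.
    have sub (q : {set V}) : u \in q -> v \in q -> {subset s <= p |: q} -> supp (F x) \subset q.
      move=> uq vq sq; apply: supp_subP => i; rewrite Fi.
      case: (vi i) => [->//|[->//|[->|[h1 h2 h3]]]]; first by rewrite Wp mulrN1 subrr eqxx.
      rewrite W0 // mulr0 addr0 => xi.
      have : i \in p |: q by apply: sq; move/fintype.subsetP: sx; apply; rewrite inE.
      by rewrite !inE (negbTE h3).
    case/subdivP: sS => [[sS' h]|[q [qS uq vq e]]|[q [qS uq vq e]]].
    * exists s => //; suff -> : F x = x by [].
      apply/rowP => i; rewrite Fi.
      by rewrite (supp0 sx (fresh _ sS')) mul0r addr0.
    * exists q => //; apply: sub => // i; rewrite e !inE.
      by case/orP => [->//|/andP[_ ->]]; rewrite orbT.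
    * exists q => //; apply: sub => // i; rewrite e !inE.
      by case/orP => [->//|/andP[_ ->]]; rewrite orbT.
- move=> y yS; have [y0 y1 /complex_ofP[s sS sy]] := yS.
  have u0 := y0 u; have v0 := y0 v; have p0 := pS _ yS.
  have mu : Num.min (y ord0 u) (y ord0 v) <= y ord0 u by rewrite ge_min lexx.
  have mv : Num.min (y ord0 u) (y ord0 v) <= y ord0 v by rewrite ge_min lexx orbT.
  have m0 : 0 <= Num.min (y ord0 u) (y ord0 v) by rewrite le_min u0 v0.
  split.
  + move=> i; rewrite Gi; case: (vi i) => [->|[->|[->|[h1 h2 h3]]]].
    * by rewrite Wu /t; lra.
    * by rewrite Wv /t; lra.
    * by rewrite Wp /t p0; lra.
    * by rewrite W0 // mulr0 subr0.
  + under eq_bigr do rewrite Gi.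
    by rewrite sumrB -big_distrr /= sum_w mulr0 subr0.
  + apply/complex_ofP.
    have [/andP[us vs]|nuv] := boolP ((u \in s) && (v \in s)); last first.
      exists s; first by apply/subdivP; apply: Or31.
      suff -> : G y = y by [].
      suff t0 : t y = 0 by apply/rowP => i; rewrite Gi t0 mul0r subr0.
      rewrite /t; move: nuv mu mv m0; rewrite negb_and => /orP[] /(supp0 sy) ->; lra.
    have sub (q : V) : q != p -> G y ord0 q = 0 -> supp (G y) \subset p |: (s :\ q).
      move=> qp Gq; apply: supp_subP => i Gyi; rewrite !inE.
      have [//|ip /=] := eqVneq i p; apply/andP; split.
        by apply: contraNneq Gyi => ->; rewrite Gq.
      case: (vi i) => [->//|[->//|[e|[h1 h2 h3]]]]; first by rewrite e eqxx in ip.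
      by move: Gyi; rewrite Gi W0 // mulr0 subr0 => yi; move/fintype.subsetP: sy; apply; rewrite inE.
    case: (leP (y ord0 u) (y ord0 v)) => h.
      exists (p |: (s :\ u)); first by apply/subdivP; apply: Or32; exists s.
      apply: sub; first by rewrite eq_sym.
      by rewrite Gi Wu /t min_l //; lra.
    exists (p |: (s :\ v)); first by apply/subdivP; apply: Or33; exists s.
    apply: sub; first by rewrite eq_sym.
    by rewrite Gi Wv /t min_r ?ltW //; lra.
- move=> x xS; have m := minS x xS; have [x0 _ _] := xS; have p0 := x0 p.
  have tF : t (F x) = x ord0 p.
    rewrite /t !Fi Wu Wv; move: m; rewrite !minElt; case: ifP; case: ifP; lra.
  by apply/rowP => i; rewrite Gi tF Fi; lra.
- move=> y yS; have p0 := pS y yS.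
  by apply/rowP => i; rewrite Fi !Gi Wp p0; lra.
Qed.

End Subdivision.

(** * A lens as a subdivided quadrilateral *)

Section Lens.
Variables (R : realType) (n : nat).
Local Notation V := 'I_n.
Implicit Types (S Q : {set {set V}}) (a b c p u v : V) (s ps : seq V).

Local Notation "A <~> B" := (homeomorphic (set_type (realization R A)) (set_type (realization R B)))
  (at level 70).

Lemma subdiv_pair Q (s1 s2 : {set V}) u v p :
  (forall s : {set V}, s \in Q -> ~~ ((u \in s) && (v \in s))) ->
  u \in s1 -> v \in s1 -> u \in s2 -> v \in s2 ->
  subdiv (Q :|: [set s1; s2]) u v p =
  Q :|: [set p |: (s1 :\ u); p |: (s2 :\ u); p |: (s1 :\ v); p |: (s2 :\ v)].
Proof.
move=> nQ u1 v1 u2 v2; apply/setP => s; apply/subdivP/idP.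
  case=> [[+ h]|[t [+ ut vt ->]]|[t [+ ut vt ->]]]; rewrite !inE.
  - by case/or3P => [->//|/eqP e|/eqP e]; move: h; rewrite e ?u1 ?v1 ?u2 ?v2.
  - by case/or3P => [/nQ|/eqP ->|/eqP ->]; rewrite ?ut ?vt // eqxx ?orbT.
  - by case/or3P => [/nQ|/eqP ->|/eqP ->]; rewrite ?ut ?vt // eqxx ?orbT.
rewrite !inE -!orbA => /orP[sQ|/or4P[] /eqP ->].
- by apply: Or31; rewrite sQ nQ.
- by apply: Or32; exists s1; split=> //; rewrite !inE eqxx ?orbT.
- by apply: Or32; exists s2; split=> //; rewrite !inE eqxx ?orbT.
- by apply: Or33; exists s1; split=> //; rewrite !inE eqxx ?orbT.
- by apply: Or33; exists s2; split=> //; rewrite !inE eqxx ?orbT.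
Qed.

(** The suspension of the path [x :: s] with poles [a] and [a']. *)
Fixpoint lens a a' x s : {set {set V}} :=
  if s is y :: s' then [set [set a; x; y]; [set a'; x; y]] :|: lens a a' y s' else finset.set0.

Lemma lens_vertex a a' x s (e : {set V}) : e \in lens a a' x s ->
  {subset e <= [:: a, a', x & s]}.
Proof.
elim: s x => [|y s IH] x /=; first by rewrite inE.
rewrite !inE => /orP[/orP[/eqP->|/eqP->]|/IH h] z; last first.
  by move/h; rewrite !inE => /or4P[->|->|->|->]; rewrite ?orbT.
all: by rewrite !inE => /orP[/orP[->|->]|->]; rewrite ?orbT.
Qed.

Lemma set3_insert (a x y p : V) : x != y -> a != x -> a != y ->
  p |: ([set a; x; y] :\ x) = [set a; p; y] /\ p |: ([set a; x; y] :\ y) = [set a; x; p].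
Proof.
move=> xy ax ay; split; apply/setP => z; rewrite !inE.
  have [->|zx] := eqVneq z x.
    by rewrite [x == a]eq_sym (negbTE ax) (negbTE xy) /= !orbF.
  by rewrite /= orbF orbA [(z == p) || _]orbC.
have [->|zy] := eqVneq z y.
  by rewrite [y == a]eq_sym (negbTE ay) [y == x]eq_sym (negbTE xy) /= !orbF.
by rewrite /= orbF orbC.
Qed.

(** A further path vertex [p] between [b] and [x] is the subdivision at the edge [bx], which lies in
    only two faces, one for each pole. *)
Lemma lens_insert Q a a' b x s p :
  b != a -> b != a' -> x != a -> x != a' -> b \notin x :: s -> p \notin [:: a, a', b, x & s] ->
  (forall e, e \in Q -> x \notin e) -> (forall e, e \in Q -> p \notin e) ->
  (Q :|: lens a a' b (p :: x :: s)) <~> (Q :|: lens a a' b (x :: s)).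
Proof.
move=> ba ba' xa xa' bs pn xQ pQ.
have bx : b != x by move: bs; rewrite inE negb_or => /andP[].
pose Q' := Q :|: lens a a' x s.
have nQ' e : e \in Q' -> ~~ ((b \in e) && (x \in e)).
  rewrite inE => /orP[/xQ/negbTE ->|/lens_vertex h]; first by rewrite andbF.
  apply/negP => /andP[/h be _]; move/negP: bs; apply; move: be.
  by rewrite !inE (negbTE ba) (negbTE ba').
have -> : Q :|: lens a a' b (x :: s) = Q' :|: [set [set a; b; x]; [set a'; b; x]].
  apply/setP => e; rewrite /= /Q' !inE.
  by do 2! [case: (_ == _)]; case: (e \in Q); case: (e \in lens _ _ _ _).
have -> : Q :|: lens a a' b (p :: x :: s) = subdiv (Q' :|: [set [set a; b; x]; [set a'; b; x]]) b x p.
  rewrite subdiv_pair //; try by rewrite !inE eqxx ?orbT.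
  have [ab ax a'b a'x] : [/\ a != b, a != x, a' != b & a' != x].
    by rewrite ![_ == b]eq_sym ![_ == x]eq_sym.
  have [-> ->] := @set3_insert a b x p bx ab ax.
  have [-> ->] := @set3_insert a' b x p bx a'b a'x.
  apply/setP => e; rewrite /= /Q' !inE.
  by do 4! [case: (_ == _)]; case: (e \in Q); case: (e \in lens _ _ _ _).
move: pn; rewrite !inE !negb_or => /and5P[pa pa' pb px ps].
apply: subdiv_homeo => // e; rewrite inE => /orP[].
  rewrite inE => /orP[/pQ//|/lens_vertex h]; apply/negP => /h.
  by rewrite !inE (negbTE pa) (negbTE pa') (negbTE px) (negbTE ps).
by rewrite !inE => /orP[] /eqP ->; rewrite !inE (negbTE pb) (negbTE px) ?(negbTE pa) ?(negbTE pa').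
Qed.

(** With one interior vertex [p], the lens consists of the four triangles from [p] to the sides of
    the quadrilateral [a b a' c]: two triangles along the diagonal [aa'], subdivided at that
    diagonal. *)
Lemma lens_base Q a a' b c p : uniq [:: a; a'; b; c] -> p \notin [:: a; a'; b; c] ->
  (forall e, e \in Q -> ~~ ((a \in e) && (a' \in e))) -> (forall e, e \in Q -> p \notin e) ->
  (Q :|: lens a a' b [:: p; c]) <~> (Q :|: [set [set a; a'; b]; [set a; a'; c]]).
Proof.
rewrite /= !inE !negb_or andbT => /and3P[/and3P[aa' ab ac] /andP[a'b a'c] bc].
move=> /and4P[pa pa' pb pc] nQ pQ.
have rot3 (x y z : V) : [set x; y; z] = [set z; x; y] by rewrite finset.setUC finset.setUA.
have -> : Q :|: lens a a' b [:: p; c] = subdiv (Q :|: [set [set a; a'; b]; [set a; a'; c]]) a a' p.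
  rewrite subdiv_pair //; try by rewrite !inE eqxx ?orbT.
  rewrite [[set a; a'; b]]rot3 [[set a; a'; c]]rot3.
  have [ba ba' ca ca'] : [/\ b != a, b != a', c != a & c != a'].
    by rewrite ![b == _]eq_sym ![c == _]eq_sym.
  have [-> ->] := @set3_insert b a a' p aa' ba ba'.
  have [-> ->] := @set3_insert c a a' p aa' ca ca'.
  rewrite /= finset.setU0; congr (_ :|: _).
  have e1 : [set b; p; a'] = [set a'; b; p] by rewrite rot3.
  have e2 : [set b; a; p] = [set a; b; p] by rewrite [[set b; a]]finset.setUC.
  have e3 : [set c; p; a'] = [set a'; p; c] by rewrite rot3 -finset.setUA [_ :|: [set p]]finset.setUC finset.setUA.
  have e4 : [set c; a; p] = [set a; p; c] by rewrite -[RHS]rot3 rot3 rot3.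
  rewrite e1 e2 e3 e4; apply/setP => e; rewrite !inE.
  by do 4! [case: (_ == _)].
apply: subdiv_homeo => // e; rewrite inE => /orP[/pQ//|].
by rewrite !inE => /orP[] /eqP ->; rewrite !inE (negbTE pa) (negbTE pa') ?(negbTE pb) ?(negbTE pc).
Qed.

(** The path is shortened vertex by vertex until one interior vertex is left. The two triangles on
    the right are only a model and need not be edges of the hypergraph. *)
Lemma lens_homeo Q a a' b c ps : uniq [:: a; a'; b; c] -> ps != [::] -> uniq ps ->
  (forall x, x \in ps -> x \notin [:: a; a'; b; c]) ->
  (forall e, e \in Q -> ~~ ((a \in e) && (a' \in e))) ->
  (forall e x, e \in Q -> x \in ps -> x \notin e) ->
  (Q :|: lens a a' b (rcons ps c)) <~> (Q :|: [set [set a; a'; b]; [set a; a'; c]]).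
Proof.
move=> u4 + + + nQ; elim: ps => [//|p ps IH] _ up pn pQ.
case: ps IH up pn pQ => [|x s] IH up pn pQ.
  by apply: lens_base => // [|e eQ]; [apply: pn|apply: pQ]; rewrite ?inE.
have ih : (Q :|: lens a a' b (rcons (x :: s) c)) <~> (Q :|: [set [set a; a'; b]; [set a; a'; c]]).
  apply: IH => //; first by case/andP: up.
    by move=> y ys; apply: pn; rewrite inE ys orbT.
  by move=> e y eQ ys; apply: pQ; rewrite // inE ys orbT.
apply: homeo_trans ih.
have nx y : y \in x :: s -> y \notin [:: a; a'; b; c] by move=> ys; apply: pn; rewrite inE ys orbT.
have := u4; rewrite /= !inE !negb_or andbT => /and3P[/and3P[aa' ab ac] /andP[a'b a'c] bc].
have := nx x; rewrite mem_head !inE !negb_or => /(_ isT)/and4P[xa xa' xb xc].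
have := pn p; rewrite mem_head !inE !negb_or => /(_ isT)/and4P[pa pa' pb pc].
apply: (@lens_insert Q a a' b x (rcons s c) p) => //; try by rewrite eq_sym.
- rewrite -[x :: rcons s c]/(rcons (x :: s) c) mem_rcons inE negb_or bc /=.
  by apply/negP => /nx; rewrite !inE eqxx !orbT.
- rewrite -[x :: rcons s c]/(rcons (x :: s) c) !inE mem_rcons !inE.
  move: up; rewrite /= !inE => /andP[/negbTE h _]; move/norP: (negbT h) => [h1 h2].
  by rewrite (negbTE pa) (negbTE pa') (negbTE pb) (negbTE pc) (negbTE h1) (negbTE h2).
- by move=> e eQ; apply: pQ; rewrite // !inE eqxx orbT.
- by move=> e eQ; apply: pQ; rewrite // !inE eqxx.
Qed.


End Lens.

(** * All lenses simultaneously *)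

Section LensFamily.
Variables (R : realType) (n : nat).
Local Notation V := 'I_n.
Local Notation "A <~> B" := (homeomorphic (set_type (realization R A)) (set_type (realization R B)))
  (at level 70).

(** As the path has interior vertices, no triangle of the lens contains both of its ends. The
    condition on the diagonals of other pieces can thus be tested with one end [t] at a time. *)
Lemma lens_end (a a' x c : V) (s : seq V) (e : {set V}) : s != [::] ->
  e \in lens a a' x (rcons s c) ->
  exists2 t, t \in [:: x; c] & {subset e <= [:: a, a', t & s]}.
Proof.
elim: s x => [//|y s IH] x _ /=; rewrite !inE => /orP[/orP[/eqP->|/eqP->]|].
- by exists x; rewrite ?inE ?eqxx // => z; rewrite !inE => /orP[/orP[->|->]|->]; rewrite ?orbT.
- by exists x; rewrite ?inE ?eqxx // => z; rewrite !inE => /orP[/orP[->|->]|->]; rewrite ?orbT.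
case: s IH => [_|y' s IH].
  rewrite /= !inE orbF => h; exists c; first by rewrite !inE eqxx orbT.
  by case/orP: h => /eqP -> z; rewrite !inE => /orP[/orP[->|->]|->]; rewrite ?orbT.
move/(IH y isT) => [t]; rewrite !inE => /orP[]/eqP -> h.
  exists c; rewrite ?inE ?eqxx ?orbT // => z /h; rewrite !inE.
  by move=> /or4P[->|->|->|/orP[->|->]]; rewrite ?orbT.
exists c; rewrite ?inE ?eqxx ?orbT // => z /h; rewrite !inE.
by move=> /or4P[->|->|->|/orP[->|->]]; rewrite ?orbT.
Qed.

Variables (I : finType) (a a' b c : I -> V) (ps : I -> seq V).
Hypothesis u4 : forall i, uniq [:: a i; a' i; b i; c i].
Hypothesis ps0 : forall i, ps i != [::].
Hypothesis psu : forall i, uniq (ps i).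
Hypothesis fresh : forall i j x, x \in ps i -> x \notin [:: a j; a' j; b j; c j].
Hypothesis disj : forall i j x, i != j -> x \in ps i -> x \notin ps j.
Hypothesis nob : forall i j t, i != j -> t \in [:: b j; c j] ->
  ~~ ((a i \in [:: a j; a' j; t]) && (a' i \in [:: a j; a' j; t])).

Let L i := lens (a i) (a' i) (b i) (rcons (ps i) (c i)).
Let T i : {set {set V}} := [set [set a i; a' i; b i]; [set a i; a' i; c i]]%SET.

(** The lenses are exchanged one by one; the remainder [Q] mixes lenses and model pairs. [nob]
    guarantees that the diagonal [a i, a' i] lies in no other piece of either kind. *)
Lemma lens_family_homeo : (\bigcup_(i : I) L i)%SET <~> (\bigcup_(i : I) T i)%SET.
Proof.
pose U (s : seq I) := (\bigcup_(i : I) (if i \in s then L i else T i))%SET.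
suff H (s : seq I) : uniq s -> U s <~> U [::].
  have -> : (\bigcup_(i : I) L i)%SET = U (enum I).
    by apply: eq_bigr => i _; rewrite mem_enum.
  have -> : (\bigcup_(i : I) T i)%SET = U [::] by [].
  by apply: H; apply: enum_uniq.
elim: s => [|i s IH]; first by move=> _; apply: homeo_refl.
move=> /= /andP[is_ us]; apply: homeo_trans (IH us).
pose Q := (\bigcup_(j | j != i) (if j \in s then L j else T j))%SET.
have -> : U (i :: s) = Q :|: L i.
  rewrite /U (bigD1 i) //= mem_head finset.setUC; congr (_ :|: _).
  by apply: eq_bigr => j ji; rewrite inE (negbTE ji).
have -> : U s = Q :|: T i.
  by rewrite /U (bigD1 i) //= (negbTE is_) finset.setUC.
have QP e : e \in Q -> exists j, j != i /\ ((e \in L j) \/ (e \in T j)).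
  by move/finset.bigcupP => [j ji h]; exists j; split=> //; move: h; case: ifP; auto.
apply: lens_homeo => //.
- by move=> x xi; apply: fresh xi.
- move=> e /QP[j [ji h]].
  have ij : i != j by rewrite eq_sym.
  have [t tj te] : exists2 t, t \in [:: b j; c j] & {subset e <= [:: a j, a' j, t & ps j]}.
    case: h => [/(lens_end (ps0 j))//|]; rewrite !inE => /orP[]/eqP ->.
      exists (b j); rewrite ?inE ?eqxx // => z.
      by rewrite !inE => /orP[/orP[->|->]|->]; rewrite ?orbT.
    exists (c j); rewrite ?inE ?eqxx ?orbT // => z.
    by rewrite !inE => /orP[/orP[->|->]|->]; rewrite ?orbT.
  apply/negP => /andP[/te ai /te a'i]; move/negP: (nob ij tj); apply.
  have [na na'] : a i \notin ps j /\ a' i \notin ps j.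
    by split; apply/negP => /(fresh i); rewrite !inE eqxx ?orbT.
  by move: ai a'i; rewrite !inE (negbTE na) (negbTE na') !orbF => -> ->.
- move=> e x /QP[j [ji h]] xi; apply/negP => xe.
  have nx : x \notin [:: a j; a' j; b j; c j] by apply: fresh xi.
  have nj : x \notin ps j by apply: disj xi; rewrite eq_sym.
  case: h => [/lens_vertex/(_ x xe)|].
    rewrite !inE mem_rcons inE; move: nx; rewrite !inE !negb_or => /and4P[/negbTE-> /negbTE-> /negbTE-> /negbTE->].
    by rewrite (negbTE nj).
  move: nx; rewrite !inE !negb_or => /and4P[/negbTE h1 /negbTE h2 /negbTE h3 /negbTE h4].
  by case/orP => /eqP e0; move: xe; rewrite e0 !inE h1 h2 ?h3 ?h4.
Qed.

End LensFamily.

(** * Cycles and the circle *)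

Section Cycles.
Variables (R : realType) (n : nat).
Local Notation V := 'I_n.
Local Notation "A <~> B" := (homeomorphic (set_type (realization R A)) (set_type (realization R B)))
  (at level 70).
Implicit Types (x y p : V) (s : seq V).

Fixpoint path_edges x s : {set {set V}} :=
  if s is y :: s' then [set x; y]%SET |: path_edges y s' else finset.set0.

Definition cycle_complex x s : {set {set V}} := [set last x s; x]%SET |: path_edges x s.

Lemma path_edges_vertex x s (e : {set V}) : e \in path_edges x s -> {subset e <= x :: s}.
Proof.
elim: s x => [|y s IH] x /=; first by rewrite inE.
rewrite !inE => /orP[/eqP ->|/IH h] z; last by move/h; rewrite !inE => ->; rewrite orbT.
by rewrite !inE => /orP[->|->]; rewrite ?orbT.
Qed.

(** Subdivision at the edge [xy]. For empty [s] the closing edge would coincide with it. *)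
Lemma cycle_insert x y s p : uniq [:: x, p, y & s] -> s != [::] ->
  cycle_complex x (p :: y :: s) <~> cycle_complex x (y :: s).
Proof.
rewrite /= !inE !negb_or => /andP[/and3P[xp xy xs] /andP[/andP[py ps] /andP[ys us]]] s0.
pose Q : {set {set V}} := [set last y s; x]%SET |: path_edges y s.
have ly : last y s != y.
  case: s s0 ys {xs ps us Q} => [//|z s] _ /=; apply: contraNneq => <-; exact: mem_last.
have lp : p != last y s.
  by apply: contraTneq (mem_last y s) => <-; rewrite inE (negbTE py) (negbTE ps).
have nQ e : e \in Q -> ~~ ((x \in e) && (y \in e)).
  rewrite !inE => /orP[/eqP ->|/path_edges_vertex h].
    by rewrite !inE [y == last _ _]eq_sym (negbTE ly) [y == x]eq_sym (negbTE xy) andbF.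
  by apply/negP => /andP[/h + _]; rewrite inE (negbTE xy) (negbTE xs).
(* Only one face contains the edge [xy] here; it is listed twice to fit [subdiv_pair]. *)
have E1 : cycle_complex x (y :: s) = Q :|: [set [set x; y]; [set x; y]]%SET.
  by apply/setP => e; rewrite /cycle_complex /= !inE; do 2! case: (_ == _) => //=; rewrite ?orbT ?orbF.
have E2 : cycle_complex x (p :: y :: s) = subdiv (cycle_complex x (y :: s)) x y p.
  rewrite E1 subdiv_pair //; try by rewrite !inE eqxx ?orbT.
  have -> : p |: ([set x; y] :\ x)%SET = [set p; y]%SET.
    apply/setP => z; rewrite !inE; have [->|//] := eqVneq z x.
    by rewrite (negbTE xy).
  have -> : p |: ([set x; y] :\ y)%SET = [set x; p]%SET.
    apply/setP => z; rewrite !inE; have [->|_] := eqVneq z y; last by rewrite /= orbF orbC.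
    by rewrite [y == x]eq_sym (negbTE xy) /= !orbF.
  apply/setP => e; rewrite /cycle_complex /= !inE.
  by do 3! case: (_ == _) => //=; rewrite ?orbT ?orbF.
rewrite E2; apply: subdiv_homeo => //; try by rewrite eq_sym.
move=> e; rewrite E1 !inE => /orP[/orP[/eqP->|/path_edges_vertex h]|/orP[]/eqP ->].
- by rewrite !inE negb_or lp eq_sym.
- by apply/negP => /h; rewrite inE (negbTE py) (negbTE ps).
- by rewrite !inE negb_or eq_sym xp.
- by rewrite !inE negb_or eq_sym xp.
Qed.

Definition diamond : set (R * R) := [set w : R * R | `|w.1| + `|w.2| = 1]%classic.

(** Opposite vertices go to opposite unit vectors. No edge contains two opposite vertices, so their
    weights are the positive and negative parts of the difference. *)
Lemma cycle4_diamond x0 x1 x2 x3 : uniq [:: x0; x1; x2; x3] ->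
  homeomorphic (set_type (realization R (cycle_complex x0 [:: x1; x2; x3]))) (set_type diamond).
Proof.
rewrite /= !inE !negb_or andbT => /and3P[/and3P[h01 h02 h03] /andP[h12 h13] h23].
pose f (z : 'rV[R]_n) : R * R := (z ord0 x0 - z ord0 x2, z ord0 x1 - z ord0 x3).
pose g (w : R * R) : 'rV[R]_n := \row_i
  (Num.max w.1 0 * (i == x0)%:R + Num.max w.2 0 * (i == x1)%:R
   + Num.max (- w.1) 0 * (i == x2)%:R + Num.max (- w.2) 0 * (i == x3)%:R).
have [h10 h20 h30 h21 h31] : [/\ x1 != x0, x2 != x0, x3 != x0, x2 != x1 & x3 != x1].
  by split; rewrite eq_sym.
have h32 : x3 != x2 by rewrite eq_sym.
have g0 w : g w ord0 x0 = Num.max w.1 0.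
  by rewrite mxE eqxx (negbTE h01) (negbTE h02) (negbTE h03) /=; lra.
have g1 w : g w ord0 x1 = Num.max w.2 0.
  by rewrite mxE eqxx (negbTE h10) (negbTE h12) (negbTE h13) /=; lra.
have g2 w : g w ord0 x2 = Num.max (- w.1) 0.
  by rewrite mxE eqxx (negbTE h20) (negbTE h21) (negbTE h23) /=; lra.
have g3 w : g w ord0 x3 = Num.max (- w.2) 0.
  by rewrite mxE eqxx (negbTE h30) (negbTE h31) (negbTE h32) /=; lra.
have gx w i : i \notin [:: x0; x1; x2; x3] -> g w ord0 i = 0.
  rewrite !inE !negb_or => /and4P[/negbTE i0 /negbTE i1 /negbTE i2 /negbTE i3].
  by rewrite mxE i0 i1 i2 i3 /=; lra.
have vi (i : V) : [\/ i = x0, i = x1, i = x2 | i = x3] \/ i \notin [:: x0; x1; x2; x3].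
  have [|h] := boolP (i \in [:: x0; x1; x2; x3]); last by right.
  by rewrite !inE => /or4P[] /eqP ->; left; [apply: Or41|apply: Or42|apply: Or43|apply: Or44].
have mpos (t : R) : 0 <= Num.max t 0 by rewrite le_max lexx orbT.
have mabs (t : R) : Num.max t 0 + Num.max (- t) 0 = `|t|.
  have [h|] := boolP (0 <= t); last rewrite -ltNge => h.
    by rewrite max_l // max_r ?oppr_le0 // addr0 ger0_norm.
  by rewrite max_r ?ltW // max_l ?oppr_ge0 ?ltW // add0r ltr0_norm.
have mdiff (t : R) : Num.max t 0 - Num.max (- t) 0 = t.
  have [h|] := boolP (0 <= t); last rewrite -ltNge => h.
    by rewrite max_l // max_r ?oppr_le0 // subr0.
  by rewrite max_r ?ltW // max_l ?oppr_ge0 ?ltW // add0r opprK.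
have mneg (t : R) : t <= 0 -> Num.max t 0 = 0 by move=> h; rewrite max_r.
have sumE (z : 'rV[R]_n) : (forall i, i \notin [:: x0; x1; x2; x3] -> z ord0 i = 0) ->
    \sum_i z ord0 i = z ord0 x0 + z ord0 x1 + z ord0 x2 + z ord0 x3.
  move=> h; rewrite (bigD1 x0) //= (bigD1 x1) //= (bigD1 x2) ?h20 //= (bigD1 x3) ?h30 ?h31 //=.
  rewrite big1 => [|i /andP[/andP[/andP[i0 i1] i2] i3]]; last first.
    by apply: h; rewrite !inE !negb_or i0 i1 i2.
  ring.
have reaP (z : 'rV[R]_n) : realization R (cycle_complex x0 [:: x1; x2; x3]) z ->
   [/\ forall i, i \notin [:: x0; x1; x2; x3] -> z ord0 i = 0,
     z ord0 x0 = 0 \/ z ord0 x2 = 0 & z ord0 x1 = 0 \/ z ord0 x3 = 0].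
{ move=> [_ _ /complex_ofP[e]]; rewrite /cycle_complex /= !inE => /or4P[|||/orP[|//]] /eqP -> sz; split.
  all: try by move=> i; rewrite !inE !negb_or => /and4P[i0 i1 i2 i3];
      apply: (supp0 sz); rewrite !inE negb_or ?i0 ?i1 ?i2 ?i3.
  all: try by left; apply: (supp0 sz); rewrite !inE negb_or ?h01 ?h02 ?h03 ?h12 ?h13 ?h10.
  all: by right; apply: (supp0 sz); rewrite !inE negb_or ?h20 ?h21 ?h23 ?h30 ?h31 ?h32. }
apply: (homeo_sets (f := f) (g := g)).
- move=> z _; rewrite /f.
  apply: cts_pair;
   by apply: ctsB; apply: cts_coord.
- move=> w _; apply: cts_rowE => i.
  have c1 : {for w, continuous (fun w : R * R => w.1)} by apply: cvg_fst.
  have c2 : {for w, continuous (fun w : R * R => w.2)} by apply: cvg_snd.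
  have c1' : {for w, continuous (fun w : R * R => - w.1)}.
    apply: (@eq_cts _ _ _ (fun w => 0 - w.1)); first by move=> y; rewrite sub0r.
    by apply: ctsB => //; apply: cts_cst.
  have c2' : {for w, continuous (fun w : R * R => - w.2)}.
    apply: (@eq_cts _ _ _ (fun w => 0 - w.2)); first by move=> y; rewrite sub0r.
    by apply: ctsB => //; apply: cts_cst.
  by do !apply: ctsD; apply: ctsM; try apply: cts_cst; apply: cts_max => //; apply: cts_cst.
- move=> z zr; have [z0 z1 _] := zr; have [zx z02 z13] := reaP _ zr.
  rewrite sumE // in z1; rewrite /diamond /f /=.
  have := z0 x0; have := z0 x1; have := z0 x2; have := z0 x3 => p3 p2 p1 p0.
  by case: z02 => e1; case: z13 => e2; rewrite e1 e2 ?sub0r ?subr0 ?normrN !ger0_norm //;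
    move: z1; rewrite e1 e2; lra.
- move=> w; rewrite /diamond /= => w1; split.
  + move=> i; case: (vi i) => [[->|->|->|->]|/gx -> //]; by rewrite ?g0 ?g1 ?g2 ?g3.
  + rewrite sumE; last by move=> i; apply: gx.
    by rewrite g0 g1 g2 g3 -w1 -!mabs; ring.
  + have pick2 (y z : V) : [set y; z]%SET \in cycle_complex x0 [:: x1; x2; x3] ->
       (forall i, i \in [:: x0; x1; x2; x3] -> (i == y) || (i == z) \/ g w ord0 i = 0) ->
       supp (g w) \in complex_of (cycle_complex x0 [:: x1; x2; x3]).
      move=> h1 h2; apply/complex_ofP; exists [set y; z]%SET => //.
      apply: supp_subP => i gi; rewrite !inE.
      have [ii|/(gx w) e] := boolP (i \in [:: x0; x1; x2; x3]); last by rewrite e eqxx in gi.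
      by case: (h2 _ ii) => // e; rewrite e eqxx in gi.
    case: (lerP 0 w.1) => s1; case: (lerP 0 w.2) => s2.
    * apply: (pick2 x0 x1); first by rewrite /cycle_complex /= !inE eqxx ?orbT.
      move=> i; rewrite !inE => /or4P[]/eqP ->; rewrite ?eqxx ?orbT; auto; right;
       by rewrite ?g2 ?g3 mneg // oppr_le0.
    * apply: (pick2 x3 x0); first by rewrite /cycle_complex /= !inE eqxx ?orbT.
      move=> i; rewrite !inE => /or4P[]/eqP ->; rewrite ?eqxx ?orbT; auto; right.
        by rewrite g1 mneg // ltW.
      by rewrite g2 mneg // oppr_le0.
    * apply: (pick2 x1 x2); first by rewrite /cycle_complex /= !inE eqxx ?orbT.
      move=> i; rewrite !inE => /or4P[]/eqP ->; rewrite ?eqxx ?orbT; auto; right.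
        by rewrite g0 mneg // ltW.
      by rewrite g3 mneg // oppr_le0.
    * apply: (pick2 x2 x3); first by rewrite /cycle_complex /= !inE eqxx ?orbT.
      move=> i; rewrite !inE => /or4P[]/eqP ->; rewrite ?eqxx ?orbT; auto; right;
       by rewrite ?g0 ?g1 mneg // ltW.
- move=> z zr; have [z0 z1 _] := zr; have [zx z02 z13] := reaP _ zr.
  have := z0 x0; have := z0 x1; have := z0 x2; have := z0 x3 => p3 p2 p1 p0.
  apply/rowP => i; case: (vi i) => [|ni]; last by rewrite gx ?zx.
  have mm (p q : R) : 0 <= p -> 0 <= q -> p = 0 \/ q = 0 ->
      Num.max (p - q) 0 = p /\ Num.max (- (p - q)) 0 = q.
    move=> hp hq [] ->; rewrite ?sub0r ?subr0 ?opprK.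
      by rewrite mneg ?oppr_le0 // max_l.
    by rewrite max_l // mneg ?oppr_le0.
  have [m0 m2] := mm _ _ p0 p2 z02; have [m1 m3] := mm _ _ p1 p3 z13.
  by case=> ->; rewrite ?g0 ?g1 ?g2 ?g3 /f /=.
- by move=> [u v] _; rewrite /f g0 g1 g2 g3 /= !mdiff.
Qed.

(** Radial projection in both directions; each norm is nonzero where the other equals 1. *)
Lemma diamond_circle : homeomorphic (set_type diamond) (set_type (circle R)).
Proof.
pose N (w : R * R) : R := Num.sqrt (w.1 ^+ 2 + w.2 ^+ 2).
pose D (w : R * R) : R := `|w.1| + `|w.2|.
pose f (w : R * R) : R * R := ((N w)^-1 * w.1, (N w)^-1 * w.2).
pose g (w : R * R) : R * R := ((D w)^-1 * w.1, (D w)^-1 * w.2).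
have c1 (w : R * R) : {for w, continuous (fun w : R * R => w.1)} by apply: cvg_fst.
have c2 (w : R * R) : {for w, continuous (fun w : R * R => w.2)} by apply: cvg_snd.
have DN (w : R * R) : D w != 0 -> N w != 0.
  apply: contra_neq; rewrite /N /D => /eqP; rewrite sqrtr_eq0 => h.
  have a1 := sqr_ge0 w.1; have a2 := sqr_ge0 w.2.
  have e1 : w.1 ^+ 2 = 0 by lra.
  have e2 : w.2 ^+ 2 = 0 by lra.
  move/eqP: e1; rewrite sqrf_eq0 => /eqP ->.
  by move/eqP: e2; rewrite sqrf_eq0 => /eqP ->; rewrite normr0 addr0.
have ND (w : R * R) : N w != 0 -> D w != 0.
  apply: contra_neq; rewrite /N /D => h.
  have a1 := normr_ge0 w.1; have a2 := normr_ge0 w.2.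
  have e1 : `|w.1| = 0 by lra.
  have e2 : `|w.2| = 0 by lra.
  move/eqP: e1; rewrite normr_eq0 => /eqP ->.
  by move/eqP: e2; rewrite normr_eq0 => /eqP ->; rewrite expr0n /= addr0 sqrtr0.
have N2 w : N w ^+ 2 = w.1 ^+ 2 + w.2 ^+ 2 by rewrite sqr_sqrtr // addr_ge0 ?sqr_ge0.
have N0 w : 0 <= N w by apply: sqrtr_ge0.
have D0 w : 0 <= D w by rewrite addr_ge0.
have scaleN (t : R) w : 0 <= t -> N (t * w.1, t * w.2) = t * N w.
  move=> t0; rewrite /N /= !exprMn -mulrDr sqrtrM ?sqr_ge0 // sqrtr_sqr ger0_norm //.
have scaleD (t : R) w : 0 <= t -> D (t * w.1, t * w.2) = t * D w.
  by move=> t0; rewrite /D /= !normrM (ger0_norm t0) mulrDr.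
apply: (homeo_sets (f := f) (g := g)).
- move=> w wd; rewrite /f.
  have cN : {for w, continuous (fun w => (N w)^-1)}.
    apply: ctsV; first by apply: DN; rewrite /D wd oner_neq0.
    apply: (@continuous_comp _ _ _ (fun w : R * R => w.1 ^+ 2 + w.2 ^+ 2) Num.sqrt).
      by apply: ctsD; apply: ctsM.
    exact: sqrt_continuous.
  apply: cts_pair;
   by apply: ctsM.
- move=> w wd; rewrite /g.
  have cN : {for w, continuous (fun w => (D w)^-1)}.
    apply: ctsV; last by apply: ctsD; apply: cts_norm.
    by apply: ND; rewrite /N wd sqrtr1 oner_neq0.
  apply: cts_pair;
   by apply: ctsM.
- move=> w wd; rewrite /circle /f /=.
  have Nw : N w != 0 by apply: DN; rewrite /D wd oner_neq0.
  by rewrite !exprMn -mulrDr -N2 exprVn mulVf // expf_neq0.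
- move=> w wd; rewrite /diamond /g /=.
  have Dw : D w != 0 by apply: ND; rewrite /N wd sqrtr1 oner_neq0.
  by rewrite !normrM ger0_norm ?invr_ge0 // -mulrDr mulVf.
- move=> w wd; have Nw : N w != 0 by apply: DN; rewrite /D wd oner_neq0.
  rewrite /g scaleD ?invr_ge0 // /f /= [D w]wd mulr1 invrK !mulrA mulfV // !mul1r.
  by case: (w).
- move=> w wd; have Dw : D w != 0 by apply: ND; rewrite /N wd sqrtr1 oner_neq0.
  have N1 : N w = 1 by rewrite /N wd sqrtr1.
  rewrite /f scaleN ?invr_ge0 // N1 mulr1 invrK /g /= !mulrA mulfV // !mul1r.
  by case: (w).
Qed.

(** Vertices are removed until four remain, which is the case of the diamond. *)
Lemma cycle_circle x s : uniq (x :: s) -> (3 <= size s)%N ->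
  homeomorphic (set_type (realization R (cycle_complex x s))) (set_type (circle R)).
Proof.
elim: s => [//|y s IH] us ss.
have [s3|] := ltnP 2 (size s).
  case: s IH us ss s3 => [//|z s] IH us ss s3.
  have us' : uniq (x :: z :: s) by move: us; rewrite /= !inE !negb_or => /and3P[/andP[_ ->] _ ->].
  apply: homeo_trans (IH us' s3).
  by apply: cycle_insert => //; case: (s) s3.
case: s us ss {IH} => [//|z [//|t [|//]]] us _ _.
exact: homeo_trans (cycle4_diamond us) diamond_circle.
Qed.

End Cycles.

(** * The triangulated grid as a product of two cycles *)

Lemma odd_mod2 m j : odd (m %% (2 * j)) = odd m.
Proof.
by rewrite [in RHS](divn_eq m (2 * j)) oddD oddM oddM /= andbF addFb.
Qed.

Section Grid.
Variables (R : realType) (n j0 : nat).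
Local Notation V := 'I_n.
Local Notation P := (2 * j0)%N.
Variable g : 'I_P -> 'I_3 -> V.
Hypothesis g_inj : forall b b' e e', g b e = g b' e' -> b = b' /\ e = e'.
Implicit Types (b : 'I_P) (c e : 'I_3).

(** The number of rows is even, so cyclically adjacent rows always differ in parity; parity thus
    orders the two ends of every edge of the row cycle. *)
Definition oddrow b : 'I_P := if odd b then b else ordS b.
Definition evenrow b : 'I_P := if odd b then ordS b else b.

Lemma odd_oddrow b : odd (oddrow b).
Proof. by rewrite /oddrow; case: ifP => // h; rewrite /= odd_mod2 /= h. Qed.

Lemma odd_evenrow b : odd (evenrow b) = false.
Proof. by rewrite /evenrow; case: ifP => // h; rewrite /= odd_mod2 /= h. Qed.

Lemma oddrow_neq b : oddrow b != evenrow b.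
Proof. by apply: contraTneq (odd_oddrow b) => ->; rewrite odd_evenrow. Qed.

(** The staircase triangulation of a product of ordered complexes: the triangle is a maximal chain
    over an edge of rows and an edge [ce] of colours, with odd rows before even ones and colours
    increasing. *)
Definition grid_triangle b c e : {set V} :=
  [set g (oddrow b) c; g (evenrow b) c; g (if (e < c)%N then oddrow b else evenrow b) e]%SET.

Definition grid_complex : {set {set V}} :=
  [set s | [exists b, exists c, exists e, (e != c) && (s == grid_triangle b c e)]]%SET.

Definition rowcycle : {set {set 'I_P}} := [set [set oddrow b; evenrow b]%SET | b : 'I_P]%SET.

(** The spare fourth vertex makes room to subdivide the triangle of colours into a 4-cycle. *)
Definition emb (e : 'I_3) : 'I_4 := widen_ord (isT : (3 <= 4)%N) e.

Definition colcycle : {set {set 'I_4}} :=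
  [set s | [exists c : 'I_3, exists e : 'I_3, (c < e)%N && (s == [set emb c; emb e]%SET)]]%SET.

Lemma emb_inj : injective emb.
Proof. by move=> c e /(congr1 val) /= h; apply: val_inj. Qed.

Let fa (z : 'rV[R]_n) : 'rV[R]_P := \row_b \sum_e z ord0 (g b e).
Let fc (z : 'rV[R]_n) : 'rV[R]_4 :=
  \row_k \sum_e (k == emb e)%:R * \sum_b z ord0 (g b e).
Let cum (ga : 'rV[R]_4) (k : nat) : R := \sum_(e : 'I_3 | (e < k)%N) ga ord0 (emb e).
(* The row weights and the colour weights are two probability vectors on
   ordered sets (odd rows before even rows); this is their monotone coupling. *)
Let coup (al : 'rV[R]_P) (ga : 'rV[R]_4) b e : R :=
  if odd b then Num.min (al ord0 b) (cum ga e.+1) - Num.min (al ord0 b) (cum ga e)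
  else Num.max (1 - al ord0 b) (cum ga e.+1) - Num.max (1 - al ord0 b) (cum ga e).
Let G (p : 'rV[R]_P * 'rV[R]_4) : 'rV[R]_n :=
  \row_v \sum_(i : 'I_P * 'I_3) (v == g i.1 i.2)%:R * coup p.1 p.2 i.1 i.2.

Let faE z b : fa z ord0 b = \sum_e z ord0 (g b e).
Proof. by rewrite mxE. Qed.

Let fcE z e : fc z ord0 (emb e) = \sum_b z ord0 (g b e).
Proof.
rewrite mxE (bigD1 e) //= eqxx mul1r [X in _ + X]big1 ?addr0 // => e' ne.
by rewrite (inj_eq emb_inj) eq_sym (negbTE ne) mul0r.
Qed.

Let fc_max z : fc z ord0 ord_max = 0.
Proof.
rewrite mxE big1 // => e _; case: eqP => [/(congr1 val) /= h|]; last by rewrite mul0r.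
by have := ltn_ord e; rewrite -h ltnn.
Qed.

Let GE p b e : G p ord0 (g b e) = coup p.1 p.2 b e.
Proof.
rewrite mxE (bigD1 (b, e)) //= eqxx mul1r big1 ?addr0 // => -[b' e'] ne.
case: eqP => [/g_inj[h1 h2]|]; last by rewrite mul0r.
by rewrite h1 h2 eqxx in ne.
Qed.

Let Gout p v : (forall b e, v != g b e) -> G p ord0 v = 0.
Proof. by move=> h; rewrite mxE big1 // => -[b e] _ /=; rewrite (negbTE (h b e)) mul0r. Qed.

Let vcase (v : V) : (exists b e, v = g b e) \/ (forall b e, v != g b e).
Proof.
have [/existsP[[b e] /eqP h]|h] := boolP [exists i : 'I_P * 'I_3, v == g i.1 i.2].
  by left; exists b, e.
right=> b e; apply: contraNneq h => h; apply/existsP; exists (b, e); exact/eqP.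
Qed.

Let sum_grid (z : 'rV[R]_n) : (forall v, (forall b e, v != g b e) -> z ord0 v = 0) ->
  \sum_v z ord0 v = \sum_b \sum_e z ord0 (g b e).
Proof.
move=> h; rewrite pair_bigA /=.
pose f (i : 'I_P * 'I_3) := g i.1 i.2.
have fi : {in [set: 'I_P * 'I_3]%SET &, injective f}.
  by move=> [b e] [b' e'] _ _ /g_inj[/= -> ->].
rewrite [RHS](eq_bigl (fun i => i \in [set: 'I_P * 'I_3]%SET)); last by move=> i; rewrite finset.in_setT.
rewrite -[RHS](big_imset (fun v => z ord0 v) fi) /= [RHS]big_mkcond /=.
apply: eq_bigr => v _; case: ifP => // /negbT nv; apply: h => b e.
by apply: contraNneq nv => ->; apply/imsetP; exists (b, e) => //; rewrite finset.in_setT.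
Qed.

Let cumS ga (e : 'I_3) : cum ga e.+1 = cum ga e + ga ord0 (emb e).
Proof.
rewrite /cum (bigD1 e) //= addrC; congr (_ + _); apply: eq_bigl => e'.
by rewrite ltnS ltn_neqAle andbC.
Qed.

Let cum0 ga : cum ga 0 = 0. Proof. by rewrite /cum big1. Qed.

Let cum_le (ga : 'rV[R]_4) k k' : (forall i, 0 <= ga ord0 i) -> (k <= k')%N -> cum ga k <= cum ga k'.
Proof.
move=> ga0 kk; rewrite /cum big_mkcond [X in _ <= X]big_mkcond; apply: ler_sum => e _.
by case: ifP => h; case: ifP => h' //; lia.
Qed.

Let tele (f : nat -> R) : \sum_(e : 'I_3) (f e.+1 - f e) = f 3%N - f 0%N.
Proof. by rewrite !big_ord_recl big_ord0 /= /bump /=; lra. Qed.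

Let sum4 (ga : 'rV[R]_4) : ga ord0 ord_max = 0 -> \sum_i ga ord0 i = cum ga 3.
Proof.
move=> h; rewrite big_ord_recr /= h addr0 /cum; apply: eq_big => [e|e _]; first by rewrite ltn_ord.
by congr (ga _ _); apply: val_inj.
Qed.

(** The staircase shape: the odd row carries only colours up to [c], the even row only colours from
    [c] on. *)
Let gtriP (z : 'rV[R]_n) b c e : e != c -> supp z \subset grid_triangle b c e ->
  [/\ forall v, (forall b e, v != g b e) -> z ord0 v = 0,
      forall b' e', b' != oddrow b -> b' != evenrow b -> z ord0 (g b' e') = 0,
      forall e' : 'I_3, (e' < c)%N -> z ord0 (g (evenrow b) e') = 0,
      forall e' : 'I_3, (c < e')%N -> z ord0 (g (oddrow b) e') = 0 &
      forall b' e', e' != c -> e' != e -> z ord0 (g b' e') = 0].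
Proof.
move=> ec sz.
have gneq b1 b2 e1 e2 : (b1 != b2) || (e1 != e2) -> (g b1 e1 == g b2 e2) = false.
  by move=> h; apply/eqP => /g_inj[h1 h2]; move: h; rewrite h1 h2 !eqxx.
have on := oddrow_neq b.
split.
- move=> v h; apply: supp0 sz _; rewrite !inE !negb_or.
  by rewrite !h.
- move=> b' e' h1 h2; apply: supp0 sz _; rewrite !inE !gneq ?h1 ?h2 //.
  by case: ifP; rewrite ?h1 ?h2.
- move=> e' h; apply: supp0 sz _; rewrite !inE !negb_or -andbA.
  apply/and3P; split; apply/negbT/gneq.
  + by rewrite eq_sym on.
  + by rewrite -[e' == c]val_eqE neq_ltn h !orbT.
  + case: ifP => h'; first by rewrite eq_sym on.
    by apply/orP; right; apply: contraFneq h' => <-.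
- move=> e' h; apply: supp0 sz _; rewrite !inE !negb_or -andbA.
  apply/and3P; split; apply/negbT/gneq.
  + by rewrite -[e' == c]val_eqE neq_ltn h !orbT.
  + by rewrite on.
  + case: ifP => h'; last by rewrite on.
    by apply/orP; right; apply: contraTneq h' => <-; rewrite -leqNgt ltnW.
- by move=> b' e' h1 h2; apply: supp0 sz _; rewrite !inE !gneq ?h1 ?h2 ?orbT.
Qed.

Let gcomplexP (s : {set V}) : reflect (exists b c e, e != c /\ s = grid_triangle b c e) (s \in grid_complex).
Proof.
rewrite inE; apply: (iffP existsP).
  by move=> [b /existsP[c /existsP[e /andP[h /eqP ->]]]]; exists b, c, e.
move=> [b [c [e [h ->]]]]; exists b; apply/existsP; exists c; apply/existsP; exists e.
by rewrite h eqxx.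
Qed.

Let colcycleP (s : {set 'I_4}) :
  reflect (exists (c e : 'I_3), (c < e)%N /\ s = [set emb c; emb e]%SET) (s \in colcycle).
Proof.
rewrite inE; apply: (iffP existsP).
  by move=> [c /existsP[e /andP[h /eqP ->]]]; exists c, e.
by move=> [c [e [h ->]]]; exists c; apply/existsP; exists e; rewrite h eqxx.
Qed.

Let sum_two b (f : 'I_P -> R) : (forall b', b' != oddrow b -> b' != evenrow b -> f b' = 0) ->
  \sum_b' f b' = f (oddrow b) + f (evenrow b).
Proof.
move=> h; rewrite (bigD1 (oddrow b)) //= (bigD1 (evenrow b)) //=; last by rewrite eq_sym oddrow_neq.
by rewrite big1 ?addr0 // => b' /andP[h1 h2]; apply: h.
Qed.

Let Gcont : continuous G.
Proof.
move=> p; apply: cts_rowE => v; apply: cts_sum => -[b e] /=.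
apply: ctsM; first exact: cts_cst.
have c1 : {for p, continuous (fun p : 'rV[R]_P * 'rV[R]_4 => p.1 ord0 b)}.
  apply: (@continuous_comp _ _ _ fst (fun x : 'rV[R]_P => x ord0 b)); first exact: cvg_fst.
  exact: cts_coord.
have c2 k : {for p, continuous (fun p : 'rV[R]_P * 'rV[R]_4 => cum p.2 k)}.
  apply: cts_sum => i.
  apply: (@continuous_comp _ _ _ snd (fun x : 'rV[R]_4 => x ord0 (emb i))); first exact: cvg_snd.
  exact: cts_coord.
rewrite /coup; case: (odd b).
  by apply: ctsB; apply: cts_min.
by apply: ctsB; apply: cts_max => //; apply: ctsB => //; apply: cts_cst.
Qed.

Let fcum (z : 'rV[R]_n) b k : (forall b' e', b' != oddrow b -> b' != evenrow b -> z ord0 (g b' e') = 0) ->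
  cum (fc z) k = \sum_(e : 'I_3 | (e < k)%N) z ord0 (g (oddrow b) e)
               + \sum_(e : 'I_3 | (e < k)%N) z ord0 (g (evenrow b) e).
Proof.
move=> h; rewrite /cum -big_split /=; apply: eq_bigr => e _.
by rewrite fcE (sum_two (b := b)) // => b' h1 h2; apply: h.
Qed.

(** The map takes both marginals, the inverse is [coup]: in the unit interval the odd row occupies
    [[0, al b]], the even row [[1 - al b, 1]] and colour [e] the interval from [cum e] to
    [cum (e+1)]; the coupling is the length of the overlap. *)
Lemma grid_complex_prod :
  homeomorphic (set_type (realization R grid_complex))
    (set_type (realization R rowcycle) * set_type (realization R colcycle))%type.
Proof.
apply: (homeo_sets_prod (f1 := fa) (f2 := fc) (g := G)).
- move=> z; apply: cts_rowE => b; apply: cts_sum => e; exact: cts_coord.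
- move=> z; apply: cts_rowE => k; apply: cts_sum => e; apply: ctsM; first exact: cts_cst.
  apply: cts_sum => b; exact: cts_coord.
- exact: Gcont.
- move=> z [z0 z1 /complex_ofP[s /gcomplexP[b [c [e [ec ->]]]] sz]].
  have [zout zrow _ _ _] := gtriP ec sz.
  split.
  + by move=> b'; rewrite faE sumr_ge0.
  + by rewrite -z1 sum_grid //; apply: eq_bigr => b' _; rewrite faE.
  + apply/complex_ofP; exists [set oddrow b; evenrow b]%SET; first by apply/imsetP; exists b.
    apply: supp_subP => b'; rewrite faE !inE; apply: contraNT; rewrite negb_or => /andP[h1 h2].
    by rewrite big1 // => e' _; apply: zrow.
- move=> z [z0 z1 /complex_ofP[s /gcomplexP[b [c [e [ec ->]]]] sz]].
  have [zout zrow _ _ zcol] := gtriP ec sz.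
  split.
  + by move=> k; rewrite mxE sumr_ge0 // => e' _; rewrite mulr_ge0 // sumr_ge0.
  + rewrite sum4 // -z1 sum_grid // exchange_big /= /cum.
    by apply: eq_big => [e'|e' _]; [rewrite ltn_ord|rewrite fcE].
  + apply/complex_ofP.
    have sub : supp (fc z) \subset [set emb c; emb e]%SET.
      apply: supp_subP => k; rewrite mxE !inE; apply: contraNT; rewrite negb_or => /andP[h1 h2].
      rewrite big1 // => e' _; have [ke|] := eqVneq k (emb e'); last by rewrite mul0r.
      rewrite big1 ?mulr0 // => b' _; apply: zcol.
        by apply: contraNneq h1 => <-; rewrite ke.
      by apply: contraNneq h2 => <-; rewrite ke.
    have : (e : nat) != c by [].
    rewrite neq_ltn => /orP[h|h].
      exists [set emb e; emb c]%SET; first by apply/colcycleP; exists e, c.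
      by rewrite finset.setUC.
    by exists [set emb c; emb e]%SET; first by apply/colcycleP; exists c, e.
- move=> al ga [a0 a1 /complex_ofP[s /imsetP[b _ ->] sa]] [c0 c1 /complex_ofP[s' /colcycleP[x [y [xy ->]]] sc]].
  have mon k k' := @cum_le ga k k' c0.
  have gm : ga ord0 ord_max = 0.
    by apply: supp0 sc _; rewrite !inE -!val_eqE /= !gtn_eqF // ltnW // ltnS ltnW.
  have cum3 : cum ga 3 = 1 by rewrite -sum4.
  have aoff b' : b' != oddrow b -> b' != evenrow b -> al ord0 b' = 0.
    by move=> h1 h2; apply: supp0 sa _; rewrite !inE negb_or h1 h2.
  have asum : al ord0 (oddrow b) + al ord0 (evenrow b) = 1.
    by rewrite -a1 (sum_two (b := b)).
  have coff e : e != x -> e != y -> ga ord0 (emb e) = 0.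
    by move=> h1 h2; apply: supp0 sc _; rewrite !inE !(inj_eq emb_inj) negb_or h1 h2.
  have cb0 k : 0 <= cum ga k by rewrite -(cum0 ga) mon.
  have cb1 (e : 'I_3) : cum ga e.+1 <= 1 by rewrite -cum3 mon.
  have cb1' (e : 'I_3) : cum ga e <= 1 by rewrite -cum3 mon // ltnW.
  have rowz b' e : al ord0 b' = 0 -> coup al ga b' e = 0.
    move=> h; rewrite /coup h; case: ifP => _; first by rewrite !min_l // subrr.
    by rewrite subr0 !max_l // subrr.
  have colz b' e : ga ord0 (emb e) = 0 -> coup al ga b' e = 0.
    by move=> h; rewrite /coup cumS h addr0 !subrr if_same.
  have c_ge0 b' e : 0 <= coup al ga b' e.
    have h := mon e e.+1 (leqnSn e).
    rewrite /coup; case: ifP => _; rewrite subr_ge0.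
      by rewrite !minEle; do 2! case: ifP; lra.
    by rewrite !maxEle; do 2! case: ifP; lra.
  have Gz v : (forall b e, v != g b e) -> G (al, ga) ord0 v = 0 by apply: Gout.
  split.
  + by move=> v; case: (vcase v) => [[b' [e ->]]|/Gz ->]; rewrite ?GE.
  + rewrite sum_grid //.
    rewrite -[RHS]a1; apply: eq_bigr => b' _.
    rewrite (eq_bigr (fun e => coup al ga b' e)); last by move=> e _; rewrite GE.
    rewrite /coup; case: (odd b').
      rewrite (tele (fun k => Num.min (al ord0 b') (cum ga k))) cum3 cum0.
      have := a0 b'; have : al ord0 b' <= 1.
        by rewrite -a1 (bigD1 b') //= lerDl sumr_ge0.
      by move=> h1 h2; rewrite min_l // min_r // subr0.
    rewrite (tele (fun k => Num.max (1 - al ord0 b') (cum ga k))) cum3 cum0.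
    have := a0 b'; have : al ord0 b' <= 1.
      by rewrite -a1 (bigD1 b') //= lerDl sumr_ge0.
    by move=> h1 h2; rewrite max_r ?max_l; lra.
  + have pick c e : e != c ->
       (forall e', (e' == x) || (e' == y) -> coup al ga (oddrow b) e' != 0 -> g (oddrow b) e' \in grid_triangle b c e) ->
       (forall e', (e' == x) || (e' == y) -> coup al ga (evenrow b) e' != 0 -> g (evenrow b) e' \in grid_triangle b c e) ->
       supp (G (al, ga)) \in complex_of grid_complex.
      move=> ec h1 h2; apply/complex_ofP; exists (grid_triangle b c e); first by apply/gcomplexP; exists b, c, e.
      apply: supp_subP => v; case: (vcase v) => [[b' [e' ->]]|/Gz ->]; last by rewrite eqxx.
      rewrite GE /=.
      have [/h1 k1|] := boolP ((e' == x) || (e' == y)); last first.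
        by rewrite negb_or => /andP[p q]; rewrite colz ?eqxx // coff.
      have [/h2 k2|] := boolP ((e' == x) || (e' == y)); last first.
        by rewrite negb_or => /andP[p q]; rewrite colz ?eqxx // coff.
      have [->//|b1] := eqVneq b' (oddrow b).
      have [->//|b2] := eqVneq b' (evenrow b).
      by rewrite rowz ?eqxx // aoff.
    have yx : y != x by rewrite -val_eqE neq_ltn xy orbT.
    (* One of the four vertices over the colours [x < y] has weight 0: either colour [y] does not
       meet the odd row, or colour [x] is entirely contained in it. *)
    have [oy|oy] := eqVneq (coup al ga (oddrow b) y) 0.
      apply: (pick x y) => // e' /orP[]/eqP -> nz; rewrite !inE ?eqxx ?orbT //.
        by rewrite oy eqxx in nz.
      by rewrite ltnNge ltnW //= eqxx !orbT.
    have ex : coup al ga (evenrow b) x = 0.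
      move: oy; rewrite /coup odd_oddrow odd_evenrow.
      have h := mon x.+1 y xy; have h' := mon y y.+1 (leqnSn y); have h'' := mon x x.+1 (leqnSn x).
      move=> oy; have lt : cum ga y < al ord0 (oddrow b).
        rewrite ltNge; apply: contraNN oy => hh.
        by rewrite !min_l ?subrr // (le_trans hh).
      have e1 : 1 - al ord0 (evenrow b) = al ord0 (oddrow b) by rewrite -asum addrK.
      by rewrite e1 !max_l ?subrr //; lra.
    apply: (pick y x); rewrite 1?eq_sym // => e' /orP[]/eqP -> nz; rewrite !inE ?eqxx ?orbT //.
      by rewrite xy eqxx !orbT.
    by rewrite ex eqxx in nz.
- move=> z [z0 z1 /complex_ofP[s /gcomplexP[b [c [e [ec ->]]]] sz]].
  have [zout zrow zev zod _] := gtriP ec sz.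
  have fcm k := fcum k zrow.
  set So := fun k : nat => \sum_(e' : 'I_3 | (e' < k)%N) z ord0 (g (oddrow b) e').
  set Se := fun k : nat => \sum_(e' : 'I_3 | (e' < k)%N) z ord0 (g (evenrow b) e').
  have So0 k : 0 <= So k by apply: sumr_ge0.
  have Se0 k : 0 <= Se k by apply: sumr_ge0.
  have SoS (e' : 'I_3) : So e'.+1 = So e' + z ord0 (g (oddrow b) e').
    rewrite /So (bigD1 e') //= addrC; congr (_ + _); apply: eq_bigl => e1.
    by rewrite ltnS ltn_neqAle andbC.
  have SeS (e' : 'I_3) : Se e'.+1 = Se e' + z ord0 (g (evenrow b) e').
    rewrite /Se (bigD1 e') //= addrC; congr (_ + _); apply: eq_bigl => e1.
    by rewrite ltnS ltn_neqAle andbC.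
  have ao : fa z ord0 (oddrow b) = So 3%N.
    by rewrite faE; apply: eq_bigl => e'; rewrite ltn_ord.
  have ae : fa z ord0 (evenrow b) = Se 3%N.
    by rewrite faE; apply: eq_bigl => e'; rewrite ltn_ord.
  have tot : So 3%N + Se 3%N = 1.
    rewrite -ao -ae -z1 sum_grid // (sum_two (b := b)); first by rewrite !faE.
    by move=> b' h1 h2; rewrite big1 // => e' _; apply: zrow.
  (* Up to colour [c] the even row has contributed nothing, and beyond [c] the odd row is exhausted;
     hence [min] and [max] with [So 3] recover both partial sums from the colour marginal. *)
  have key k : Se k = 0 \/ So k = So 3%N.
    have [kc|ck] := leqP k c.
      by left; rewrite /Se big1 // => e' ek; apply: zev; apply: leq_trans kc.
    right; rewrite /So [RHS](bigID (fun e' : 'I_3 => (e' < k)%N)) /=.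
    rewrite [X in _ = _ + X]big1 ?addr0; last first.
      by move=> e' /andP[_]; rewrite -leqNgt => h; apply: zod; apply: leq_trans h.
    by apply: eq_bigl => e'; rewrite ltn_ord.
  have SoM k : So k <= So 3%N.
    rewrite /So big_mkcond [X in _ <= X]big_mkcond; apply: ler_sum => e' _ /=.
    by rewrite ltn_ord; case: ifP.
  have minE k : Num.min (So 3%N) (cum (fc z) k) = So k.
    rewrite fcm -/(So k) -/(Se k); case: (key k) => h; rewrite h.
      by rewrite addr0 min_r.
    by rewrite min_l // lerDl.
  have maxE k : Num.max (So 3%N) (cum (fc z) k) = So 3%N + Se k.
    rewrite fcm -/(So k) -/(Se k); case: (key k) => h; rewrite h.
      by rewrite !addr0 max_l.
    by rewrite max_r // lerDl.
  apply/rowP => v; case: (vcase v) => [[b' [e' ->]]|nv]; last by rewrite Gout ?zout.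
  rewrite GE /= /coup.
  have [->|b1] := eqVneq b' (oddrow b).
    by rewrite odd_oddrow ao !minE SoS; lra.
  have [->|b2] := eqVneq b' (evenrow b).
    rewrite odd_evenrow ae.
    have -> : 1 - Se 3%N = So 3%N by lra.
    by rewrite !maxE SeS; lra.
  have -> : fa z ord0 b' = 0 by rewrite faE big1 // => e1 _; apply: zrow.
  rewrite zrow // subr0.
  have cz k : 0 <= cum (fc z) k by rewrite fcm; apply: addr_ge0; [apply: So0|apply: Se0].
  have c1 (e1 : nat) : cum (fc z) e1 <= 1.
    rewrite fcm -/(So e1) -/(Se e1) -tot; apply: lerD (SoM e1) _.
    rewrite /Se big_mkcond [X in _ <= X]big_mkcond.
    by apply: ler_sum => e2 _ /=; rewrite ltn_ord; case: ifP.
  case: ifP => _; first by rewrite (min_l (cz e'.+1)) (min_l (cz e')) subrr.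
  by rewrite (max_l (c1 e'.+1)) (max_l (c1 e')) subrr.
- move=> al ga [a0 a1 /complex_ofP[s /imsetP[b _ ->] sa]] [c0 c1 /complex_ofP[s' /colcycleP[x [y [xy ->]]] sc]].
  have mon k k' := @cum_le ga k k' c0.
  have gm : ga ord0 ord_max = 0.
    by apply: supp0 sc _; rewrite !inE -!val_eqE /= !gtn_eqF // ltnW // ltnS ltnW.
  have cum3 : cum ga 3 = 1 by rewrite -sum4.
  have aoff b' : b' != oddrow b -> b' != evenrow b -> al ord0 b' = 0.
    by move=> h1 h2; apply: supp0 sa _; rewrite !inE negb_or h1 h2.
  have asum : al ord0 (oddrow b) + al ord0 (evenrow b) = 1.
    by rewrite -a1 (sum_two (b := b)).
  have cb0 k : 0 <= cum ga k by rewrite -(cum0 ga) mon.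
  have cb1 (e : 'I_3) : cum ga e.+1 <= 1 by rewrite -cum3 mon.
  have cb1' (e : 'I_3) : cum ga e <= 1 by rewrite -cum3 mon // ltnW.
  split; apply/rowP => i.
    rewrite faE (eq_bigr (fun e => coup al ga i e)); last by move=> e _; rewrite GE.
    rewrite /coup; case: (odd i).
      rewrite (tele (fun k => Num.min (al ord0 i) (cum ga k))) cum3 cum0.
      have := a0 i; have : al ord0 i <= 1.
        by rewrite -a1 (bigD1 i) //= lerDl sumr_ge0.
      by move=> h1 h2; rewrite min_l // min_r // subr0.
    rewrite (tele (fun k => Num.max (1 - al ord0 i) (cum ga k))) cum3 cum0.
    have := a0 i; have : al ord0 i <= 1.
      by rewrite -a1 (bigD1 i) //= lerDl sumr_ge0.
    by move=> h1 h2; rewrite max_r ?max_l; lra.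
  have [->|im] := eqVneq i ord_max; first by rewrite fc_max gm.
  have i3 : (i < 3)%N.
    have := ltn_ord i; rewrite ltnS leq_eqVlt => /orP[/eqP h|//].
    by case/eqP: im; apply: val_inj.
  have -> : i = emb (Ordinal i3) by apply: val_inj.
  set e := Ordinal i3.
  rewrite fcE (sum_two (b := b)); last first.
    move=> b' h1 h2; rewrite GE /= /coup aoff //; case: ifP => _; first by rewrite !min_l // subrr.
    by rewrite subr0 !max_l // subrr.
  rewrite !GE /= /coup odd_oddrow odd_evenrow.
  have -> : 1 - al ord0 (evenrow b) = al ord0 (oddrow b) by rewrite -asum addrK.
  rewrite (cumS ga e) !minEle !maxEle.
  by case: ifP => h1; case: ifP => h2; lra.
Qed.

End Grid.

Lemma ordS_val n (b : 'I_n) : ordS b = (if b.+1 == n then 0 else b.+1)%N :> nat.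
Proof.
case: n b => [[]//|n] b /=; case: eqP => [->|h]; first by rewrite modnn.
by rewrite modn_small //; have := ltn_ord b; lia.
Qed.

Lemma path_edgesP n (x : 'I_n) s (e : {set 'I_n}) :
  reflect (exists2 i, (i < size s)%N & e = [set nth x (x :: s) i; nth x s i]%SET)
    (e \in path_edges x s).
Proof.
suff H (d : 'I_n) : reflect (exists2 i, (i < size s)%N & e = [set nth d (x :: s) i; nth d s i]%SET)
    (e \in path_edges x s) by apply: H.
elim: s x => [|y s IH] x /=; first by rewrite inE; apply: (iffP idP) => // -[].
rewrite !inE; apply: (iffP orP) => [[/eqP ee|/IH[i il ee]]|[[|i] il ee]].
- by exists 0%N.
- by exists i.+1.
- by left; apply/eqP.
- by right; apply/IH; exists i.
Qed.

Lemma oddeven_set j (b : 'I_(2 * j)) : [set oddrow b; evenrow b]%SET = [set b; ordS b]%SET.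
Proof. by rewrite /oddrow /evenrow; case: ifP => // _; rewrite finset.setUC. Qed.

Lemma rowcycle_circle (R : realType) j : (2 <= j)%N ->
  homeomorphic (set_type (realization R (rowcycle j))) (set_type (circle R)).
Proof.
move=> j2; have P0 : (0 < 2 * j)%N by lia.
pose x0 : 'I_(2 * j) := Ordinal P0; pose s := behead (enum 'I_(2 * j)).
have es : enum 'I_(2 * j) = x0 :: s.
  have := nth_ord_enum x0 x0; rewrite /s; have := size_enum_ord (2 * j).
  case: (enum 'I_(2 * j)) => [|y t] /=; first by lia.
  by move=> _ ->.
have ss : size s = (2 * j).-1 by rewrite size_behead size_enum_ord.
have nE (i : 'I_(2 * j)) : nth x0 (x0 :: s) i = i by rewrite -es nth_ord_enum.
have nS (i : nat) (il : (i.+1 < 2 * j)%N) : nth x0 s i = Ordinal il by rewrite -[LHS]/(nth x0 (x0 :: s) (Ordinal il)) nE.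
have lE : last x0 s = nth x0 (x0 :: s) (size s) := esym (nth_last x0 (x0 :: s)).
have -> : rowcycle j = cycle_complex x0 s.
  apply/setP => e; apply/imsetP/idP.
    move=> [b _ ->]; rewrite oddeven_set /cycle_complex !inE.
    have [h|h] := eqVneq b.+1 (2 * j)%N.
      apply/orP; left; apply/eqP.
      have e1 : ordS b = x0 by apply: val_inj; apply: etrans (ordS_val b) _; rewrite h eqxx.
      rewrite e1; congr [set _; _]%SET.
      rewrite lE -[LHS]nE; congr nth; rewrite ss; lia.
    apply/orP; right; apply/path_edgesP; have bl := ltn_ord b.
    have h' : (b.+1 < 2 * j)%N by rewrite ltn_neqAle h.
    exists b; first by rewrite ss; lia.
    rewrite nE (nS _ h'); congr [set _; _]%SET; apply: val_inj => /=.
    by rewrite modn_small.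
  rewrite !inE => /orP[/eqP ->|/path_edgesP[i il ->]].
    have bl : ((2 * j).-1 < 2 * j)%N by lia.
    exists (Ordinal bl) => //; rewrite oddeven_set.
    have -> : ordS (Ordinal bl) = x0.
      by apply: val_inj; apply: etrans (ordS_val _) _; rewrite /= prednK // eqxx.
    by congr [set _; _]%SET; rewrite lE -[RHS]nE ss.
  have il' : (i.+1 < 2 * j)%N by move: il; rewrite ss; lia.
  exists (Ordinal (ltnW il')) => //; rewrite oddeven_set (nS _ il').
  rewrite -[nth _ _ _]/(nth x0 (x0 :: s) (Ordinal (ltnW il'))) nE.
  congr [set _; _]%SET; apply: val_inj => /=; by rewrite modn_small.
apply: cycle_circle; last by rewrite ss; lia.
by rewrite -es enum_uniq.
Qed.

Lemma colcycle_circle (R : realType) :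
  homeomorphic (set_type (realization R colcycle)) (set_type (circle R)).
Proof.
pose e0 : 'I_4 := @Ordinal 4 0 isT; pose e1 : 'I_4 := @Ordinal 4 1 isT.
pose e2 : 'I_4 := @Ordinal 4 2 isT; pose e3 : 'I_4 := @Ordinal 4 3 isT.
pose c0 : 'I_3 := @Ordinal 3 0 isT; pose c1 : 'I_3 := @Ordinal 3 1 isT.
pose c2 : 'I_3 := @Ordinal 3 2 isT.
have [m0 m1 m2] : [/\ emb c0 = e0, emb c1 = e1 & emb c2 = e2] by split; apply: val_inj.
have -> : colcycle = cycle_complex e0 [:: e1; e2].
  apply/setP => e; rewrite /cycle_complex /= !inE orbF; apply/existsP/or3P.
    move=> [c /existsP[c' /andP[cc /eqP ->]]].
    have cE (x : 'I_3) : [\/ x = c0, x = c1 | x = c2].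
      by case: x => [[|[|[|//]]] h]; [apply: Or31|apply: Or32|apply: Or33]; apply: val_inj.
    case: (cE c) cc => ->; case: (cE c') => -> //; rewrite ?m0 ?m1 ?m2 => _.
    - by apply: Or32.
    - by apply: Or31; rewrite finset.setUC.
    - by apply: Or33.
  case=> /eqP ->.
  - by exists c0; apply/existsP; exists c2; rewrite m0 m2 finset.setUC eqxx.
  - by exists c0; apply/existsP; exists c1; rewrite m0 m1 eqxx.
  - by exists c1; apply/existsP; exists c2; rewrite m1 m2 eqxx.
apply: homeo_trans (_ : homeomorphic _ (set_type (realization R (cycle_complex e0 [:: e3; e1; e2])))) _.
  by apply: homeo_sym; apply: cycle_insert.
exact: cycle_circle.
Qed.

Lemma grid_complex_torus (R : realType) n j (g : 'I_(2 * j) -> 'I_3 -> 'I_n) : (2 <= j)%N ->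
  (forall b b' e e', g b e = g b' e' -> b = b' /\ e = e') ->
  homeomorphic (set_type (realization R (grid_complex g))) (torus R).
Proof.
move=> j2 gi; apply: homeo_trans (grid_complex_prod R gi) _.
by apply: homeo_prod; [apply: rowcycle_circle|apply: colcycle_circle].
Qed.

(** * The torus *)

Section Hypergraph.
Variables (n : nat) (H : {set {set 'I_n}}).
Hypothesis H3 : uniform3 H.
Local Notation V := 'I_n.
Local Notation X := {ffun 'I_3 -> V}.

Definition edge (a b c : V) : bool := [set a; b; c]%SET \in H.

Lemma edgeCA a b c : edge a b c = edge b a c.
Proof. by rewrite /edge [X in X :|: _]finset.setUC. Qed.

Lemma edgeAC a b c : edge a b c = edge a c b.
Proof. by rewrite /edge finset.setUAC. Qed.

Lemma edge_neq a b : edge a b b = false.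
Proof.
apply/negP => /H3; rewrite finset.setUC finset.setUCA finset.setUid finset.cards2.
by case: (_ != _).
Qed.

Definition clink (a a' : V) : rel V := fun x y => edge a x y && edge a' x y.

Lemma clink_sym a a' : symmetric (clink a a').
Proof. by move=> x y; rewrite /clink edgeAC (edgeAC a'). Qed.

Lemma clink_irr a a' : irreflexive (clink a a').
Proof. by move=> x; rewrite /clink edge_neq. Qed.

Lemma lens_sub a a' x s : path (clink a a') x s -> lens a a' x s \subset H.
Proof.
elim: s x => [|y s IH] x /=; first by rewrite finset.sub0set.
move=> /andP[/andP[h1 h2] /IH h]; rewrite finset.subUset h andbT.
by apply/fintype.subsetP => e; rewrite !inE => /orP[]/eqP ->.
Qed.

Definition states : {set X} := [set x : X | edge (x 0) (x 1) (x 2)]%SET.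

Lemma statesP x c : x \in states -> edge (x c) (x (c + 1)) (x (c + 2)).
Proof.
rewrite inE => h; case: c => [[|[|[|//]]] hc].
- have -> : Ordinal hc = 0 by apply: val_inj.
  by rewrite !add0r.
- have -> : Ordinal hc = 1 by apply: val_inj.
  have -> : 1 + 1 = 2 :> 'I_3 by apply: val_inj.
  have -> : 1 + 2 = 0 :> 'I_3 by apply: val_inj.
  by rewrite edgeAC edgeCA.
- have -> : Ordinal hc = 2 by apply: val_inj.
  have -> : 2 + 1 = 0 :> 'I_3 by apply: val_inj.
  have -> : 2 + 2 = 1 :> 'I_3 by apply: val_inj.
  by rewrite edgeCA edgeAC.
Qed.

Lemma card_states : (#|H| <= #|states|)%N.
Proof.
pose f (x : X) := [set x 0; x 1; x 2]%SET.
apply: leq_trans (leq_imset_card f (mem states)).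
apply/subset_leq_card/fintype.subsetP => e eH; apply/imsetP.
have := H3 eH; rewrite cardE; case es: (enum e) => [|a [|b [|c [|? ?]]]] //= _.
pose x : X := [ffun i : 'I_3 => nth a [:: a; b; c] i].
have fx : f x = e.
  apply/setP => v; rewrite -[RHS]mem_enum es !inE /f /x !ffunE /=.
  by rewrite orbA.
by exists x => //; rewrite inE /edge -/(f x) fx.
Qed.

Variables (q M : nat).

(** A step from [x] to itself counts as bad, since each step has to bring in another vertex. *)
Definition gstep (c : 'I_3) (x y : X) : bool :=
  (x c != y c) && ~~ fragile q.+1 M (clink (x c) (y c)) (x (c + 1)) (x (c + 2)).

Lemma gstep_sym c (x y : X) : off c x = off c y -> gstep c x y = gstep c y x.
Proof.
rewrite /off => -[h1 h2]; rewrite /gstep eq_sym h1 h2; congr (_ && ~~ _).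
by apply: eq_fragile => u v; rewrite /clink andbC.
Qed.

(** For each coordinate [c], the pairs with [x = y] number at most [n^3]; any other bad pair is
    given by two vertices [a], [a'] and a fragile edge of their common link, [n^2] times [O(n)]
    possibilities. *)
Lemma bad_count_states : (bad_count gstep states <= 3 * ((2 * (M * q.+1 ^ 3)).+1 * n ^ 3))%N.
Proof.
rewrite -[X in (X * _)%N](card_ord 3) -sum_nat_const; apply: leq_sum => c _.
pose B := badpairs gstep states c.
pose D := [set p in B | p.1 c == p.2 c]%SET.
rewrite -(finset.cardsID D B) mulSn; apply: leq_add.
  have -> : (n ^ 3)%N = #|X| by rewrite card_ffun !card_ord.
  have fi : {in B :&: D &, injective (fun p : X * X => p.1)}.
    move=> [x y] [x' y']; rewrite !inE /= => /and3P[/and4P[_ _ /eqP p1 _] _ /eqP e1].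
    move=> /and3P[/and4P[_ _ /eqP p2 _] _ /eqP e2] e; subst x'.
    have -> : y = x by apply: off_inj p1 _.
    by have -> : y' = x by apply: off_inj p2 _.
  by rewrite -(card_in_imset fi) max_card.
pose f (p : X * X) := (p.1 c, p.2 c, (p.1 (c + 1), p.1 (c + 2))).
have fi : {in B :\: D &, injective f}.
  move=> [x y] [x' y']; rewrite !inE /= => /and3P[_ _ /and3P[_ /eqP p1 _]].
  move=> /and3P[_ _ /and3P[_ /eqP p2 _]] [/= h1 h2 h3 h4].
  have e1 : x = x' by apply: (@off_inj _ c) => //; rewrite /off h3 h4.
  by rewrite e1 in p1 *; congr pair; apply: (@off_inj _ c) => //; rewrite p1 p2.
rewrite -(card_in_imset fi).
pose C (a a' : V) := [set p : V * V | clink a a' p.1 p.2 && fragile q.+1 M (clink a a') p.1 p.2]%SET.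
apply: leq_trans (_ : #|[set t : V * V * (V * V) | t.2 \in C t.1.1 t.1.2]%SET| <= _)%N.
  apply/subset_leq_card/fintype.subsetP => _ /imsetP[[x y] + ->].
  rewrite !inE /= negb_and => /and3P[+ xS /and3P[yS /eqP p ng]].
  rewrite xS yS p eqxx ng /= => xy.
  have x3 := statesP c (_ : x \in states); have y3 := statesP c (_ : y \in states).
  move: ng; rewrite /gstep xy negbK => ->; rewrite andbT /clink x3 ?inE //=.
  by case: p => <- <-; apply: y3; rewrite inE.
rewrite -sum1_card big_mkcond /=.
rewrite (eq_bigr (fun t : V * V * (V * V) => if t.2 \in C t.1.1 t.1.2 then 1%N else 0%N)); last first.
  by move=> t _; rewrite inE.
rewrite -(pair_bigA _ (fun t1 t2 => if t2 \in C t1.1 t1.2 then 1%N else 0%N)) /=.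
apply: leq_trans (_ : \sum_(t : V * V) 2 * (M * q.+1 ^ 3) * n <= _)%N.
  apply: leq_sum => -[a a'] _ /=; rewrite -big_mkcond sum1_card.
  by apply: fragile_count => //; [apply: clink_sym|apply: clink_irr].
by rewrite sum_nat_const card_prod !card_ord; apply: eq_leq; rewrite !expnS expn0; ring.
Qed.

Lemma fibre_count_states : (fibre_count states <= 3 * n ^ 2)%N.
Proof.
rewrite -[X in (X * _)%N](card_ord 3) -sum_nat_const; apply: leq_sum => c _.
by apply: leq_trans (max_card _) _; rewrite card_prod !card_ord expnS expn1.
Qed.

End Hypergraph.

Lemma ord3_neq (c : 'I_3) : [/\ c + 1 != c, c + 2 != c & c + 1 != c + 2].
Proof. by case: c => [[|[|[|//]]] hc]; split. Qed.

(** * Placing lenses on a conflict-free grid *)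

Section GridTorus.
Variables (R : realType) (n : nat) (H : {set {set 'I_n}}) (q j0 : nat).
Hypotheses (j2 : (2 <= j0)%N) (jq : (6 * j0 <= q)%N).
Local Notation V := 'I_n.
Local Notation P := (2 * j0)%N.
Variable g : nat -> 'I_3 -> V.
Hypothesis gP : forall e, g P e = g 0%N e.
Hypothesis ginj : forall b b' e e', (b < P)%N -> (b' < P)%N -> g b e = g b' e' ->
  b = b' /\ e = e'.
(** The vertex standing in coordinate [e] at the moment when [c] is replaced in block [b]. *)
Let lnk b (c e : 'I_3) := g (if (e < c)%N (+) odd b then b.+1 else b) e.
Hypothesis ggood : forall b c, (b < P)%N ->
  ~~ fragile q.+1 (q.+1 ^ q.+2) (clink H (g b c) (g b.+1 c)) (lnk b c (c + 1)) (lnk b c (c + 2)).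

Let gI (b : 'I_P) e := g b e.

Let gS (b : 'I_P) e : g b.+1 e = gI (ordS b) e.
Proof. by rewrite /gI ordS_val; case: eqP => // ->. Qed.

Let gIinj b b' e e' : gI b e = gI b' e' -> b = b' /\ e = e'.
Proof. by move=> /ginj[] // h ->; split=> //; apply: val_inj. Qed.

Let lnkE (b : 'I_P) (c e : 'I_3) :
  lnk b c e = gI (if (e < c)%N then oddrow b else evenrow b) e.
Proof.
rewrite /lnk /oddrow /evenrow; case: (e < c)%N; case ob: (odd b) => //=; exact: gS.
Qed.

(** The [6 * j0] steps carry one lens each and the grid has as many vertices, so [q] bounds both
    sizes needed for [choose_colouring]. Distinct colours keep the interiors of the lenses
    disjoint. *)
Lemma grid_contains_torus : contains_triangulation R H (torus R).
Proof.
pose I := ('I_P * 'I_3)%type.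
pose a (i : I) := gI i.1 i.2; pose a' (i : I) := gI (ordS i.1) i.2.
pose b (i : I) := lnk i.1 i.2 (i.2 + 1); pose c (i : I) := lnk i.1 i.2 (i.2 + 2).
have cI : (#|{: I}| = 6 * j0)%N by rewrite card_prod !card_ord; lia.
(* Shifted by one: colour 0 is reserved for the grid, so the interiors of the lenses avoid it. *)
pose col (i : I) : 'I_q.+1 := inord (enum_rank i).+1.
have colE i : col i = (enum_rank i).+1 :> nat.
  by rewrite inordK // ltnS; apply: leq_trans (ltn_ord _) _; rewrite cI.
have col_inj : injective col.
  by move=> i i' /(congr1 val); rewrite /= !colE => -[/val_inj/enum_rank_inj].
pose Z := [set gI i.1 i.2 | i : I]%SET.
have gZ r e : gI r e \in Z by apply/imsetP; exists (r, e).
have aZ i : a i \in Z by apply: gZ.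
have a'Z i : a' i \in Z by apply: gZ.
have bZ i : b i \in Z by rewrite /b lnkE; apply: gZ.
have cZ i : c i \in Z by rewrite /c lnkE; apply: gZ.
have rS (r : 'I_P) : r != ordS r.
  apply/eqP => /(congr1 (@nat_of_ord P)); rewrite ordS_val.
  by have := ltn_ord r; case: eqP; lia.
have u4 i : uniq [:: a i; a' i; b i; c i].
  have [n1 n2 n3] := ord3_neq i.2.
  rewrite /= !inE !negb_or andbT; apply/and3P; split.
  - apply/and3P; split; apply/eqP; rewrite /a /a' /b /c ?lnkE => /gIinj[h1 h2].
    + by have := rS i.1; rewrite {1}h1 eqxx.
    + by rewrite -h2 eqxx in n1.
    + by rewrite -h2 eqxx in n2.
  - apply/andP; split; apply/eqP; rewrite /a /a' /b /c ?lnkE => /gIinj[h1 h2].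
    + by rewrite -h2 eqxx in n1.
    + by rewrite -h2 eqxx in n2.
  - by apply/eqP; rewrite /b /c !lnkE => /gIinj[h1 h2]; rewrite h2 eqxx in n3.
have [|||chi [chiZ chil]] := @choose_colouring n q I (fun i => clink H (a i) (a' i)) b c col Z.
- by rewrite cI.
- by apply: leq_trans (leq_imset_card _ _) _; rewrite cI; apply: leq_trans jq _.
- by move=> i; rewrite /a' -gS; apply: ggood.
have bc i : b i != c i by have := u4 i; rewrite /= !inE !negb_or !andbT => /and3P[].
have pth i : exists ps : seq V, [/\ ps != [::], path (clink H (a i) (a' i)) (b i) (rcons ps (c i)),
    uniq ps & {subset ps <= colour_class chi (col i)}].
  by have [ps [h1 h2 h3 [h4 _ _]]] := linked_path (bc i) (chil i); exists ps.
have [ps psP] := choice pth.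
have fresh i j x : x \in ps i -> x \notin [:: a j; a' j; b j; c j].
  move=> xi; have [_ _ _ /(_ x xi)] := psP i; rewrite inE => /eqP cx.
  have nZ : x \notin Z.
    by apply/negP => /chiZ; rewrite cx => /(congr1 val); rewrite /= colE.
  by rewrite !inE !negb_or; apply/and4P; split; apply: contraNneq nZ => ->.
have disj i j x : i != j -> x \in ps i -> x \notin ps j.
  move=> ij xi; apply/negP => xj; have [_ _ _ /(_ x xi)] := psP i; have [_ _ _ /(_ x xj)] := psP j.
  rewrite !inE => /eqP -> /eqP /col_inj e; by rewrite e eqxx in ij.
exists (\bigcup_(i : I) lens (a i) (a' i) (b i) (rcons (ps i) (c i)))%SET.
  apply/finset.bigcupsP => i _; apply: lens_sub; by have [] := psP i.
apply: homeo_trans (_ : homeomorphic _ (set_type (realization R (grid_complex gI)))) _; last first.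
  exact: grid_complex_torus.
have -> : grid_complex gI = (\bigcup_(i : I) [set [set a i; a' i; b i]; [set a i; a' i; c i]])%SET.
  have triE (r : 'I_P) (k e : 'I_3) : grid_triangle gI r k e = [set gI r k; gI (ordS r) k; lnk r k e]%SET.
    rewrite /grid_triangle lnkE /oddrow /evenrow; case: (odd r) => //.
    by rewrite [X in X :|: _ = _]finset.setUC.
  apply/setP => s; apply/idP/finset.bigcupP.
    rewrite inE => /existsP[r /existsP[k /existsP[e /andP[ek /eqP ->]]]].
    exists (r, k) => //; rewrite triE !inE /a /a' /b /c /=.
    by case: (ord3_cases k e) ek => ->; rewrite ?eqxx ?orbT.
  move=> [[r k] _]; rewrite !inE /a /a' /b /c /= => h.
  have [n1 n2 n3] := ord3_neq k.
  apply/existsP; exists r; apply/existsP; exists k.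
  case/orP: h => /eqP ->; apply/existsP; [exists (k + 1)|exists (k + 2)];
    by rewrite triE eqxx ?n1 ?n2.
apply: lens_family_homeo => //.
- by move=> i; have [] := psP i.
- by move=> i; have [] := psP i.
(* The diagonal of a piece joins two consecutive rows in colour [k]. Another piece contains two
   vertices of one colour only in its own colour [k'], in rows [r'] and [r' + 1]; for [r != r']
   these cannot be the same two rows of a cycle of length at least 4. *)
move=> [r k] [r' k'] t ij tj.
have [e ek te] : exists2 e, e != k' & exists r0, t = gI r0 e.
  have [n1 n2 n3] := ord3_neq k'.
  move: tj; rewrite !inE /b /c /= => /orP[]/eqP ->; rewrite lnkE.
    by exists (k' + 1) => //; eexists.
  by exists (k' + 2) => //; eexists.
case: te => r0 ->; rewrite /a /a' /= !inE; apply/negP => /andP[h1 h2].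
have in_col (x : 'I_P) : [|| gI x k == gI r' k', gI x k == gI (ordS r') k' | gI x k == gI r0 e] ->
    (k = k' /\ (x = r' \/ x = ordS r')) \/ (k = e /\ x = r0).
  by case/or3P => /eqP/gIinj[-> ->]; auto.
have P4 : (4 <= P)%N by lia.
case: (in_col _ h1) => [[kk hx]|[ke hx]]; case: (in_col _ h2) => [[kk' hy]|[ke' hy]].
- have rr : r != r' by apply: contraNneq ij => ->; rewrite kk.
  case: hx => hx; first by rewrite hx eqxx in rr.
  case: hy => hy; last by case/eqP: rr; apply: (@ordS_inj P).
  move/(congr1 (@nat_of_ord P)): hx; move/(congr1 (@nat_of_ord P)): hy; rewrite !ordS_val.
  have := ltn_ord r; have := ltn_ord r'.
  by case: eqP; case: eqP; lia.
- by rewrite -kk ke' eqxx in ek.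
- by rewrite -kk' ke eqxx in ek.
- by have := rS r; rewrite {1}hx -hy eqxx.
Qed.

End GridTorus.

(** Here [t] is [n^(1/4)]. With fibres of size [d = la^2 * t^2], the bad pairs contribute
    [6 K t^10 / la^2] and the fibres [3 la^2 t^10] to the potential of [stable_subset]; their sum is
    the hypothesis on [#|H|]. *)
Lemma torus_of_many_edges (R : realType) (q : nat) (la t : R) (n : nat) (H : {set {set 'I_n}}) :
  (78 <= q)%N -> la = q%:R ^+ 2 * 128 -> 0 < t -> n%:R = t ^+ 4 -> uniform3 H ->
  (6 * (2 * (q.+1 ^ q.+2 * q.+1 ^ 3)).+1%:R / la ^+ 2 + 3 * la ^+ 2) * t ^+ 10 < #|H|%:R ->
  contains_triangulation R H (torus R).
Proof.
move=> q78 laE t0 nt H3 big.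
have q0 : 0 < q%:R :> R by rewrite ltr0n; apply: leq_trans q78.
have la0 : 0 < la by rewrite laE mulr_gt0 // exprn_gt0.
pose M := (q.+1 ^ q.+2)%N; pose K := (2 * (M * q.+1 ^ 3)).+1.
pose d := la ^+ 2 * t ^+ 2; pose sigma := (la * t)^-1.
have d0 : 0 < d by rewrite mulr_gt0 ?exprn_gt0.
have s0 : 0 <= sigma by rewrite invr_ge0 ltW // mulr_gt0.
have s2 : sigma ^+ 2 = d^-1 by rewrite /sigma exprVn exprMn.
pose G := gstep H q M.
have pot : 2 / d * (bad_count G (states H))%:R + d * (fibre_count (states H))%:R < #|states H|%:R.
  apply: lt_le_trans (_ : #|H|%:R <= _); last by rewrite ler_nat card_states.
  apply: le_lt_trans big.
  have b1 : (bad_count G (states H))%:R <= 3 * (K%:R * t ^+ 12) :> R.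
    by have := bad_count_states H3 q M; rewrite -(ler_nat R) natrM [(_ * n ^ 3)%:R]natrM natrX nt -exprM.
  have p1 : (fibre_count (states H))%:R <= 3 * t ^+ 8 :> R.
    by have := fibre_count_states H; rewrite -(ler_nat R) natrM natrX nt -exprM.
  have i0 : 0 <= 2 / d by rewrite divr_ge0 // ltW.
  apply: le_trans (lerD (ler_wpM2l i0 b1) (ler_wpM2l (ltW d0) p1)) _.
  rewrite le_eqVlt; apply/orP; left; apply/eqP; rewrite -/M -/K /d.
  by field; rewrite !gt_eqF.
have [S [Ssub S0 Sst]] := stable_subset d0 pot.
have small : (q%:R ^+ 2 * sigma) ^+ 12 * #|{ffun 'I_3 -> 'I_n}|%:R < 2^-1 ^+ 78 :> R.
  rewrite card_ffun !card_ord natrX nt -exprM.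
  (* The factor [128 = 2^7] of [la] leaves [2^(-84)] after twelve steps, and the excess of 84 over
     78 makes the inequality strict; the powers of [t] cancel. *)
  have -> : q%:R ^+ 2 * sigma = 2^-1 ^+ 7 * t^-1.
    rewrite /sigma laE; have -> : (128 : R) = 2 ^+ 7 by rewrite -natrX.
    by field; rewrite !gt_eqF.
  rewrite exprMn -exprM [t^-1 ^+ _]exprVn -mulrA mulVf ?mulr1 ?expf_neq0 ?gt_eqF //.
  rewrite (_ : (7 * 12 = 78 + 6)%N) // exprD -[X in _ < X]mulr1.
  rewrite ltr_pM2l ?exprn_gt0 ?invr_gt0 //.
  by rewrite exprn_ilt1 ?invr_ge0 // invf_lt1 // ltr1n.
have Gs c x y : off c x = off c y -> G c x y = G c y x by apply: gstep_sym.
have [j [g [/andP[j2 j13] gP ginj gg]]] := grid_exists Gs d0 S0 Sst s0 s2 q78 small.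
have jq : (6 * j <= q)%N by apply: leq_trans q78; lia.
apply: (grid_contains_torus R j2 jq gP ginj).
move=> b c bl; have [x [y [xS yS pxy gxy [xc yc xe]]]] := gg b c bl.
have [n1 n2 n3] := ord3_neq c.
by move: gxy; rewrite /G /gstep xc yc !xe // => /andP[].
Qed.

Theorem theorem1p1 (R : realType) :
  exists2 c : R, 0 < c &
    forall (n : nat) (H : {set {set 'I_n}}),
      (0 < n)%N -> uniform3 H ->
      ~ contains_triangulation R H (torus R) ->
      #|H|%:R <= c * n%:R `^ (5 / 2).
Proof.
(* The value 78 is hidden behind an existential so that the enormous power of [q + 1] in the
   constant is never evaluated. *)
have [q q78] : exists q : nat, (78 <= q)%N by exists 78%N.
pose la : R := q%:R ^+ 2 * 128.
have q0 : 0 < q%:R :> R by rewrite ltr0n; apply: leq_trans q78.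
have la0 : 0 < la by rewrite mulr_gt0 // exprn_gt0.
exists (6 * (2 * (q.+1 ^ q.+2 * q.+1 ^ 3)).+1%:R / la ^+ 2 + 3 * la ^+ 2).
  by rewrite addr_gt0 ?mulr_gt0 ?invr_gt0 ?exprn_gt0.
move=> n H n0 H3 noT.
(* A fourth root of [n] turns every exponent in sight, 5/2 included, into a natural number. *)
pose t : R := Num.sqrt (Num.sqrt n%:R).
have t0 : 0 < t by rewrite !sqrtr_gt0 ltr0n.
have nt : n%:R = t ^+ 4.
  by rewrite (exprM t 2 2) sqr_sqrtr ?sqrtr_ge0 // sqr_sqrtr.
have -> : n%:R `^ (5 / 2) = t ^+ 10.
  rewrite nt -(powR_mulrn 4 (ltW t0)) -powRrM.
  have -> : 4 * (5 / 2) = 10%:R :> R by lra.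
  by rewrite powR_mulrn // ltW.
rewrite leNgt; apply/negP => big; apply: noT.
exact: (torus_of_many_edges q78 (erefl la) t0 nt H3 big).
Qed.
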